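(* Let $N\ge1$, let $W=\begin{pmatrix}0&I_N\\ I_N&0\end{pmatrix}$, and assume $A\in G\mathcal{B}^{2N\times 2N}$. (a) The operator $\Phi(A)$ is invertible if and only if the function $F(t)=A(t)W\widetilde{A}^{-1}(t)$ admits an antisymmetric factorization with characteristic pairs $(\varrho_k,\kappa_k)$ which are all contained in the set $$\{(-1,-1),\,(-1,0),\,(1,0),\,(1,1)\}.$$ (b) The operator $\Psi(A)$ is invertible if and only if the function $G(t)=\widetilde{A}^{-1}(t)WA(t)$ admits an antisymmetric factorization with characteristic pairs $(\varrho_k,\kappa_k)$ which are all contained in the set $$\{(1,-1),\,(-1,0),\,(1,0),\,(-1,1)\}.$$
   Context: $\mathbb{T}$ is the unit circle in $\mathbb{C}$, $L^2=L^2(\mathbb{T})$; $f_n$ denotes the $n$-th Fourier coefficient of $f$. $H^2=\{f\in L^2: f_n=0 \text{ for } n<0\}$, $\overline{H^2}=\{f\in L^2: f_n=0\text{ for }n>0\}$, $H^\infty=L^\infty(\mathbb{T})\cap H^2$, $\overline{H^\infty}=L^\infty(\mathbb{T})\cap\overline{H^2}$. $GB$ denotes the group of invertible elements of a Banach algebra $B$. For a function $A$ on $\mathbb{T}$, $\widetilde{A}(t)=A(1/t)$ and $\widetilde{A}^{-1}(t)=(A(1/t))^{-1}$. On vector-valued $L^2$ spaces (any number of components): $M(A)$ is multiplication by the matrix function $A$; $P:\sum_{n\in\mathbb{Z}}f_nt^n\mapsto\sum_{n\ge0}f_nt^n$; $Q=I-P$; $(Jf)(t)=t^{-1}f(1/t)$.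 For $A\in L^\infty(\mathbb{T})^{2N\times2N}$ define the following operators on $(L^2)^N$, where rows act $(L^2)^{2N}\to(L^2)^N$ and columns act $(L^2)^N\to(L^2)^{2N}$: $$\Phi(A)=(P,\,JP)M(A)\begin{pmatrix}I\\ J\end{pmatrix},\quad \Psi(A)=(I,\,J)M(A)\begin{pmatrix}P\\ PJ\end{pmatrix}.$$ If $A=\begin{pmatrix}a&b\\ c&d\end{pmatrix}$ with $N\times N$ blocks, then $\Phi(A)=PM(a)+PJM(\widetilde b)+QJM(c)+QM(\widetilde d)$ and $\Psi(A)=M(a)P+M(b)JQ+M(\widetilde c)JP+M(\widetilde d)Q$. Standing assumptions on $\mathcal{B}$: $\mathcal{B}$ is a Banach algebra of functions on $\mathbb{T}$ (for example the Wiener algebra or the Hölder algebras $C^\alpha$, $0<\alpha<1$) such that: (a) $\mathcal{B}$ is an inverse closed Banach subalgebra of $C(\mathbb{T})$ (i.e. $b\in\mathcal{B}$ invertible in $C(\mathbb{T})$ implies $b^{-1}\in\mathcal{B}$); (b) $\mathcal{B}$ contains all trigonometric polynomials; (c) $a\in\mathcal{B}$ implies $\widetilde a\in\mathcal{B}$; (d) for each $n$, each $A\in G\mathcal{B}^{n\times n}$ can be written as $A=A_-\Lambda A_+$ with $\Lambda(t)=\mathrm{diag}(t^{\kappa_1},\dots,t^{\kappa_n})$, $\kappa_j\in\mathbb{Z}$, $A_\pm\in G\mathcal{B}_\pm^{n\times n}$, where $\mathcal{B}_+=\mathcal{B}\cap H^\infty$ and $\mathcal{B}_-=\mathcal{B}\cap\overline{H^\infty}$.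 An antisymmetric factorization of $F\in G\mathcal{B}^{n\times n}$ (within $\mathcal{B}$) is a representation $F(t)=F_-(t)D(t)\widetilde{F}_-^{-1}(t)$ with $F_-\in G\mathcal{B}_-^{n\times n}$ and $D(t)=\mathrm{diag}(\varrho_1t^{\kappa_1},\dots,\varrho_nt^{\kappa_n})$, $\varrho_k\in\{-1,1\}$, $\kappa_k\in\mathbb{Z}$; equivalently (with $F_+=\widetilde{F}_-^{-1}$), $F=\widetilde{F}_+^{-1}DF_+$ with $F_+\in G\mathcal{B}_+^{n\times n}$. The pairs $(\varrho_k,\kappa_k)$ are its characteristic pairs. *)

(* Defs.v *)
From HB Require Import structures.
From mathcomp Require Import all_boot all_order all_algebra.
From mathcomp Require Import complex ring lra.
From mathcomp Require Import all_classical all_reals all_analysis.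
From mathcomp Require Import measurable_realfun.

Set Implicit Arguments.
Unset Strict Implicit.
Unset Printing Implicit Defensive.

Import Order.TTheory GRing.Theory Num.Theory.
Import numFieldNormedType.Exports.
Import ComplexField.Normc.

Local Open Scope classical_set_scope.
Local Open Scope complex_scope.
Local Open Scope ring_scope.

Section Circle.
Variable R : realType.

Record circle := Circle { cval :> R[i]; cvalP : `|cval| == 1 }.

HB.instance Definition _ := [isSub for cval].
HB.instance Definition _ := [Choice of circle by <:].

HB.instance Definition _ := Topological.copy circle
  (initial_topology (cval : circle -> (R[i] : numFieldType))).

Fact circle_inv_subproof (t : circle) : `|(t : R[i])^-1| == 1.
Proof. by rewrite normfV (eqP (cvalP t)) invr1. Qed.
Definition cinv (t : circle) : circle := Circle (circle_inv_subproof t).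

Fact circle_expi_subproof (x : R) : `|cos x +i* sin x| == 1.
Proof. by rewrite normc_def/= cos2Dsin2 sqrtr1. Qed.
Definition expi (x : R) : circle := Circle (circle_expi_subproof x).

HB.instance Definition _ := isPointed.Build circle (expi 0).

HB.instance Definition _ := @isMeasurable.Build default_measure_display circle
  <<s open >> (@sigma_algebra0 _ setT open) (@sigma_algebraC circle open)
  (@sigma_algebra_bigcup _ setT open).

Lemma cos_sin_continuous :
  continuous (fun x : R => (cos x +i* sin x : (R[i] : numFieldType))).
Proof.
move=> x; apply/cvgrPdist_lt => -[e e'] /=; rewrite ltcE/= => /andP[/eqP -> e0].
have e20 : 0 < e / 2 by rewrite divr_gt0.
have /cvgrPdist_lt/(_ _ e20) hc := @continuous_cos R x.
have /cvgrPdist_lt/(_ _ e20) hs := @continuous_sin R x.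
near=> y.
rewrite normc_def ltcR/=.
have hcy : `|cos x - cos y| < e / 2 by near: y; exact: hc.
have hsy : `|sin x - sin y| < e / 2 by near: y; exact: hs.
rewrite -(ltr_pXn2r (n := 2)) ?nnegrE ?sqrtr_ge0 ?ltW// sqr_sqrtr ?addr_ge0 ?sqr_ge0//.
rewrite -(real_normK (num_real (cos x - cos y))) -(real_normK (num_real (sin x - sin y))).
have := normr_ge0 (cos x - cos y); have := normr_ge0 (sin x - sin y).
move: hcy hsy; set a := `|_|; set b := `|_| => *; nra.
Unshelve. all: by end_near. Qed.

Lemma measurable_expi :
  measurable_fun [set: measurableTypeR R] (expi : measurableTypeR R -> circle).
Proof.
apply: (measurability (@open circle)) => // _ [_ [U oU <-] <-].
rewrite setTI; apply: open_measurable.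
rewrite (_ : _ @^-1` _ = (fun x : R => cos x +i* sin x) @^-1` U)//.
by move/continuousP : cos_sin_continuous; apply.
Qed.

Fact pi2_gt0 : 0 < pi *+ 2 :> R.
Proof. by rewrite mulrn_wgt0 ?pi_gt0. Qed.

(** Normalized arc length. *)
Definition arc : set circle -> \bar R :=
  pushforward (uniform_prob pi2_gt0) (expi : measurableTypeR R -> circle).

Let arc0 : arc set0 = 0%E.
Proof. by rewrite /arc /pushforward preimage_set0 measure0. Qed.

Let arc_ge0 A : (0 <= arc A)%E.
Proof. by rewrite /arc /pushforward measure_ge0. Qed.

Let arc_sigma_additive : semi_sigma_additive arc.
Proof.
move=> F mF tF mUF; rewrite /arc /pushforward preimage_bigcup.
have mexpi A : measurable A -> measurable (expi @^-1` A : set (measurableTypeR R)).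
  by move=> mA; rewrite -[X in measurable X]setTI; exact: measurable_expi.
apply: measure_semi_sigma_additive.
- by move=> n; exact: mexpi.
- apply/trivIsetP => /= i j _ _ ij; rewrite -preimage_setI.
  by move/trivIsetP : tF => /(_ _ _ _ _ ij) ->//; rewrite preimage_set0.
- by rewrite -preimage_bigcup; exact: mexpi.
Qed.

HB.instance Definition _ := isMeasure.Build _ _ _ arc
  arc0 arc_ge0 arc_sigma_additive.

Let arc_setT : arc setT = 1%E.
Proof. by rewrite /arc /pushforward preimage_setT probability_setT. Qed.

HB.instance Definition _ := Measure_isProbability.Build _ _ _ arc arc_setT.

End Circle.

Arguments arc {R}.

(** Elements of L^p are represented by functions; equality in L^p is equality
    almost everywhere. *)

Section FunctionSpaces.
Variable R : realType.
Implicit Types f g : circle R -> R[i].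

Definition ccontinuous f :=
  continuous (f : circle R -> (R[i] : numFieldType)).

Definition cmeasurable f :=
  measurable_fun setT (fun t => complex.Re (f t)) /\
  measurable_fun setT (fun t => complex.Im (f t)).

Definition Lp (p : \bar R) : set (circle R -> R[i]) :=
  [set f | cmeasurable f /\ (Lnorm arc p (fun t => (normc (f t))%:E) < +oo)%E].

Definition cintegral f : R[i] :=
  Rintegral arc setT (fun t => complex.Re (f t)) +i*
  Rintegral arc setT (fun t => complex.Im (f t)).

Definition fourier f (n : int) : R[i] :=
  cintegral (fun t => f t * (t : R[i]) ^ (- n)).

Definition H2 : set (circle R -> R[i]) :=
  [set f | Lp 2%:E f /\ forall n : int, n < 0 -> fourier f n = 0].
Definition H2bar : set (circle R -> R[i]) :=
  [set f | Lp 2%:E f /\ forall n : int, 0 < n -> fourier f n = 0].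
Definition Hoo := Lp +oo%E `&` H2.
Definition Hoobar := Lp +oo%E `&` H2bar.

(** The Riesz projection is determined up to almost everywhere equality by the
    Fourier coefficients of the result (Riesz-Fischer); [xget] chooses a
    representative. *)
Definition riesz f : circle R -> R[i] :=
  xget (fun=> 0)
    [set g | Lp 2%:E g /\
             forall n : int, fourier g n = if 0 <= n then fourier f n else 0].

End FunctionSpaces.

Section Operators.
Variable R : realType.

Definition vfun n := circle R -> 'cV[R[i]]_n.

Definition L2 n : set (vfun n) :=
  [set f | forall i, Lp 2%:E (fun t => f t i 0)].

Definition L2norm n (f : vfun n) : \bar R :=
  Lnorm arc 2%:E (fun t => (Num.sqrt (\sum_i normc (f t i 0) ^+ 2))%:E).

Definition aeq n (f g : vfun n) := {ae arc, forall t, f t = g t}.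

(** Boundedness and linearity up to [aeq] imply compatibility with [aeq]. *)
Definition bounded_operator m n (S : vfun m -> vfun n) :=
  [/\ forall f, L2 f -> L2 (S f),
      forall (a : R[i]) f g, L2 f -> L2 g ->
        aeq (S (fun t => a *: f t + g t)) (fun t => a *: S f t + S g t) &
      exists M : R, forall f, L2 f -> (L2norm (S f) <= M%:E * L2norm f)%E].

Definition invertible_operator n (S : vfun n -> vfun n) :=
  bounded_operator S /\
  exists2 S' : vfun n -> vfun n, bounded_operator S' &
    forall f, L2 f -> aeq (S' (S f)) f /\ aeq (S (S' f)) f.

Definition opM m n (A : circle R -> 'M[R[i]]_(m, n)) (f : vfun n) : vfun m :=
  fun t => A t *m f t.

Definition opP n (f : vfun n) : vfun n :=
  fun t => \col_i riesz (fun s => f s i 0) t.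

Definition opJ n (f : vfun n) : vfun n :=
  fun t => (t : R[i])^-1 *: f (cinv t).

Definition Phi N (A : circle R -> 'M[R[i]]_(N + N)) (f : vfun N) : vfun N :=
  let h := opM A (fun t => col_mx (f t) (opJ f t)) in
  fun t => opP (fun s => usubmx (h s)) t + opJ (opP (fun s => dsubmx (h s))) t.

Definition Psi N (A : circle R -> 'M[R[i]]_(N + N)) (f : vfun N) : vfun N :=
  let h := opM A (fun t => col_mx (opP f t) (opP (opJ f) t)) in
  fun t => usubmx (h t) + opJ (fun s => dsubmx (h s)) t.

End Operators.

Section Algebras.
Variable R : realType.
Local Notation cfun := (circle R -> R[i]).

(** The norm is only constrained on [B]. Continuity of the embedding into C(T)
    is not required: evaluations are characters of [B], so it is automatic. *)
Record banach_algebra (B : set cfun) (nB : cfun -> R) : Prop := BanachAlgebra {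
  ba_zero : B (fun=> 0);
  ba_add : forall f g, B f -> B g -> B (fun t => f t + g t);
  ba_scale : forall (a : R[i]) f, B f -> B (fun t => a * f t);
  ba_mul : forall f g, B f -> B g -> B (fun t => f t * g t);
  ba_norm_ge0 : forall f, B f -> 0 <= nB f;
  ba_norm_eq0 : forall f, B f -> nB f = 0 -> f = (fun=> 0);
  ba_normD : forall f g, B f -> B g -> nB (fun t => f t + g t) <= nB f + nB g;
  ba_normZ : forall (a : R[i]) f, B f -> nB (fun t => a * f t) = normc a * nB f;
  ba_normM : forall f g, B f -> B g -> nB (fun t => f t * g t) <= nB f * nB g;
  ba_complete : forall u : nat -> cfun, (forall k, B (u k)) ->
    (forall e : R, 0 < e -> exists K, forall k l, (K <= k)%N -> (K <= l)%N ->
       nB (fun t => u k t - u l t) < e) ->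
    exists2 f, B f & (fun k => nB (fun t => u k t - f t)) @ \oo --> (0 : R)
}.

Definition mx_over (S : set cfun) n : set (circle R -> 'M[R[i]]_n) :=
  [set F | forall i j, S (fun t => F t i j)].

Definition GLmx (S : set cfun) n : set (circle R -> 'M[R[i]]_n) :=
  [set F | mx_over S F /\
    exists2 G, mx_over S G & forall t, F t *m G t = 1%:M /\ G t *m F t = 1%:M].

Definition Bplus (B : set cfun) := B `&` Hoo (R := R).
Definition Bminus (B : set cfun) := B `&` Hoobar (R := R).

Record standing_assumptions (B : set cfun) (nB : cfun -> R) : Prop :=
  StandingAssumptions {
  sa_banach : banach_algebra B nB;
  sa_continuous : forall f, B f -> ccontinuous f;
  sa_inverse_closed : forall f g, B f -> ccontinuous g ->
    (forall t, f t * g t = 1) -> B g;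
  sa_trig : forall n (c : 'I_n -> R[i]) (k : 'I_n -> int),
    B (fun t => \sum_i c i * (t : R[i]) ^ k i);
  sa_tilde : forall f, B f -> B (fun t => f (cinv t));
  sa_factorization : forall n (A : circle R -> 'M[R[i]]_n), GLmx B A ->
    exists (Am Ap : circle R -> 'M[R[i]]_n) (kappa : 'I_n -> int),
      [/\ GLmx (Bminus B) Am, GLmx (Bplus B) Ap &
          forall t, A t =
            Am t *m diag_mx (\row_j (t : R[i]) ^ kappa j) *m Ap t]
}.

(** The factors are units over [B] and the diagonal factor is a unit of trigonometric
    polynomials, so a factorization forces [F] to be a unit over [B]. *)
Definition antisym_factorization (B : set cfun) n (F : circle R -> 'M[R[i]]_n)
    (rho kappa : 'I_n -> int) :=
  (forall k, rho k \in [:: -1; 1]) /\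
  exists2 Fm : circle R -> 'M[R[i]]_n, GLmx (Bminus B) Fm &
    forall t, F t =
      Fm t *m diag_mx (\row_k ((rho k)%:~R * (t : R[i]) ^ kappa k))
           *m invmx (Fm (cinv t)).

Definition antisym_factorization_in (B : set cfun) n
    (F : circle R -> 'M[R[i]]_n) (s : seq (int * int)) :=
  exists rho kappa : 'I_n -> int,
    antisym_factorization B F rho kappa /\ forall k, (rho k, kappa k) \in s.

Definition Wmx N : 'M[R[i]]_(N + N) := block_mx 0 1%:M 1%:M 0.

End Algebras.

Arguments Wmx {R} N.

(* Main.v *)
(* Let F = A W A~^-1, so that F F~ = I. The range of (I; J) consists of the solutions of
   W J h = h, hence A maps it onto Y_F = {h : F J h = h}; as (P, JP) has kernel Q L^2,
   Phi(A) is invertible iff L^2 is the direct sum of Y_F and Q L^2. Likewise Psi(A) is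
   invertible iff L^2 is the direct sum of Y_{-G} and Q L^2. If F = F_- D F_-~^-1, then
   multiplication by F_- preserves Q L^2 and maps Y_D onto Y_F, so the splitting can be
   read off the scalar equations y_k = rho y_{kappa-1-k} for Fourier coefficients: it
   holds iff every pair (rho, kappa) is in the list.

   An antisymmetric factorization always exists. Write F = A_- L A_+ and U = A_+~ A_-.
   Then U L U~ = L, and comparing Fourier supports shows that U is block triangular with
   constant diagonal blocks. Its block diagonal part U0 is an involution commuting with
   L; choose C with U0 C = C R and L C = C L', where R and L' are diagonal and R^2 = I.
   The matrix X = C + U C R is invertible over B_- and U L X~ = X R L', whence
   F_- = A_+~^-1 X and D = R L'. *)

From HB Require Import structures.
From mathcomp Require Import all_boot all_order all_algebra.
From mathcomp Require Import fingroup perm mxpoly.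
From mathcomp Require Import complex ring lra zify.
From mathcomp Require Import all_classical all_reals all_analysis.
From mathcomp Require Import measurable_realfun ess_sup_inf.
Require Import Defs.

Set Implicit Arguments.
Unset Strict Implicit.
Unset Printing Implicit Defensive.

Import Order.TTheory GRing.Theory Num.Theory.
Import numFieldNormedType.Exports.
Import ComplexField.Normc.

Local Open Scope classical_set_scope.
Local Open Scope complex_scope.
Local Open Scope ring_scope.

(** * Functionals that vanish on trigonometric polynomials *)

(** Origin of X: the equation U L X~ = X R L' says that X is fixed by the map Y -> U L Y~ (R
    L')^(-1). This map is an involution, because U L U~ = L, L L~ = I, L' L'~ = I and R is an
    involution commuting with L'. It sends C to U C R, so X is C plus its image. X is invertible
    over B_- because X C^(-1) = I + U U0 has a nonzero constant determinant.

    The analysis rests on Fourier series in L^2. Uniqueness of the coefficients comes first, by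
    extending functionals that vanish on all t^n to indicators of Borel sets. Bessel's identity and
    completeness then give Riesz-Fischer, and the density of trigonometric polynomials follows from
    uniqueness, not conversely. From there on, an identity almost everywhere is an identity of
    coefficients, which J permutes by k -> -1 - k and P truncates.

    Invertibility requires a bounded inverse. The factorization provides an explicit bounded section
    of the splitting, from which the inverses of Phi(A) and Psi(A) are assembled. *)

(** Bernoulli bounds (1 + x)^m below by 1 + m x, and (1 - x)^m (1 + x)^m <= 1. *)
Lemma one_sub_exp_le (R : realFieldType) (x : R) (m : nat) :
  0 <= x <= 1 -> (1 - x) ^+ m <= (1 + m%:R * x)^-1.
Proof.
move=> /andP[x0 x1].
have h k : 1 + k%:R * x <= (1 + x) ^+ k.
  elim: k => [|k ih]; first by rewrite expr0 mul0r addr0.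
  have ik : 0 <= k%:R :> R by [].
  rewrite exprS -natr1; nra.
have hp : 0 < 1 + m%:R * x by rewrite ltr_pwDl// mulr_ge0.
rewrite -[leRHS]mul1r ler_pdivlMr//.
apply: (@le_trans _ _ ((1 - x) ^+ m * (1 + x) ^+ m)).
  by rewrite ler_wpM2l// exprn_ge0// subr_ge0.
by rewrite -exprMn exprn_ile1//; nra.
Qed.

Lemma one_sub_exp_ge (R : realFieldType) (x : R) (m : nat) :
  0 <= x <= 1 -> 1 - m%:R * x <= (1 - x) ^+ m.
Proof.
move=> /andP[x0 x1]; elim: m => [|m ih]; first by rewrite expr0 mul0r subr0.
have ik : 0 <= m%:R :> R by [].
rewrite exprS -natr1; nra.
Qed.

Lemma natmul_geometric_cvg0 (R : realType) (r : R) : 0 <= r < 1 ->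
  (fun n : nat => n%:R * r ^+ n) @ \oo --> 0.
Proof.
move=> /andP[]; rewrite le_eqVlt => /predU1P[<- _|r0 r1].
  apply/cvgrPdist_lt => e e0; near=> n.
  rewrite expr0n (_ : (n == 0)%N = false) ?mulr0 ?subrr ?normr0//.
  by apply/negbTE; rewrite -lt0n; near: n; exact: nbhs_infty_gt.
(* Half of the decay absorbs the factor n: Bernoulli for 1/q = 1 + h gives n q^n <= 1/h, and another
   q^n remains. *)
pose q := Num.sqrt r.
have q0 : 0 < q by rewrite sqrtr_gt0.
have q1 : q < 1 by rewrite -sqrtr1 ltr_sqrt.
pose h := q^-1 - 1.
have h0 : 0 < h by rewrite subr_gt0 invf_gt1.
have le n : n%:R * r ^+ n <= h^-1 * q ^+ n.
  have -> : r ^+ n = q ^+ n * q ^+ n by rewrite -exprMn -expr2 sqr_sqrtr// ltW.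
  rewrite mulrA ler_pM2r ?exprn_gt0//.
  rewrite -[leRHS]mul1r ler_pdivlMr//.
  have : 1 + n%:R * h <= (1 + h) ^+ n.
    elim: n => [|k ih]; first by rewrite expr0 mul0r addr0.
    have ik : 0 <= k%:R :> R by [].
    rewrite exprS -natr1; nra.
  rewrite (_ : 1 + h = q^-1) ?exprVn => [H|]; last by rewrite /h addrC subrK.
  have qn : 0 < q ^+ n by rewrite exprn_gt0.
  rewrite mulrAC -ler_pdivlMr// mul1r; apply: le_trans H.
  by rewrite lerDr.
apply: (@squeeze_cvgr _ _ _ _ (cst 0) (fun n => h^-1 * q ^+ n)).
- by near=> n; rewrite le mulr_ge0// exprn_ge0// ltW.
- exact: cvg_cst.
- by apply: cvg_geometric; rewrite ger0_norm// ltW.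
Unshelve. all: by end_near. Qed.

(* The polynomials of the Brosowski-Deutsch proof of the Stone-Weierstrass theorem. *)
Lemma step_approx_cvg (R : realType) (w : R) : 0 <= w <= 1 ->
  (fun n : nat => (1 - w ^+ n) ^+ (n * 2 ^ n)) @ \oo -->
  ((if w < 2^-1 then 1 else 0) : R).
Proof.
move=> /andP[w0 w1].
have wn n : 0 <= w ^+ n <= 1 by rewrite exprn_ge0// exprn_ile1.
(* The exponent times w^n is n (2 w)^n, which is at least n if w >= 1/2 and tends to 0 if w < 1/2.
   The two Bernoulli bounds turn this into the limits 0 and 1. *)
case: ifPn => [w12|]; last first.
  rewrite -leNgt => w12.
  apply: (@squeeze_cvgr _ _ _ _ (cst 0) harmonic).
  - near=> n; apply/andP; split.
      by rewrite exprn_ge0// subr_ge0; case/andP: (wn n).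
    apply: (le_trans (one_sub_exp_le _ (wn n))).
    rewrite /harmonic /= lef_pV2 ?posrE ?ltr_pwDl//; last first.
      by rewrite mulr_ge0//; case/andP: (wn n).
    rewrite -natr1 addrC lerD2l natrM natrX -mulrA -exprMn.
    rewrite ler_peMr// -[leLHS](expr1n _ n) lerXn2r// ?nnegrE; lra.
  - exact: cvg_cst.
  - exact: cvg_harmonic.
apply: (@squeeze_cvgr _ _ _ _ (fun n => 1 - n%:R * (2 * w) ^+ n) (cst 1)).
- near=> n; apply/andP; split; last first.
    by apply: exprn_ile1; case/andP: (wn n) => *; lra.
  have := one_sub_exp_ge (n * 2 ^ n) (wn n).
  by rewrite natrM natrX -mulrA -exprMn.
- rewrite -[X in _ --> X]subr0; apply: cvgB; first exact: cvg_cst.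
  by apply: natmul_geometric_cvg0; apply/andP; split; lra.
- exact: cvg_cst.
Unshelve. all: by end_near. Qed.

(** * Complex functions on the circle through their real and imaginary parts *)

Lemma cvg_complexP (R : realType) (T : Type) (F : set_system T) (FF : Filter F)
    (f : T -> R[i]) (z : R[i]) :
  ((f : T -> (R[i] : numFieldType)) @ F --> (z : (R[i] : numFieldType))) <->
  ((complex.Re (f t) @[t --> F] --> complex.Re z) /\
   (complex.Im (f t) @[t --> F] --> complex.Im z)).
Proof.
split=> [/cvgrPdist_lt h|[/cvgrPdist_lt hr /cvgrPdist_lt hi]].
  split; apply/cvgrPdist_lt => e e0; have e0' : 0 < e%:C by rewrite ltcR.
    near=> t; rewrite -ltcR.
    have : `|z - f t| < e%:C by near: t; exact: (h _ e0').
    apply: le_lt_trans; rewrite normc_def lecR -sqrtr_sqr ler_wsqrtr//=.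
    by case: (z) (f t) => [a b] [c d] /=; rewrite lerDl sqr_ge0.
  near=> t; rewrite -ltcR.
  have : `|z - f t| < e%:C by near: t; exact: (h _ e0').
  apply: le_lt_trans; rewrite normc_def lecR -sqrtr_sqr ler_wsqrtr//=.
  by case: (z) (f t) => [a b] [c d] /=; rewrite lerDr sqr_ge0.
apply/cvgrPdist_lt => -[e e'] /=; rewrite ltcE/= => /andP[/eqP -> e0].
have e20 : 0 < e / 2 by rewrite divr_gt0.
near=> t; rewrite normc_def ltcR.
have : `|complex.Re z - complex.Re (f t)| < e / 2 by near: t; exact: hr.
have : `|complex.Im z - complex.Im (f t)| < e / 2 by near: t; exact: hi.
case: (z) (f t) => [a b] [c d] /= h1 h2.
rewrite -(ltr_pXn2r (n := 2)) ?nnegrE ?sqrtr_ge0 ?ltW// sqr_sqrtr ?addr_ge0 ?sqr_ge0//.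
rewrite -(real_normK (num_real (a - c))) -(real_normK (num_real (b - d))).
have := normr_ge0 (a - c); have := normr_ge0 (b - d).
move: h1 h2; set x := `|_|; set y := `|_| => *; nra.
Unshelve. all: by end_near. Qed.

Lemma ccontinuousP (R : realType) (f : circle R -> R[i]) : ccontinuous f <->
  continuous (fun t => complex.Re (f t)) /\ continuous (fun t => complex.Im (f t)).
Proof.
split=> [h|[hr hi] t].
  by split=> t; have /cvg_complexP[] := h t.
by apply: (@cvg_complexP _ _ (nbhs t) _ f (f t)).2; split; [exact: hr|exact: hi].
Qed.

Lemma ccontinuous_measurable (R : realType) (f : circle R -> R[i]) :
  ccontinuous f -> cmeasurable f.
Proof.
have m (g : circle R -> R) : continuous g -> measurable_fun setT g.
  move=> /continuousP cg; apply: (measurability _ (RGenInftyO.measurableE R)).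
  move=> _ [_ [x ->] <-]; rewrite setTI; apply: sub_sigma_algebra.
  exact/cg/interval_open.
by move=> /ccontinuousP[? ?]; split; exact: m.
Qed.

Lemma ccontinuous_cval (R : realType) : ccontinuous (@cval R).
Proof. by move=> t; exact: initial_continuous. Qed.

Section ComplexValued.
Variable R : realType.
Implicit Types f g : circle R -> R[i].

Lemma normr_Re_le (z : R[i]) : `|complex.Re z| <= normc z.
Proof. by case: z => a b /=; rewrite -sqrtr_sqr ler_wsqrtr// lerDl sqr_ge0. Qed.

Lemma normr_Im_le (z : R[i]) : `|complex.Im z| <= normc z.
Proof. by case: z => a b /=; rewrite -sqrtr_sqr ler_wsqrtr// lerDr sqr_ge0. Qed.

Lemma cvalV (t : circle R) : (t : R[i])^-1 = (t : R[i])^*%C.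
Proof. by rewrite invc_norm (eqP (cvalP t)) expr1n invr1 mul1r. Qed.

Lemma cval_neq0 (t : circle R) : (t : R[i]) != 0.
Proof. by rewrite -normr_eq0 (eqP (cvalP t)) oner_eq0. Qed.

Lemma normc_cval (t : circle R) : normc (t : R[i]) = 1.
Proof. by have /eqP[] := cvalP t. Qed.

Lemma normc_exprz (t : circle R) (n : int) : normc ((t : R[i]) ^ n) = 1.
Proof.
have h m : normc ((t : R[i]) ^+ m) = 1.
  by elim: m => [|m ih]; rewrite ?normc1// exprS normcM ih normc_cval mulr1.
by case: n => n; rewrite ?NegzE -?exprnN ?normcV h ?invr1.
Qed.

Lemma cmeasurable_cst (c : R[i]) : cmeasurable (fun _ : circle R => c).
Proof. by split; exact: measurable_cst. Qed.

Lemma cmeasurableD f g : cmeasurable f -> cmeasurable g ->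
  cmeasurable (fun t => f t + g t).
Proof.
move=> [fR fI] [gR gI]; split.
  rewrite (_ : (fun t => _) = (fun t => complex.Re (f t) + complex.Re (g t))).
    exact: measurable_funD.
  by apply/funext => t; case: (f t) (g t) => [? ?] [].
rewrite (_ : (fun t => _) = (fun t => complex.Im (f t) + complex.Im (g t))).
  exact: measurable_funD.
by apply/funext => t; case: (f t) (g t) => [? ?] [].
Qed.

Lemma cmeasurableM f g : cmeasurable f -> cmeasurable g ->
  cmeasurable (fun t => f t * g t).
Proof.
move=> [fR fI] [gR gI]; split.
  rewrite (_ : (fun t => _) = (fun t => complex.Re (f t) * complex.Re (g t) -
     complex.Im (f t) * complex.Im (g t))).
    by apply: measurable_funB; exact: measurable_funM.
  by apply/funext => t; case: (f t) (g t) => [? ?] [].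
rewrite (_ : (fun t => _) = (fun t => complex.Re (f t) * complex.Im (g t) +
     complex.Im (f t) * complex.Re (g t))).
  by apply: measurable_funD; exact: measurable_funM.
by apply/funext => t; case: (f t) (g t) => [? ?] [].
Qed.

Lemma cmeasurable_conj f : cmeasurable f -> cmeasurable (fun t => (f t)^*%C).
Proof.
move=> [fR fI]; split.
  by rewrite (_ : (fun t => _) = (fun t => complex.Re (f t)))//;
     apply/funext => t; case: (f t).
rewrite (_ : (fun t => _) = (fun t => - complex.Im (f t))).
  exact: measurable_funN.
by apply/funext => t; case: (f t).
Qed.

Lemma cmeasurable_cval : cmeasurable (@cval R).
Proof. exact/ccontinuous_measurable/ccontinuous_cval. Qed.

Lemma cmeasurable_exprz (n : int) : cmeasurable (fun t : circle R => (t : R[i]) ^ n).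
Proof.
have h f m : cmeasurable f -> cmeasurable (fun t => f t ^+ m).
  move=> mf; elim: m => [|m ih]; first exact: cmeasurable_cst.
  rewrite (_ : (fun t => _) = (fun t => f t * f t ^+ m)); first exact: cmeasurableM.
  by apply/funext => t; rewrite exprS.
case: n => n; first exact/h/cmeasurable_cval.
rewrite (_ : (fun t => _) = (fun t : circle R => ((t : R[i])^*%C) ^+ n.+1)).
  exact/h/cmeasurable_conj/cmeasurable_cval.
by apply/funext => t; rewrite -cvalV NegzE -exprnN exprVn.
Qed.

End ComplexValued.

Section TrigNull.
Variable R : realType.
Implicit Types (h g : circle R -> R) (I : (circle R -> R) -> R).

Definition bmeas h := measurable_fun setT h /\ exists M, forall t, `|h t| <= M.

Lemma bmeas_cst (c : R) : bmeas (fun=> c).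
Proof. by split; [exact: measurable_cst|exists `|c|]. Qed.

Lemma bmeasD h g : bmeas h -> bmeas g -> bmeas (fun t => h t + g t).
Proof.
move=> [mh [M hM]] [mg [M' gM]]; split; first exact: measurable_funD.
by exists (M + M') => t; rewrite (le_trans (ler_normD _ _))// lerD.
Qed.

Lemma bmeasM h g : bmeas h -> bmeas g -> bmeas (fun t => h t * g t).
Proof.
move=> [mh [M hM]] [mg [M' gM]]; split; first exact: measurable_funM.
exists (M * M') => t; rewrite normrM ler_pM//.
Qed.

(* Abstracts [h |-> \int u * h] for [u] with vanishing Fourier coefficients, and the
   difference between [h |-> \int h] and its reflection. That such functionals vanish
   replaces the density of trigonometric polynomials. *)
Record trig_null I : Prop := TrigNull {
  tn_linear : forall (a : R) f g, bmeas f -> bmeas g ->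
    I (fun t => a * f t + g t) = a * I f + I g;
  tn_cvg : forall (f : nat -> circle R -> R) g (M : R),
    (forall n, measurable_fun setT (f n)) -> (forall n t, `|f n t| <= M) ->
    (forall t, f n t @[n --> \oo] --> g t) -> I (f n) @[n --> \oo] --> I g;
  tn_Re : forall n : int, I (fun t => complex.Re ((t : R[i]) ^ n)) = 0;
  tn_Im : forall n : int, I (fun t => complex.Im ((t : R[i]) ^ n)) = 0 }.

(** Quantifying over all functionals of the class makes products of multipliers a mere composition.
    Multipliers form an algebra closed under bounded pointwise limits; the aim is to reach the
    indicator of every Borel set, for evaluating the new functional at the constant 1 gives I h =
    0. *)
Definition multiplier h := bmeas h /\
  forall I, trig_null I -> trig_null (fun g => I (fun t => h t * g t)).

Lemma cvg_bmeas (f : nat -> circle R -> R) g (M : R) :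
  (forall n, measurable_fun setT (f n)) -> (forall n t, `|f n t| <= M) ->
  (forall t, f n t @[n --> \oo] --> g t) -> bmeas g.
Proof.
move=> mf fM fg; split.
  by apply: (measurable_fun_cvg mf) => t _; exact: fg.
exists M => t; apply: (cvgr_to_le (cvg_norm (fg t))).
by near=> n; exact: fM.
Unshelve. all: by end_near. Qed.

(** For bounded [h] the clauses on linearity and convergence are inherited from [I], so only the
    values on the trigonometric monomials remain to be checked. *)
Lemma trig_null_mul h I : bmeas h -> trig_null I ->
  (forall n : int, I (fun t => h t * complex.Re ((t : R[i]) ^ n)) = 0) ->
  (forall n : int, I (fun t => h t * complex.Im ((t : R[i]) ^ n)) = 0) ->
  trig_null (fun g => I (fun t => h t * g t)).
Proof.
move=> bh tI hRe hIm; split=> // [a f g bf bg|f g M mf fM fg].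
  rewrite -(tn_linear tI); [|exact: bmeasM..].
  by congr I; apply/funext => t; rewrite mulrDr mulrCA.
have [mh [K hK]] := bh.
apply: (@tn_cvg _ tI _ _ (K * M)).
- by move=> n; exact: measurable_funM.
- by move=> n t; rewrite normrM ler_pM.
- by move=> t; apply: cvgM => //; exact: cvg_cst.
Qed.

Lemma trig_null_cst0 I : trig_null I -> I (fun=> 0) = 0.
Proof. by move=> /tn_Im /(_ 0); rewrite (_ : (fun t => _) = (fun=> 0)). Qed.

Lemma trig_nullZ I (a : R) f : trig_null I -> bmeas f ->
  I (fun t => a * f t) = a * I f.
Proof.
move=> tI bf; have := tn_linear tI a bf (bmeas_cst 0).
by rewrite trig_null_cst0// addr0 => <-; congr I; apply/funext => t; rewrite addr0.
Qed.

Lemma bmeas_exprz (n : int) :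
  bmeas (fun t => complex.Re ((t : R[i]) ^ n)) /\
  bmeas (fun t => complex.Im ((t : R[i]) ^ n)).
Proof.
have [mR mI] := cmeasurable_exprz R n.
have nt (t : circle R) : normc ((t : R[i]) ^ n) = 1 := normc_exprz t n.
split; split=> //; exists 1 => t; rewrite -(nt t).
  exact: normr_Re_le.
exact: normr_Im_le.
Qed.

Lemma multiplier_cst (c : R) : multiplier (fun=> c).
Proof.
split; first exact: bmeas_cst.
move=> I tI; apply: trig_null_mul => //; first exact: bmeas_cst.
  by move=> n; rewrite trig_nullZ// ?(tn_Re tI) ?mulr0//; case: (bmeas_exprz n).
by move=> n; rewrite trig_nullZ// ?(tn_Im tI) ?mulr0//; case: (bmeas_exprz n).
Qed.

Lemma multiplierM h g : multiplier h -> multiplier g ->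
  multiplier (fun t => h t * g t).
Proof.
move=> [bh mh] [bg mg]; split; first exact: bmeasM.
move=> I /mh /mg; congr trig_null; apply/funext => f; congr I.
by apply/funext => t; rewrite mulrA.
Qed.

Lemma multiplierD h g : multiplier h -> multiplier g ->
  multiplier (fun t => h t + g t).
Proof.
move=> [bh mh] [bg mg]; split; first exact: bmeasD.
move=> I tI; have hT := mh _ tI; have gT := mg _ tI.
have key f : bmeas f -> I (fun t => h t * f t) = 0 -> I (fun t => g t * f t) = 0 ->
    I (fun t => (h t + g t) * f t) = 0.
  move=> bf h0 g0.
  have := tn_linear tI 1 (bmeasM bh bf) (bmeasM bg bf).
  rewrite h0 g0 mulr0 addr0 => <-.
  by congr I; apply/funext => t; rewrite mul1r mulrDl.
apply: trig_null_mul => // [|n|n]; first exact: bmeasD.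
  by apply: key; [case: (bmeas_exprz n)|exact: tn_Re hT n|exact: tn_Re gT n].
by apply: key; [case: (bmeas_exprz n)|exact: tn_Im hT n|exact: tn_Im gT n].
Qed.

(** [tn_cvg] carries the vanishing on each monomial over to the limit. *)
Lemma multiplier_cvg (f : nat -> circle R -> R) g (M : R) :
  (forall n, multiplier (f n)) -> (forall n t, `|f n t| <= M) ->
  (forall t, f n t @[n --> \oo] --> g t) -> multiplier g.
Proof.
move=> mf fM fg.
have mf' n : measurable_fun setT (f n) by have [[]] := mf n.
have bg := cvg_bmeas mf' fM fg; split=> // I tI.
have key k : bmeas k -> (forall n, I (fun t => f n t * k t) = 0) ->
    I (fun t => g t * k t) = 0.
  move=> [mk [K kK]] k0.
  have : I (fun t => f n t * k t) @[n --> \oo] --> I (fun t => g t * k t).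
    apply: (@tn_cvg _ tI _ _ (M * K)).
    - by move=> n; exact: measurable_funM.
    - by move=> n t; rewrite normrM ler_pM.
    - by move=> t; apply: cvgM => //; exact: cvg_cst.
  rewrite (_ : (fun n => _) = (fun=> 0)); last exact/funext.
  by move/cvg_lim => <- //; rewrite lim_cst.
apply: trig_null_mul => // n; apply: key; first by case: (bmeas_exprz n).
- by move=> m; have [_ /(_ _ tI)/tn_Re] := mf m.
- by case: (bmeas_exprz n).
- by move=> m; have [_ /(_ _ tI)/tn_Im] := mf m.
Qed.

Lemma trig_null_comb I (a b : R) f g : trig_null I -> bmeas f -> bmeas g ->
  I f = 0 -> I g = 0 -> I (fun t => a * f t + b * g t) = 0.
Proof.
move=> tI bf bg f0 g0; have bbg := bmeasM (bmeas_cst b) bg.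
by rewrite (tn_linear tI a bf bbg) trig_nullZ// f0 g0 !mulr0 addr0.
Qed.

(** On the circle 2 Re t = t + t^(-1), so Re t times a part of t^n is the half sum of the same parts
    of t^(n+1) and t^(n-1). *)
Lemma multiplier_Re_cval : multiplier (fun t : circle R => complex.Re (t : R[i])).
Proof.
have [bR bI] := bmeas_exprz 1.
split=> // I tI; apply: trig_null_mul => // n.
  have [bR1 _] := bmeas_exprz (n + 1); have [bR2 _] := bmeas_exprz (n - 1).
  rewrite -(trig_null_comb 2^-1 2^-1 tI bR1 bR2 (tn_Re tI _) (tn_Re tI _)).
  congr I; apply/funext => t; rewrite !expfzDr ?cval_neq0// expr1z exprN1 cvalV.
  by case: (t : R[i]) (_ ^ n) => [a b] [c d] /=; field.
have [_ bI1] := bmeas_exprz (n + 1); have [_ bI2] := bmeas_exprz (n - 1).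
rewrite -(trig_null_comb 2^-1 2^-1 tI bI1 bI2 (tn_Im tI _) (tn_Im tI _)).
congr I; apply/funext => t; rewrite !expfzDr ?cval_neq0// expr1z exprN1 cvalV.
by case: (t : R[i]) (_ ^ n) => [a b] [c d] /=; field.
Qed.

Lemma multiplier_Im_cval : multiplier (fun t : circle R => complex.Im (t : R[i])).
Proof.
have [bR bI] := bmeas_exprz 1.
split=> // I tI; apply: trig_null_mul => // n.
  have [_ bI1] := bmeas_exprz (n + 1); have [_ bI2] := bmeas_exprz (n - 1).
  rewrite -(trig_null_comb 2^-1 (- 2^-1) tI bI1 bI2 (tn_Im tI _) (tn_Im tI _)).
  congr I; apply/funext => t; rewrite !expfzDr ?cval_neq0// expr1z exprN1 cvalV.
  by case: (t : R[i]) (_ ^ n) => [a b] [c d] /=; field.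
have [bR1 _] := bmeas_exprz (n + 1); have [bR2 _] := bmeas_exprz (n - 1).
rewrite -(trig_null_comb (- 2^-1) 2^-1 tI bR1 bR2 (tn_Re tI _) (tn_Re tI _)).
congr I; apply/funext => t; rewrite !expfzDr ?cval_neq0// expr1z exprN1 cvalV.
by case: (t : R[i]) (_ ^ n) => [a b] [c d] /=; field.
Qed.

Lemma multiplierX h (n : nat) : multiplier h -> multiplier (fun t => h t ^+ n).
Proof.
move=> mh; elim: n => [|n ih]; first exact: multiplier_cst.
have := multiplierM mh ih; congr multiplier.
by apply/funext => t; rewrite exprS.
Qed.

(** [K] is at least twice |h - c|, so the affine image [w] of [h] lies in [0, 1]; it is below 1/2
    exactly where h < c. The polynomials of [step_approx_cvg] in [w] then converge boundedly to the
    indicator. *)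
Lemma multiplier_lt h (c : R) : multiplier h -> (forall t, `|h t| <= 1) ->
  multiplier (\1_[set t | h t < c] : circle R -> R).
Proof.
move=> mh h1; pose K := 2 * (1 + `|c|).
have K0 : 0 < K by rewrite mulr_gt0// ltr_pwDl.
pose w t := 2^-1 + (h t - c) / K.
have w01 t : 0 <= w t <= 1.
  have h1' : - 1 <= h t <= 1 by rewrite -ler_norml.
  have c1 : - `|c| <= c <= `|c| by rewrite -ler_norml.
  have : - 2^-1 <= (h t - c) / K <= 2^-1.
    rewrite ler_pdivlMr// ler_pdivrMr// /K; apply/andP; lra.
  by rewrite /w => ?; apply/andP; lra.
have mw : multiplier w.
  apply: multiplierD; first exact: multiplier_cst.
  apply: multiplierM; last exact: multiplier_cst.
  by apply: multiplierD => //; exact: multiplier_cst.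
apply: (@multiplier_cvg (fun n t => (1 - w t ^+ n) ^+ (n * 2 ^ n)) _ 1).
- move=> n; apply: multiplierX; apply: multiplierD; first exact: multiplier_cst.
  have := multiplierM (multiplier_cst (-1)) (multiplierX n mw); congr multiplier.
  by apply/funext => t; rewrite mulN1r.
- move=> n t; have /andP[w0 w1] := w01 t.
  have : 0 <= w t ^+ n <= 1 by rewrite exprn_ge0// exprn_ile1.
  move=> /andP[? ?]; rewrite ger0_norm ?exprn_ge0 ?subr_ge0//.
  by apply: exprn_ile1; lra.
- move=> t; have := step_approx_cvg (w01 t).
  rewrite indicE (_ : (w t < 2^-1) = (h t < c)).
    suff -> : (t \in [set t | h t < c]) = (h t < c) by case: (h t < c).
    by apply/idP/idP; rewrite inE.
  by rewrite /w gtrDl pmulr_llt0 ?invr_gt0// subr_lt0.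
Qed.

Lemma multiplier_indicC (S : set (circle R)) :
  multiplier (\1_S : circle R -> R) -> multiplier (\1_(~` S) : circle R -> R).
Proof.
move=> mS.
have := multiplierD (multiplier_cst 1) (multiplierM (multiplier_cst (-1)) mS).
congr multiplier; apply/funext => t; rewrite indicC indicE.
by case: (t \in S); rewrite /= ?mulr1 ?mulr0 ?addr0 ?subrr.
Qed.

(** After passing to complements, the indicator of the intersection is the pointwise limit of finite
    products of indicators. *)
Lemma multiplier_indic_bigcup (F : nat -> set (circle R)) :
  (forall n, multiplier (\1_(F n) : circle R -> R)) ->
  multiplier (\1_(\bigcup_n F n) : circle R -> R).
Proof.
move=> mF; rewrite -[\bigcup_n _]setCK; apply: multiplier_indicC.
pose g n t : R := \prod_(i < n) \1_(~` F i) t.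
have g01 n t : g n t = 0 \/ g n t = 1.
  rewrite /g; elim: n => [|n]; first by rewrite big_ord0; right.
  rewrite big_ord_recr /= => -[->|->]; first by left; rewrite mul0r.
  by rewrite mul1r indicE; case: (_ \in _); [right|left].
apply: (@multiplier_cvg g _ 1).
- move=> n; rewrite /g; elim: n => [|n ih].
    have := multiplier_cst 1; congr multiplier.
    by apply/funext => t; rewrite big_ord0.
  have := multiplierM ih (multiplier_indicC (mF n)); congr multiplier.
  by apply/funext => t; rewrite big_ord_recr.
- by move=> n t; case: (g01 n t) => ->; rewrite ?normr0 ?normr1.
- move=> t; rewrite indicE; case: (boolP (t \in _)) => /= [|].
    rewrite inE /= => nF; rewrite (_ : (fun n => g n t) = cst 1); first exact: cvg_cst.
    apply/funext => n; rewrite /g big1// => i _.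
    by rewrite indicE mem_set// => Fi; apply: nF; exists i.
  rewrite notin_setE /= => /contrapT[k _ Fk].
  apply/cvgrPdist_lt => e e0; near=> n.
  have kn : (k < n)%N by near: n; exact: nbhs_infty_gt.
  rewrite /g (bigD1 (Ordinal kn))//= indicE memNset//= ?mul0r ?subrr ?normr0//.
Unshelve. all: by end_near. Qed.

(** Boxes with rational corners are countable in number, so an open set becomes a countable union of
    sets cut out by strict inequalities on the two coordinates, to which [multiplier_lt] applies. *)
Lemma open_circle_rat_box (U : set (circle R)) : open U -> forall t, U t ->
  exists q : rat * rat * (rat * rat),
    let box := [set s : circle R |
      (ratr q.1.1 < complex.Re (s : R[i]) < ratr q.1.2) /\
      (ratr q.2.1 < complex.Im (s : R[i]) < ratr q.2.2)] in
    box t /\ box `<=` U.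
Proof.
move=> [V oV <-] t /= Vt.
have := open_nbhs_nbhs (conj oV Vt) => /nbhs_ballP[[e e'] /=].
rewrite ltcE /= => /andP[/eqP -> e0] eV.
pose d := e / 2; have d0 : 0 < d by rewrite divr_gt0.
have rat_in (x y : R) : x < y -> exists q : rat, x < ratr q < y.
  by move=> /rat_in_itvoo[q]; rewrite in_itv /=; exists q.
have [|a1 /andP[? ?]] := rat_in (complex.Re (t : R[i]) - d) (complex.Re (t : R[i])); first lra.
have [|a2 /andP[? ?]] := rat_in (complex.Re (t : R[i])) (complex.Re (t : R[i]) + d); first lra.
have [|b1 /andP[? ?]] := rat_in (complex.Im (t : R[i]) - d) (complex.Im (t : R[i])); first lra.
have [|b2 /andP[? ?]] := rat_in (complex.Im (t : R[i])) (complex.Im (t : R[i]) + d); first lra.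
exists ((a1, a2), (b1, b2)) => /=; split; first by split; apply/andP.
move=> s /= [/andP[? ?] /andP[? ?]]; apply: eV.
rewrite /ball /= normc_def ltcR.
have : `|complex.Re (t : R[i]) - complex.Re (s : R[i])| < d.
  by rewrite ltr_norml; apply/andP; split; lra.
have : `|complex.Im (t : R[i]) - complex.Im (s : R[i])| < d.
  by rewrite ltr_norml; apply/andP; split; lra.
rewrite /d; case: (t : R[i]) (s : R[i]) => [x y] [x' y'] /= h1 h2.
rewrite -(ltr_pXn2r (n := 2)) ?nnegrE ?sqrtr_ge0 ?ltW// sqr_sqrtr ?addr_ge0 ?sqr_ge0//.
rewrite -(real_normK (num_real (x - x'))) -(real_normK (num_real (y - y'))).
have := normr_ge0 (x - x'); have := normr_ge0 (y - y').
move: h1 h2; set a := `|_|; set b := `|_| => *; nra.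
Qed.

Lemma multiplier_indic_open (U : set (circle R)) : open U ->
  multiplier (\1_U : circle R -> R).
Proof.
move=> oU.
pose hR (t : circle R) := complex.Re (t : R[i]).
pose hI (t : circle R) := complex.Im (t : R[i]).
have bR t : `|hR t| <= 1 by rewrite -(normc_cval t) normr_Re_le.
have bI t : `|hI t| <= 1 by rewrite -(normc_cval t) normr_Im_le.
pose box (q : rat * rat * (rat * rat)) := [set s : circle R |
      (ratr q.1.1 < complex.Re (s : R[i]) < ratr q.1.2) /\
      (ratr q.2.1 < complex.Im (s : R[i]) < ratr q.2.2)].
have gt h c : multiplier h -> (forall t, `|h t| <= 1) ->
    multiplier (\1_[set t | c < h t] : circle R -> R).
  move=> mh h1.
  rewrite (_ : [set t | c < h t] = [set t | - h t < - c]); last first.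
    by apply/seteqP; split => t /=; rewrite ltrN2.
  apply: (@multiplier_lt (fun t => - h t)) => [|t]; last by rewrite normrN.
  have := multiplierM (multiplier_cst (-1)) mh; congr multiplier.
  by apply/funext => t; rewrite mulN1r.
have mI A B : multiplier (\1_A : circle R -> R) -> multiplier (\1_B : circle R -> R) ->
    multiplier (\1_(A `&` B) : circle R -> R).
  by move=> mA mB; rewrite indicI; exact: multiplierM.
have mbox q : multiplier (\1_(box q) : circle R -> R).
  rewrite (_ : box q = ([set t | ratr q.1.1 < hR t] `&` [set t | hR t < ratr q.1.2]) `&`
    ([set t | ratr q.2.1 < hI t] `&` [set t | hI t < ratr q.2.2])).
    by apply: (mI); apply: (mI); (apply: (gt) || apply: multiplier_lt) => //;
       first [exact: multiplier_Re_cval|exact: multiplier_Im_cval].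
  apply/seteqP; split => t /=; rewrite /box /hR /hI /=.
    by move=> [/andP[-> ->] /andP[-> ->]].
  by move=> [[-> ->] [-> ->]].
(* An enumeration of the boxes contained in [U]: numbers that code no box, or a box not inside [U],
   contribute the empty set. *)
pose F n : set (circle R) := if unpickle n is Some q then
  (if `[< box q `<=` U >] then box q else set0) else set0.
have -> : U = \bigcup_n F n.
  apply/seteqP; split => [t /(open_circle_rat_box oU)[q [qt qU]]|t [n _]].
    exists (pickle q); first exact: I.
    rewrite /F pickleK; case: asboolP => [_|nqU]; first exact: qt.
    by case: (nqU qU).
  by rewrite /F; case: unpickle => // q; case: asboolP => // h /h.
apply: multiplier_indic_bigcup => n; rewrite /F.
have m0 : multiplier (\1_set0 : circle R -> R).
  by rewrite indic0; exact: multiplier_cst.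
by case: unpickle => // q; case: asboolP.
Qed.

(* The sets whose indicator is a multiplier form a sigma-algebra. *)
Lemma trig_null_indic I (S : set (circle R)) : trig_null I -> measurable S ->
  I (\1_S) = 0.
Proof.
move=> tI mS.
suff mulS : multiplier (\1_S : circle R -> R).
  have := tn_Re (mulS.2 _ tI) 0.
  by congr (_ = _); congr I; apply/funext => t; rewrite expr0z mulr1.
pose C := [set S : set (circle R) | multiplier (\1_S : circle R -> R)].
have /(_ _ _ _ mS) := @smallest_sub _ (sigma_algebra setT) open C; apply.
  split.
  - by rewrite /C /= indic0; exact: multiplier_cst.
  - by move=> A; rewrite setTD; exact: multiplier_indicC.
  - by move=> F; exact: multiplier_indic_bigcup.
by move=> U; exact: multiplier_indic_open.
Qed.

End TrigNull.

(** * Normalized arc length *)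

Lemma expi_exists (R : realType) (t : circle R) :
  exists2 x : R, 0 <= x <= pi *+ 2 & t = expi x.
Proof.
have : normc (t : R[i]) = 1 := normc_cval t.
case: t => -[x y] tP /= /(congr1 (fun z => z ^+ 2)).
rewrite sqr_sqrtr ?addr_ge0 ?sqr_ge0// expr1n => xy1.
have x1 : -1 <= x <= 1 by apply/andP; split; nra.
have /andP[a0 api] : 0 <= acos x <= pi by rewrite acos_ge0// acos_lepi.
have sy : sin (acos x) = `|y|.
  by rewrite sin_acos// -xy1 addrAC subrr add0r sqrtr_sqr.
have pi0 := pi_ge0 R.
have [y0|y0] := leP 0 y.
  exists (acos x); first by rewrite a0 mulr2n; lra.
  by apply: val_inj => /=; rewrite acosK// sy ger0_norm.
exists (pi *+ 2 - acos x); first by apply/andP; split; lra.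
apply: val_inj => /=; rewrite cosB sinB cos2pi sin2pi mul1r !mul0r addr0 sub0r mul1r.
by rewrite acosK// sy ltr0_norm// opprK.
Qed.

Lemma expi_continuous (R : realType) : continuous (@expi R : R -> circle R).
Proof.
apply/continuousP => U [V oV <-].
by move/continuousP : (@cos_sin_continuous R); apply.
Qed.

Lemma cos_sin_exprn (R : realType) (x : R) (n : nat) :
  (cos x +i* sin x) ^+ n = cos (n%:R * x) +i* sin (n%:R * x).
Proof.
elim: n => [|n ih]; first by rewrite mul0r cos0 sin0.
rewrite exprS ih -natr1 mulrDl mul1r cosD sinD.
by apply/eqP; rewrite eq_complex /=; apply/andP; split; apply/eqP; ring.
Qed.

(** The summand 1 keeps the integrand nonnegative when |p| + |q| <= 1, so that [integral_arc], a
    change of variables for nonnegative functions, can be used; it is cancelled afterwards. *)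
Lemma int_cos_sin (R : realType) (n : nat) (p q : R) :
  (\int[lebesgue_measure]_(x in `[0%R : R, (pi *+ 2)%R])
    (1 + (p * cos (n.+1%:R * x) + q * sin (n.+1%:R * x)))%:E = ((pi : R) *+ 2)%:E)%E.
Proof.
pose m : R := n.+1%:R; have m0 : m != 0 by rewrite pnatr_eq0.
pose F (x : R) := x + (p * m^-1) * sin (m * x) - (q * m^-1) * cos (m * x).
have dF (x : R) : is_derive x (1 : R) F (1 + (p * cos (m * x) + q * sin (m * x))).
  rewrite /F; apply: is_derive_eq.
  by rewrite /GRing.scale /=; field.
have dFE x : derive1 F x = 1 + (p * cos (m * x) + q * sin (m * x)).
  by rewrite derive1E; apply: derive_val.
have cF : continuous F.
  by move=> x; apply: differentiable_continuous; apply/derivable1_diffP; have := dF x; case.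
have cf : continuous (fun x : R => 1 + (p * cos (m * x) + q * sin (m * x))).
  move=> x; apply: cvgD; first exact: cvg_cst.
  by apply: cvgD; apply: cvgM; try exact: cvg_cst; apply: continuous_comp;
    [apply: cvgM; [exact: cvg_cst|exact: cvg_id]|exact: continuous_cos
    |apply: cvgM; [exact: cvg_cst|exact: cvg_id]|exact: continuous_sin].
rewrite (@continuous_FTC2 _ _ F)//.
- rewrite /F !mulr0 sin0 cos0.
  have := cos_sin_exprn (pi *+ 2 : R) n.+1; move/eqP.
  rewrite cos2pi sin2pi expr1n eq_complex /= => /andP[/eqP <- /eqP <-].
  by rewrite -EFinB; congr EFin; ring.
- exact: pi2_gt0.
- exact: continuous_subspaceT.
- split.
  + by move=> x _; have := dF x; case.
  + by apply: cvg_at_right_filter; exact: cF.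
  + by apply: cvg_at_left_filter; exact: cF.
Qed.

Section ArcIntegral.
Variable R : realType.
Local Notation mu := (@arc R).

Lemma integral_arc (f : circle R -> \bar R) : measurable_fun setT f ->
  (forall t, 0 <= f t)%E ->
  (\int[mu]_t f t =
   (pi *+ 2)^-1%:E * \int[lebesgue_measure]_(x in `[0%R, (pi *+ 2)%R]) f (expi x))%E.
Proof.
move=> mf f0; rewrite /arc ge0_integral_pushforward//=; last first.
  exact: measurable_expi.
rewrite preimage_setT integral_uniform//= ?subr0//.
exact: (measurableT_comp mf (@measurable_expi R)).
Qed.

Lemma arc_integrable (h : circle R -> R) : bmeas h -> mu.-integrable setT (EFin \o h).
Proof.
move=> [mh [M hM]]; apply: measurable_bounded_integrable => //.
  by rewrite (le_lt_trans (probability_le1 _ _))// ltry.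
exists M; split; first by rewrite num_real.
by move=> x Mx t _ /=; rewrite (le_trans (hM t))// ltW.
Qed.

Lemma Rintegral_arc_cst (c : R) : \int[mu]_t c = c.
Proof.
have m1 : mu setT = 1%:E := probability_setT mu.
by rewrite Rintegral_cst// [X in fine X]m1 mulr1.
Qed.

Lemma cval_exprNz (t : circle R) (n : nat) :
  (t : R[i]) ^ (Negz n) = (((t : R[i]) ^ n.+1)^*)%C.
Proof. by rewrite NegzE -exprnN -exprVn cvalV -exprnP rmorphXn. Qed.

Lemma Rintegral_trig (n : nat) (p q : R) : `|p| + `|q| <= 1 ->
  \int[mu]_t (1 + (p * complex.Re ((t : R[i]) ^ n.+1) +
                    q * complex.Im ((t : R[i]) ^ n.+1))) = 1.
Proof.
move=> pq; have [bR bI] := bmeas_exprz R n.+1.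
rewrite /Rintegral integral_arc; last 2 first.
- apply/measurable_EFinP.
  have [] // := bmeasD (bmeas_cst 1)
    (bmeasD (bmeasM (bmeas_cst p) bR) (bmeasM (bmeas_cst q) bI)).
- move=> t; rewrite lee_fin.
  have := normr_Re_le ((t : R[i]) ^ n.+1); have := normr_Im_le ((t : R[i]) ^ n.+1).
  rewrite !normc_exprz; set a := complex.Re _; set b := complex.Im _ => b1 a1.
  have : `|p * a + q * b| <= 1.
    rewrite (le_trans (ler_normD _ _))// !normrM (le_trans _ pq)//.
    by rewrite lerD// ler_piMr.
  by rewrite ler_norml => /andP[? _]; lra.
have /= := @int_cos_sin R n p q; set I1 := integral _ _ _ => I1E.
set I2 := integral _ _ _; have -> : I2 = I1.
  by apply: eq_integral => x _; rewrite /= -exprnP cos_sin_exprn.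
by rewrite I1E /= mulVf// gt_eqF// pi2_gt0.
Qed.

Lemma Rintegral_exprSn (n : nat) :
  \int[mu]_t complex.Re ((t : R[i]) ^ n.+1) = 0 /\
  \int[mu]_t complex.Im ((t : R[i]) ^ n.+1) = 0.
Proof.
have [bR bI] := bmeas_exprz R n.+1.
have i1 := arc_integrable (bmeas_cst 1).
split; apply: (@addrI _ 1).
  rewrite -[in LHS](Rintegral_arc_cst 1) -RintegralD//; last exact: arc_integrable.
  rewrite addr0 -[RHS](@Rintegral_trig n 1 0) ?normr1 ?normr0 ?addr0//.
  by apply: eq_Rintegral => t _; rewrite mul1r mul0r addr0.
rewrite -[in LHS](Rintegral_arc_cst 1) -RintegralD//; last exact: arc_integrable.
rewrite addr0 -[RHS](@Rintegral_trig n 0 1) ?normr1 ?normr0 ?add0r//.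
by apply: eq_Rintegral => t _; rewrite mul1r mul0r add0r.
Qed.

Lemma Rintegral_exprz (n : int) :
  \int[mu]_t complex.Re ((t : R[i]) ^ n) = (n == 0)%:R /\
  \int[mu]_t complex.Im ((t : R[i]) ^ n) = 0.
Proof.
case: n => [[|n]|n].
- split; [rewrite -[RHS](Rintegral_arc_cst 1)|rewrite -[RHS](Rintegral_arc_cst 0)];
    exact: eq_Rintegral.
- exact: Rintegral_exprSn.
- have [hR hI] := Rintegral_exprSn n; split.
    rewrite -[RHS]hR; apply: eq_Rintegral => t _.
    by rewrite cval_exprNz; case: (_ ^ _).
  rewrite -[RHS]oppr0 -hI -mulN1r -RintegralZl//.
    apply: eq_Rintegral => t _; rewrite cval_exprNz mulN1r.
    by case: (_ ^ _).
  by apply: arc_integrable; case: (bmeas_exprz R n.+1).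
Qed.

Lemma Rintegral_cvg (u : circle R -> R) (f : nat -> circle R -> R) g (M : R) :
  mu.-integrable setT (EFin \o u) ->
  (forall n, measurable_fun setT (f n)) -> (forall n t, `|f n t| <= M) ->
  (forall t, f n t @[n --> \oo] --> g t) ->
  \int[mu]_t (u t * f n t) @[n --> \oo] --> \int[mu]_t (u t * g t).
Proof.
move=> iu mf fM fg.
have mu_ : measurable_fun setT u.
  by apply/measurable_EFinP; case/integrableP: iu.
have [mg [M' gM]] := cvg_bmeas mf fM fg.
have [] := @dominated_convergence _ _ R mu setT measurableT
  (fun n t => (u t * f n t)%:E) (fun t => (u t * g t)%:E)
  (fun t => (`|M|%:E * `|(u t)%:E|)%E).
- by move=> n; apply/measurable_EFinP; exact: measurable_funM.
- by apply/measurable_EFinP; exact: measurable_funM.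
- apply: aeW => t _; apply: cvg_EFin; first exact: nearW.
  by apply: cvgM => //; exact: cvg_cst.
- by apply: integrableZl => //; exact: integrable_abse.
- apply: aeW => t n _; rewrite lee_fin normrM mulrC ler_wpM2r//.
  by rewrite (le_trans (fM n t))// ler_norm.
move=> ig _ /= h; apply: fine_cvg.
by rewrite /Rintegral fineK//; apply: integrable_fin_num.
Qed.

Lemma integrable_scale (a : R) (u : circle R -> R) :
  mu.-integrable setT (EFin \o u) ->
  mu.-integrable setT (EFin \o (fun t => a * u t)).
Proof.
move=> iu; rewrite (_ : _ \o _ = (fun t => a%:E * (u t)%:E)%E); first exact: integrableZl.
by apply/funext => t; rewrite /= EFinM.
Qed.

Lemma integrableM_bmeas (u h : circle R -> R) :
  mu.-integrable setT (EFin \o u) -> bmeas h ->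
  mu.-integrable setT (EFin \o (fun t => u t * h t)).
Proof.
move=> iu [mh [M hM]].
have mu_ : measurable_fun setT u by apply/measurable_EFinP; case/integrableP: iu.
apply: (@le_integrable _ _ R mu setT measurableT _ (fun t => (`|M|%:E * `|(u t)%:E|)%E)).
- by apply/measurable_EFinP; exact: measurable_funM.
- move=> t _ /=; rewrite lee_fin !normrM !normr_id mulrC ler_wpM2r//.
  by rewrite (le_trans (hM t))// ler_norm.
- by apply: integrableZl => //; exact: integrable_abse.
Qed.

Lemma trig_null_integral (u : circle R -> R) : mu.-integrable setT (EFin \o u) ->
  (forall n : int, \int[mu]_t (u t * complex.Re ((t : R[i]) ^ n)) = 0) ->
  (forall n : int, \int[mu]_t (u t * complex.Im ((t : R[i]) ^ n)) = 0) ->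
  trig_null (fun h => \int[mu]_t (u t * h t)).
Proof.
move=> iu hR hI; split=> // [a f g bf bg|f g M mf fM fg].
  rewrite -RintegralZl//; last exact: integrableM_bmeas.
  rewrite -RintegralD//; last 2 first.
  - exact/integrable_scale/integrableM_bmeas.
  - exact: integrableM_bmeas.
  by apply: eq_Rintegral => t _; rewrite mulrDr mulrCA.
exact: Rintegral_cvg iu mf fM fg.
Qed.

(** |u| equals 2 u times the indicator of u > 0, minus u. The first term integrates to 0 by
    [trig_null_indic], the second by the hypothesis at n = 0, so |u| has integral 0. *)
Lemma trig_null_ae0 (u : circle R -> R) : mu.-integrable setT (EFin \o u) ->
  (forall n : int, \int[mu]_t (u t * complex.Re ((t : R[i]) ^ n)) = 0) ->
  (forall n : int, \int[mu]_t (u t * complex.Im ((t : R[i]) ^ n)) = 0) ->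
  {ae mu, forall t, u t = 0}.
Proof.
move=> iu hR hI; have tn := trig_null_integral iu hR hI.
have mu_ : measurable_fun setT u by apply/measurable_EFinP; case/integrableP: iu.
have mS : measurable [set t | 0 < u t].
  rewrite -[X in measurable X]setTI; rewrite (_ : [set t | _] = u @^-1` `]0, +oo[%classic).
    exact: mu_.
  by apply/seteqP; split => t /=; rewrite in_itv /= andbT.
have b1 : bmeas (\1_[set t | 0 < u t] : circle R -> R).
  split; first exact: measurable_indic.
  by exists 1 => t; rewrite indicE; case: (_ \in _); rewrite ?normr1 ?normr0.
have h1 := trig_null_indic tn mS.
have h2 : \int[mu]_t u t = 0.
  have := tn_Re tn 0; rewrite -[X in _ = X -> _]h1 => _.
  by rewrite -[RHS](hR 0); apply: eq_Rintegral => t _; rewrite expr0z mulr1.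
have : \int[mu]_t `|u t| = 0.
  have i1 := integrableM_bmeas iu b1.
  have i2 : mu.-integrable setT (EFin \o (fun t => 2 * (u t * \1_[set t | 0 < u t] t))).
    exact: integrable_scale.
  transitivity (\int[mu]_t (2 * (u t * \1_[set t | 0 < u t] t) - u t)).
    apply: eq_Rintegral => t _; rewrite indicE.
    case: (ltP 0 (u t)) => u0.
      by rewrite mem_set//= gtr0_norm//; ring.
    by rewrite memNset /= ?ler0_norm//; [ring|rewrite ltNge u0].
  by rewrite RintegralB// RintegralZl// h1 h2 mulr0 subr0.
move=> hu; have h0 : (\int[mu]_t `|(u t)%:E| = 0)%E.
  rewrite -[LHS]fineK; first by congr EFin.
  apply: (integrable_fin_num measurableT); exact: (integrable_norm iu).
have := @ae_eq_integral_abs _ _ R mu setT measurableT (EFin \o u).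
move=> [|+ _]; first exact/measurable_EFinP.
move=> /(_ h0); apply: filterS => t /(_ I) /=; by case.
Qed.

Lemma Rintegral_lin (a : R) (f g : circle R -> R) : bmeas f -> bmeas g ->
  \int[mu]_t (a * f t + g t) = a * \int[mu]_t f t + \int[mu]_t g t.
Proof.
move=> /arc_integrable bf /arc_integrable bg.
by rewrite RintegralD ?RintegralZl//; exact: integrable_scale.
Qed.

Lemma cinv_cval (t : circle R) : (cinv t : R[i]) = (t : R[i])^*%C.
Proof. by rewrite /= cvalV. Qed.

Lemma cinvK : involutive (@cinv R).
Proof. by move=> t; apply: val_inj; rewrite /= invrK. Qed.

Lemma cinv_continuous : continuous (@cinv R).
Proof.
apply/continuousP => U [V oV <-].
have : ccontinuous (fun t : circle R => (cinv t : R[i])).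
  have /ccontinuousP[cR cI] := @ccontinuous_cval R.
  have eR : (fun s : circle R => complex.Re (cinv s : R[i])) =
            (fun s : circle R => complex.Re (s : R[i])).
    by apply/funext => s; rewrite cinv_cval; case: (s : R[i]).
  have eI : (fun s : circle R => complex.Im (cinv s : R[i])) =
            (fun s : circle R => - complex.Im (s : R[i])).
    by apply/funext => s; rewrite cinv_cval; case: (s : R[i]).
  have cI' : continuous (fun s : circle R => - complex.Im (s : R[i])).
    by move=> s; exact: (cvgN (cI s)).
  by apply/ccontinuousP; split; [move: cR; rewrite -eR|move: cI'; rewrite -eI].
by move/continuousP; apply.
Qed.

Lemma measurable_cinv : measurable_fun setT (@cinv R).
Proof.
apply: (measurability (@open (circle R))) => // _ [_ [U oU <-] <-].
rewrite setTI; apply: sub_sigma_algebra.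
by move/continuousP : cinv_continuous; apply; exists U.
Qed.

(** The integral of t^n does not change under n -> -n, so integration minus reflected integration is
    [trig_null] and annihilates indicators. *)
Lemma arc_cinv (S : set (circle R)) : measurable S -> mu (@cinv R @^-1` S) = mu S.
Proof.
move=> mS.
have bind (A : set (circle R)) : measurable A -> bmeas (\1_A : circle R -> R).
  split; first exact: measurable_indic.
  by exists 1 => t; rewrite indicE; case: (_ \in _); rewrite ?normr1 ?normr0.
have bc (h : circle R -> R) : bmeas h -> bmeas (h \o @cinv R).
  move=> [mh [M hM]]; split; first exact: (measurableT_comp mh measurable_cinv).
  by exists M => t; exact: hM.
pose I (h : circle R -> R) := \int[mu]_t h t - \int[mu]_t h (cinv t).
have tI : trig_null I.
  split.
  - move=> a f g bf bg; rewrite /I.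
    rewrite Rintegral_lin// (Rintegral_lin a (bc _ bf) (bc _ bg)).
    by ring.
  - move=> f g M mf fM fg; have i1 := arc_integrable (bmeas_cst 1).
    rewrite /I; apply: cvgB.
      have := Rintegral_cvg i1 mf fM fg.
      by under eq_fun do under eq_Rintegral do rewrite mul1r;
         under [X in _ --> X]eq_Rintegral do rewrite mul1r.
    have mf' n : measurable_fun setT (f n \o @cinv R).
      exact: (measurableT_comp (mf n) measurable_cinv).
    have := Rintegral_cvg i1 mf' (fun n t => fM n (cinv t)) (fun t => fg (cinv t)).
    by under eq_fun do under eq_Rintegral do rewrite mul1r;
       under [X in _ --> X]eq_Rintegral do rewrite mul1r.
  - move=> n; rewrite /I (Rintegral_exprz n).1.
    rewrite [X in _ - X](_ : _ = \int[mu]_t complex.Re ((t : R[i]) ^ (- n))).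
      by rewrite (Rintegral_exprz (- n)).1 oppr_eq0 subrr.
    by apply: eq_Rintegral => t _ /=; rewrite exprz_inv.
  - move=> n; rewrite /I (Rintegral_exprz n).2 sub0r.
    apply/eqP; rewrite oppr_eq0; apply/eqP.
    by rewrite -[RHS](Rintegral_exprz (- n)).2; apply: eq_Rintegral => t _ /=; rewrite exprz_inv.
have := trig_null_indic tI mS; rewrite /I => /subr0_eq.
have mS' : measurable (@cinv R @^-1` S).
  by rewrite -[X in measurable X]setTI; exact: measurable_cinv.
have mind (A : set (circle R)) : measurable A -> (\int[mu]_t (\1_A t : R))%:E = mu A.
  move=> mA; rewrite /Rintegral fineK ?integral_indic ?setIT//.
  exact: fin_num_measure.
move=> h; rewrite -mind// -(mind S)// h.
by congr EFin; apply: eq_Rintegral.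
Qed.

Lemma integral_cinv (f : circle R -> \bar R) : measurable_fun setT f ->
  (\int[mu]_t f (cinv t) = \int[mu]_t f t)%E.
Proof.
have H (g : circle R -> \bar R) : measurable_fun setT g -> (forall t, 0 <= g t)%E ->
  (\int[mu]_t g (cinv t) = \int[mu]_t g t)%E.
  move=> mg g0; transitivity (\int[pushforward mu (@cinv R)]_t g t)%E.
    by rewrite (ge0_integral_pushforward measurable_cinv).
  apply: eq_measure_integral => [|mc A mA _]; first exact: measurable_cinv.
  exact: (arc_cinv mA).
move=> mf; rewrite integralE [RHS]integralE; congr (_ - _)%E.
  rewrite -(H (f^\+)%E (measurable_funepos mf) (funepos_ge0 f)).
  by apply: eq_integral => x _; rewrite (funepos_comp f (@cinv R)).
rewrite -(H (f^\-)%E (measurable_funeneg mf) (funeneg_ge0 f)).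
  by apply: eq_integral => x _; rewrite (funeneg_comp f (@cinv R)).
Qed.

Lemma arc_open_gt0 (U : set (circle R)) : open U -> U !=set0 -> (0 < mu U)%E.
Proof.
move=> oU [t Ut]; have [x /andP[x0 x2] tE] := expi_exists t.
have oV : open (@expi R @^-1` U).
  by move/continuousP : (@expi_continuous R); apply.
have Vx : (@expi R @^-1` U) x by rewrite /= -tE.
have /nbhs_ballP[e /= e0 eV] := open_nbhs_nbhs (conj oV Vx).
(* The parameter [x] may be an end point of [0, 2 pi], outside of which the uniform density
   vanishes; hence the clipping. *)
pose a := Num.max 0 (x - e); pose b := Num.min (pi *+ 2) (x + e).
have p2 := pi2_gt0 R.
have ab : a < b.
  by rewrite /a /b gt_max !lt_min; apply/andP; split; apply/andP; split; lra.
have a0 : 0 <= a by rewrite le_max lexx.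
have b2 : b <= pi *+ 2 by rewrite ge_min lexx.
have ax : x - e <= a by rewrite le_max lexx orbT.
have bx : b <= x + e by rewrite ge_min lexx orbT.
have sub : `]a, b[%classic `<=` @expi R @^-1` U.
  move=> y; rewrite /= in_itv /= => /andP[ay yb]; apply: eV.
  by rewrite /ball /= ltr_norml; apply/andP; split; lra.
rewrite /arc /pushforward.
have le : (uniform_prob (pi2_gt0 R) `]a, b[%classic <= uniform_prob (pi2_gt0 R) (@expi R @^-1` U))%E.
  apply: le_measure; rewrite ?inE//.
  exact: open_measurable.
apply: lt_le_trans le; rewrite /uniform_prob.
rewrite (eq_integral (fun=> (pi *+ 2)^-1%:E)); last first.
  move=> y; rewrite inE /= in_itv /= => /andP[ay yb].
  rewrite /uniform_pdf subr0 ifT//; apply/andP; split; lra.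
rewrite integral_cst//= lebesgue_measure_itv /= lte_fin ab -EFinD lte_fin.
by rewrite mulr_gt0 ?invr_gt0 ?subr_gt0.
Qed.

(** The set where [f] does not vanish is open, and a nonempty open set has positive measure. *)
Lemma ccontinuous_ae_eq0 (f : circle R -> R[i]) : ccontinuous f ->
  {ae mu, forall t, f t = 0} -> forall t, f t = 0.
Proof.
move=> cf [N [mN N0 subN]] t; apply: contrapT => ft.
have oU : open [set t | f t != 0].
  move/continuousP : cf => /(_ [set z | z != 0]); apply.
  have : closed [set (0 : (R[i] : numFieldType))] by apply: accessible_closed_set1; apply: hausdorff_accessible; exact: norm_hausdorff.
  by move=> /closed_openC; congr open; apply/seteqP; split => z /= /eqP.
have := arc_open_gt0 oU; rewrite ltNge => /(_ _)/negP; apply.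
  by exists t; apply/eqP.
rewrite -[leRHS]N0; apply: le_measure; rewrite ?inE//.
  exact: sub_sigma_algebra.
by move=> s /= /eqP fs; apply: subN => /=.
Qed.

End ArcIntegral.

(** * Fourier series of square integrable functions *)

Section RealIntegrable.
Variable R : realType.
Local Notation mu := (@arc R).
Implicit Types u v : circle R -> R.

Definition rint u := mu.-integrable setT (EFin \o u).

Lemma rint_measurable u : rint u -> measurable_fun setT u.
Proof. by case/integrableP => /measurable_EFinP. Qed.

Lemma rintD u v : rint u -> rint v -> rint (fun t => u t + v t).
Proof. by move=> iu iv; exact: (integrableD measurableT iu iv). Qed.

Lemma rintZ (a : R) u : rint u -> rint (fun t => a * u t).
Proof. exact: integrable_scale. Qed.

Lemma rint_le u v : measurable_fun setT u -> rint v ->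
  (forall t, `|u t| <= v t) -> rint u.
Proof.
move=> mu_ iv uv; apply: (le_integrable measurableT _ _ iv).
  exact/measurable_EFinP.
by move=> t _ /=; rewrite lee_fin (le_trans (uv t))// ler_norm.
Qed.

Lemma rint_cinv u : rint u -> rint (fun t => u (cinv t)).
Proof.
move=> iu; have mu_ := rint_measurable iu.
have mcu : measurable_fun setT (fun t => u (cinv t)).
  exact: (measurableT_comp mu_ (@measurable_cinv R)).
case/integrableP: iu => _ iu; apply/integrableP; split; first exact/measurable_EFinP.
rewrite (_ : (\int[mu]_x _)%E = (\int[mu]_x `|(u x)%:E|)%E)//.
apply: (@integral_cinv R (fun t => `|(u t)%:E|%E)).
by apply: measurableT_comp => //; exact/measurable_EFinP.
Qed.

Lemma Rintegral_cinv u : measurable_fun setT u ->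
  \int[mu]_t u (cinv t) = \int[mu]_t u t.
Proof.
move=> mu_; rewrite /Rintegral; congr fine.
exact: (@integral_cinv R (fun t => (u t)%:E) ((measurable_EFinP _ _).2 mu_)).
Qed.

Lemma ae_eq_Rintegral u v : measurable_fun setT u -> measurable_fun setT v ->
  {ae mu, forall t, u t = v t} -> \int[mu]_t u t = \int[mu]_t v t.
Proof.
move=> mu_ mv uv; rewrite /Rintegral; congr fine; apply: ae_eq_integral => //.
- exact/measurable_EFinP.
- exact/measurable_EFinP.
- by apply: filterS uv => t /= -> _.
Qed.

Lemma rint_ae u v : measurable_fun setT v -> rint u ->
  {ae mu, forall t, u t = v t} -> rint v.
Proof.
move=> mv iu uv; have mu_ := rint_measurable iu.
case/integrableP: (iu) => _ fu; apply/integrableP; split; first exact/measurable_EFinP.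
have <- : (\int[mu]_t `|(u t)%:E| = \int[mu]_t `|(v t)%:E|)%E.
  apply: ae_eq_integral => //.
  - by apply: measurableT_comp => //; exact/measurable_EFinP.
  - by apply: measurableT_comp => //; exact/measurable_EFinP.
  - by apply: filterS uv => t /= -> _.
exact: fu.
Qed.

Lemma rint_sqr u v : measurable_fun setT u -> measurable_fun setT v ->
  rint (fun t => u t ^+ 2) -> rint (fun t => v t ^+ 2) -> rint (fun t => u t * v t).
Proof.
move=> mu_ mv iu iv; apply: (rint_le _ (rintD iu iv)); first exact: measurable_funM.
move=> t; rewrite normrM -(real_normK (num_real (u t))) -(real_normK (num_real (v t))).
have := normr_ge0 (u t); have := normr_ge0 (v t).
move: `|u t| `|v t| => a b a0 b0; nra.
Qed.

End RealIntegrable.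

(** Adding 2 S 2^(-k) to a_k gives a nonincreasing sequence and subtracting it a nondecreasing one;
    this yields the limit and the rate at once. *)
Lemma geometric_cauchy (R : realType) (a : nat -> R) (S : R) : 0 <= S ->
  (forall k, `|a k.+1 - a k| <= S * (2^-1) ^+ k) ->
  cvgn a /\ forall k, `|limn a - a k| <= 2 * S * (2^-1) ^+ k.
Proof.
move=> S0 ha.
pose b k := a k + 2 * S * (2^-1) ^+ k; pose c k := a k - 2 * S * (2^-1) ^+ k.
have q0 k : 0 <= S * (2^-1) ^+ k by rewrite mulr_ge0// exprn_ge0.
have bc k : c k <= b k by rewrite /b /c; have := q0 k; lra.
have nb : nonincreasing_seq b.
  apply/nonincreasing_seqP => k; rewrite /b exprS.
  by have := ha k; rewrite ler_norml => /andP[_]; lra.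
have nc : nondecreasing_seq c.
  apply/nondecreasing_seqP => k; rewrite /c exprS.
  by have := ha k; rewrite ler_norml => /andP[+ _]; lra.
have cb : cvgn b.
  apply: nonincreasing_is_cvgn => //; exists (c 0) => _ [k _ <-].
  by rewrite (le_trans (nc _ _ (leq0n k))).
have q_cvg : (fun k => 2 * S * (2^-1) ^+ k) @ \oo --> (0 : R).
  by apply: cvg_geometric; rewrite ger0_norm//; lra.
have ab : a @ \oo --> limn b.
  rewrite (_ : a = (fun k => b k - 2 * S * (2^-1) ^+ k)).
    by rewrite -[limn b]subr0; exact: cvgB.
  by apply/funext => k; rewrite /b addrK.
have cc : c @ \oo --> limn b.
  by rewrite -[limn b]subr0; exact: cvgB.
split=> [|k]; first by apply/cvg_ex; exists (limn b).
have -> : limn a = limn b by exact/cvg_lim.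
rewrite ler_norml; apply/andP; split.
  have : c k <= limn c by apply: nondecreasing_cvgn_le => //; apply/cvg_ex; exists (limn b).
  rewrite (cvg_lim _ cc)// /c; lra.
have : limn b <= b k by exact: nonincreasing_cvgn_ge.
by rewrite /b; lra.
Qed.

Section ScalarL2.
Variable R : realType.
Local Notation mu := (@arc R).
Local Notation C := R[i].
Implicit Types f g : circle R -> C.

Definition sqn (z : C) : R := complex.Re z ^+ 2 + complex.Im z ^+ 2.

Lemma sqn_ge0 z : 0 <= sqn z. Proof. by rewrite addr_ge0// sqr_ge0. Qed.

Lemma normc_sqr (z : C) : normc z ^+ 2 = sqn z.
Proof. by case: z => a b; rewrite /= sqr_sqrtr// addr_ge0// sqr_ge0. Qed.

Lemma sqnM (y z : C) : sqn (y * z) = sqn y * sqn z.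
Proof. by rewrite -!normc_sqr normcM exprMn. Qed.

Lemma sqnN (z : C) : sqn (- z) = sqn z.
Proof. by case: z => a b; rewrite /sqn /= !sqrrN. Qed.

Lemma sqn_eq0 (z : C) : sqn z = 0 -> z = 0.
Proof.
case: z => a b; rewrite /sqn /= => /eqP.
by rewrite paddr_eq0 ?sqr_ge0// !sqrf_eq0 => /andP[/eqP -> /eqP ->].
Qed.

Lemma sqnD_le (y z : C) : sqn (y + z) <= 2 * sqn y + 2 * sqn z.
Proof.
case: y z => a b [c d]; rewrite /sqn /= -subr_ge0.
rewrite (_ : _ - _ = (a - c) ^+ 2 + (b - d) ^+ 2); last by ring.
by rewrite addr_ge0// sqr_ge0.
Qed.

Lemma sqn_exprz (t : circle R) (n : int) : sqn ((t : C) ^ n) = 1.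
Proof. by rewrite -normc_sqr normc_exprz expr1n. Qed.

Lemma exprzN_conj (t : circle R) (n : int) : (t : C) ^ (- n) = ((t : C) ^ n)^*%C.
Proof.
rewrite -exprz_inv cvalV; case: n => n; first by rewrite -!exprnP rmorphXn.
by rewrite !NegzE -!exprnN rmorphV ?rmorphXn// unitfE expf_neq0// cval_neq0.
Qed.

Lemma measurable_sqn f : cmeasurable f -> measurable_fun setT (fun t => sqn (f t)).
Proof. by move=> [? ?]; apply: measurable_funD; exact: measurable_funX. Qed.

Definition Nsq f : R := \int[mu]_t sqn (f t).

Lemma Lnorm2E (h : circle R -> R) : (forall t, 0 <= h t) ->
  Lnorm mu 2%:E (fun t => (h t)%:E) = ((\int[mu]_t (h t ^+ 2)%:E) `^ 2^-1)%E.
Proof.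
move=> h0; rewrite unlock /=; congr (_ `^ _)%E.
apply: eq_integral => t _; by rewrite ger0_norm// powR_mulrn.
Qed.

Lemma Lp2P f : Lp 2%:E f <-> cmeasurable f /\ rint (fun t => sqn (f t)).
Proof.
have E : (Lnorm mu 2%:E (fun t => (normc (f t))%:E) =
    (\int[mu]_t (sqn (f t))%:E) `^ 2^-1)%E.
  rewrite Lnorm2E; last by move=> t; case: (f t) => a b; exact: sqrtr_ge0.
  by congr (_ `^ _)%E; apply: eq_integral => t _; rewrite normc_sqr.
have I0 : (0 <= \int[mu]_t (sqn (f t))%:E)%E.
  by apply: integral_ge0 => t _; rewrite lee_fin sqn_ge0.
have eqn : (\int[mu]_t `|(sqn (f t))%:E| = \int[mu]_t (sqn (f t))%:E)%E.
  by apply: eq_integral => t _; rewrite gee0_abs// lee_fin sqn_ge0.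
rewrite /Lp /= E; split=> [[mf lt]|[mf /integrableP[_ lt]]]; split=> //.
  apply/integrableP; split; first by apply/measurable_EFinP; exact: measurable_sqn.
  rewrite /= eqn; move: lt I0; case: (integral _ _ _) => [r| |]//=.
    by move=> _ _; rewrite ltry.
  by rewrite invr_eq0 pnatr_eq0.
by apply: poweR_lty; rewrite -eqn.
Qed.

Definition cintg f := rint (fun t => complex.Re (f t)) /\ rint (fun t => complex.Im (f t)).

Lemma L2_cmeasurable f : Lp 2%:E f -> cmeasurable f.
Proof. by case/Lp2P. Qed.

Lemma L2_rint f : Lp 2%:E f -> rint (fun t => sqn (f t)).
Proof. by case/Lp2P. Qed.

Lemma L2D f g : Lp 2%:E f -> Lp 2%:E g -> Lp 2%:E (fun t => f t + g t).
Proof.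
move=> /Lp2P[mf ff] /Lp2P[mg ig]; apply/Lp2P; split; first exact: cmeasurableD.
apply: (rint_le _ (rintD (rintZ 2 ff) (rintZ 2 ig))).
  by apply: measurable_sqn; exact: cmeasurableD.
by move=> t; rewrite ger0_norm ?sqn_ge0// sqnD_le.
Qed.

Lemma L2_bounded_mul (b : circle R -> C) (M : R) f : cmeasurable b ->
  (forall t, sqn (b t) <= M) -> Lp 2%:E f -> Lp 2%:E (fun t => b t * f t).
Proof.
move=> mb bM /Lp2P[mf ff]; apply/Lp2P; split; first exact: cmeasurableM.
apply: (rint_le _ (rintZ M ff)); first by apply: measurable_sqn; exact: cmeasurableM.
by move=> t; rewrite ger0_norm ?sqn_ge0// sqnM ler_wpM2r ?sqn_ge0.
Qed.

Lemma L2Z (a : C) f : Lp 2%:E f -> Lp 2%:E (fun t => a * f t).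
Proof. by apply: (@L2_bounded_mul (fun=> a) (sqn a)) => //; exact: cmeasurable_cst. Qed.

Lemma L2_exprz (n : int) : Lp 2%:E (fun t : circle R => (t : C) ^ n).
Proof.
apply/Lp2P; split; first exact: cmeasurable_exprz.
apply: arc_integrable; split; first by apply: measurable_sqn; exact: cmeasurable_exprz.
by exists 1 => t; rewrite sqn_exprz normr1.
Qed.

Lemma L2_exprzM (n : int) f : Lp 2%:E f -> Lp 2%:E (fun t => (t : C) ^ n * f t).
Proof.
apply: (@L2_bounded_mul _ 1); first exact: cmeasurable_exprz.
by move=> t; rewrite sqn_exprz.
Qed.

Lemma L2_0 : Lp 2%:E (fun _ : circle R => 0 : C).
Proof.
have := L2Z 0 (L2_exprz 0); rewrite (_ : (fun t => _) = (fun=> 0))//.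
by apply/funext => t; rewrite mul0r.
Qed.

Lemma L2_sum (I : Type) (s : seq I) (F : I -> circle R -> C) :
  (forall i, Lp 2%:E (F i)) -> Lp 2%:E (fun t => \sum_(i <- s) F i t).
Proof.
move=> hF; elim: s => [|i s ih].
  by have := L2_0; congr (Lp _ _); apply/funext => t; rewrite big_nil.
by have := L2D (hF i) ih; congr (Lp _ _); apply/funext => t; rewrite big_cons.
Qed.

Lemma cmeasurable_cinv f : cmeasurable f -> cmeasurable (fun t => f (cinv t)).
Proof.
by move=> [fR fI]; split; [exact: (measurableT_comp fR (@measurable_cinv R))
  |exact: (measurableT_comp fI (@measurable_cinv R))].
Qed.

Lemma L2_cinv f : Lp 2%:E f -> Lp 2%:E (fun t => f (cinv t)).
Proof.
move=> /Lp2P[mf ff]; apply/Lp2P; split; first exact: cmeasurable_cinv.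
exact: rint_cinv ff.
Qed.

Lemma Nsq_cinv f : cmeasurable f -> Nsq (fun t => f (cinv t)) = Nsq f.
Proof. by move=> mf; exact: (Rintegral_cinv (measurable_sqn mf)). Qed.

Lemma Nsq_ge0 f : 0 <= Nsq f.
Proof. by apply: Rintegral_ge0 => t _; exact: sqn_ge0. Qed.

Lemma le_Nsq f (v : circle R -> R) : Lp 2%:E f -> rint v ->
  (forall t, sqn (f t) <= v t) -> Nsq f <= \int[mu]_t v t.
Proof. by move=> /L2_rint ff iv fv; apply: le_Rintegral. Qed.

Lemma NsqD_le f g : Lp 2%:E f -> Lp 2%:E g ->
  Nsq (fun t => f t + g t) <= 2 * Nsq f + 2 * Nsq g.
Proof.
move=> hf hg; have /L2_rint rf := hf; have /L2_rint rg := hg.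
rewrite /Nsq -!RintegralZl// -RintegralD//; [|exact: rintZ..].
apply: le_Nsq; [exact: L2D|by apply: rintD; exact: rintZ|].
by move=> t; exact: sqnD_le.
Qed.

Lemma Nsq_bounded_mul (b : circle R -> C) (M : R) f : cmeasurable b ->
  (forall t, sqn (b t) <= M) -> Lp 2%:E f -> Nsq (fun t => b t * f t) <= M * Nsq f.
Proof.
move=> mb bM hf; have /L2_rint rf := hf; rewrite /Nsq -RintegralZl//.
apply: le_Nsq; [exact: L2_bounded_mul hf|exact: rintZ|].
by move=> t; rewrite sqnM ler_wpM2r ?sqn_ge0.
Qed.

Lemma Nsq_ae f g : cmeasurable f -> cmeasurable g ->
  {ae mu, forall t, f t = g t} -> Nsq f = Nsq g.
Proof.
move=> mf mg fg; apply: ae_eq_Rintegral; [exact: measurable_sqn..|].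
by apply: filterS fg => t ->.
Qed.

Lemma L2_cintgM f g : Lp 2%:E f -> Lp 2%:E g -> cintg (fun t => f t * g t).
Proof.
move=> /Lp2P[[fR fI] rf] /Lp2P[[gR gI] rg].
have aux (h : circle R -> C) (k : C -> R) : measurable_fun setT (fun t => k (h t)) ->
    (forall z, k z ^+ 2 <= sqn z) -> rint (fun t => sqn (h t)) ->
    rint (fun t => k (h t) ^+ 2).
  move=> mk kz rh; apply: (rint_le _ rh); first exact: measurable_funX.
  by move=> t; rewrite ger0_norm ?sqr_ge0.
have sR z : complex.Re z ^+ 2 <= sqn z by rewrite lerDl sqr_ge0.
have sI z : complex.Im z ^+ 2 <= sqn z by rewrite lerDr sqr_ge0.
have rfR := aux _ _ fR sR rf; have rfI := aux _ _ fI sI rf.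
have rgR := aux _ _ gR sR rg; have rgI := aux _ _ gI sI rg.
split.
  rewrite (_ : (fun t => _) = (fun t => complex.Re (f t) * complex.Re (g t) +
     (-1) * (complex.Im (f t) * complex.Im (g t)))).
    by apply: rintD; [|apply: rintZ]; exact: rint_sqr.
  by apply/funext => t; rewrite mulN1r; case: (f t) (g t) => [? ?] [].
rewrite (_ : (fun t => _) = (fun t => complex.Re (f t) * complex.Im (g t) +
     complex.Im (f t) * complex.Re (g t))).
  by apply: rintD; exact: rint_sqr.
by apply/funext => t; case: (f t) (g t) => [? ?] [].
Qed.

Lemma cintegralD f g : cintg f -> cintg g ->
  cintegral (fun t => f t + g t) = cintegral f + cintegral g.
Proof.
move=> [fR fI] [gR gI]; rewrite /cintegral.
apply/eqP; rewrite eq_complex /= -!RintegralD//; apply/andP; split; apply/eqP;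
  by apply: eq_Rintegral => t _; case: (f t) (g t) => [? ?] [].
Qed.

Lemma cintegralZ (a : C) f : cintg f -> cintegral (fun t => a * f t) = a * cintegral f.
Proof.
move=> [fR fI]; rewrite /cintegral; case: a => x y.
apply/eqP; rewrite eq_complex /= -!RintegralZl// -RintegralD; [|done|exact: rintZ..].
rewrite -RintegralB; [|done|exact: rintZ..]; apply/andP; split; apply/eqP;
  by apply: eq_Rintegral => t _; case: (f t).
Qed.

Lemma cintgZ (a : C) f : cintg f -> cintg (fun t => a * f t).
Proof.
case: a => x y [fR fI]; split.
  rewrite (_ : (fun t => _) = (fun t => x * complex.Re (f t) + (- y) * complex.Im (f t))).
    by apply: rintD; exact: rintZ.
  by apply/funext => t; case: (f t) => a b /=; rewrite mulNr.
rewrite (_ : (fun t => _) = (fun t => x * complex.Im (f t) + y * complex.Re (f t))).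
  by apply: rintD; exact: rintZ.
by apply/funext => t; case: (f t).
Qed.

Lemma L2_cintg f (n : int) : Lp 2%:E f -> cintg (fun t => f t * (t : C) ^ n).
Proof. by move=> hf; apply: L2_cintgM => //; exact: L2_exprz. Qed.

Lemma fourierD f g n : Lp 2%:E f -> Lp 2%:E g ->
  fourier (fun t => f t + g t) n = fourier f n + fourier g n.
Proof.
move=> hf hg; rewrite /fourier -cintegralD; [|exact: L2_cintg..].
by congr cintegral; apply/funext => t; rewrite mulrDl.
Qed.

Lemma fourierZ (a : C) f n : Lp 2%:E f ->
  fourier (fun t => a * f t) n = a * fourier f n.
Proof.
move=> hf; rewrite /fourier -cintegralZ; last exact: L2_cintg.
by congr cintegral; apply/funext => t; rewrite mulrA.
Qed.

Lemma fourier_exprzM (k : int) f n :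
  fourier (fun t => (t : C) ^ k * f t) n = fourier f (n - k).
Proof.
rewrite /fourier; congr cintegral; apply/funext => t.
by rewrite opprB expfzDr ?cval_neq0//; ring.
Qed.

Lemma fourier_exprz (k n : int) :
  fourier (fun t : circle R => (t : C) ^ k) n = (n == k)%:R.
Proof.
rewrite /fourier /cintegral.
have e (t : circle R) : (t : C) ^ k * (t : C) ^ (- n) = (t : C) ^ (k - n).
  by rewrite expfzDr ?cval_neq0.
under eq_Rintegral do rewrite e.
under [X in _ +i* X]eq_Rintegral do rewrite e.
have [-> ->] := Rintegral_exprz R (k - n).
by rewrite subr_eq0 eq_sym; case: eqP.
Qed.

Lemma fourier_cinv f n : cmeasurable f ->
  fourier (fun t => f (cinv t)) n = fourier f (- n).
Proof.
move=> mf; rewrite /fourier /cintegral opprK.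
have [mR mI] : cmeasurable (fun t => f t * (t : C) ^ n).
  by apply: cmeasurableM => //; exact: cmeasurable_exprz.
rewrite -(Rintegral_cinv mR) -(Rintegral_cinv mI).
have e t : f (cinv t) * (t : C) ^ (- n) = f (cinv t) * (cinv t : C) ^ n.
  by rewrite /= exprz_inv.
by congr (_ +i* _); apply: eq_Rintegral => t _; rewrite e.
Qed.

Lemma fourier_ae f g n : cmeasurable f -> cmeasurable g ->
  {ae mu, forall t, f t = g t} -> fourier f n = fourier g n.
Proof.
move=> mf mg fg.
have [fR fI] := cmeasurableM mf (cmeasurable_exprz R (- n)).
have [gR gI] := cmeasurableM mg (cmeasurable_exprz R (- n)).
rewrite /fourier /cintegral; congr (_ +i* _); apply: ae_eq_Rintegral => //;
  by apply: filterS fg => t ->.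
Qed.

Lemma fourier0 n : fourier (fun _ : circle R => 0 : C) n = 0.
Proof.
have h := fourierZ 0 n (L2_exprz 0); rewrite mul0r in h.
by rewrite -[RHS]h; congr fourier; apply/funext => t; rewrite mul0r.
Qed.

Lemma cintegral_Re f : complex.Re (cintegral f) = \int[mu]_t complex.Re (f t).
Proof. by []. Qed.

(** One complex coefficient only relates moments of the real part of [f] to moments of its imaginary
    part. The coefficients of indices n and -n together determine all four moments, so that
    [trig_null_ae0] applies to each part separately. *)
Lemma fourier_eq0_ae f : Lp 2%:E f -> (forall n, fourier f n = 0) ->
  {ae mu, forall t, f t = 0}.
Proof.
move=> hf f0.
have [] := L2_cintg 0 hf; rewrite /=.
have ef : (fun t : circle R => f t * (t : C) ^ 0) = f.
  by apply/funext => t; rewrite expr0z mulr1.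
move=> iR iI; have iu : rint (fun t => complex.Re (f t)).
  by move: iR; congr rint; apply/funext => t; rewrite expr0z mulr1.
have iv : rint (fun t => complex.Im (f t)).
  by move: iI; congr rint; apply/funext => t; rewrite expr0z mulr1.
pose uR n := \int[mu]_t (complex.Re (f t) * complex.Re ((t : C) ^ n)).
pose uI n := \int[mu]_t (complex.Re (f t) * complex.Im ((t : C) ^ n)).
pose vR n := \int[mu]_t (complex.Im (f t) * complex.Re ((t : C) ^ n)).
pose vI n := \int[mu]_t (complex.Im (f t) * complex.Im ((t : C) ^ n)).
have ib (u h : circle R -> R) := @integrableM_bmeas R u h.
have key n : uR n = vI n /\ uI n + vR n = 0.
  have := f0 (- n); rewrite /fourier opprK /cintegral => /eqP.
  rewrite eq_complex /= => /andP[/eqP h1 /eqP h2].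
  have [bR bI] := bmeas_exprz R n; split.
    apply/eqP; rewrite -subr_eq0 -h1 /uR /vI -RintegralB//; [|exact: ib..].
    by apply/eqP; apply: eq_Rintegral => t _; case: (f t) (_ ^ _) => [? ?] [].
  rewrite -h2 /uI /vR -RintegralD//; [|exact: ib..].
  by apply: eq_Rintegral => t _; case: (f t) (_ ^ _) => [? ?] [].
have uRN n : uR (- n) = uR n.
  by apply: eq_Rintegral => t _; rewrite exprzN_conj; case: (_ ^ _).
have vRN n : vR (- n) = vR n.
  by apply: eq_Rintegral => t _; rewrite exprzN_conj; case: (_ ^ _).
have uvI n : uI (- n) = - uI n /\ vI (- n) = - vI n.
  have [bR bI] := bmeas_exprz R n.
  split; rewrite -[RHS]mulN1r -RintegralZl//; try exact: ib.
    by apply: eq_Rintegral => t _; rewrite exprzN_conj mulN1r; case: (_ ^ _) => a b /=;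
      rewrite mulrN.
  by apply: eq_Rintegral => t _; rewrite exprzN_conj mulN1r; case: (_ ^ _) => a b /=;
    rewrite mulrN.
have z n : [/\ uR n = 0, uI n = 0, vR n = 0 & vI n = 0].
  have [k1 k2] := key n; have [k3 k4] := key (- n).
  move: k3 k4; rewrite uRN vRN (uvI n).1 (uvI n).2 => k3 k4.
  by split; lra.
have aeR := @trig_null_ae0 R (fun t => complex.Re (f t)) iu
  (fun n => let: And4 h _ _ _ := z n in h) (fun n => let: And4 _ h _ _ := z n in h).
have aeI := @trig_null_ae0 R (fun t => complex.Im (f t)) iv
  (fun n => let: And4 _ _ h _ := z n in h) (fun n => let: And4 _ _ _ h := z n in h).
apply: filterS2 aeR aeI => t.
by case: (f t) => a b /= -> ->.
Qed.

Lemma fourier_inj f g : Lp 2%:E f -> Lp 2%:E g ->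
  (forall n, fourier f n = fourier g n) -> {ae mu, forall t, f t = g t}.
Proof.
move=> hf hg fg.
have hd : Lp 2%:E (fun t => f t + (-1) * g t) by apply: L2D => //; exact: L2Z.
have := fourier_eq0_ae hd; have z n : fourier (fun t => f t + (-1) * g t) n = 0.
  by rewrite fourierD ?fourierZ// ?fg ?mulN1r ?subrr//; exact: L2Z.
by move=> /(_ z); apply: filterS => t /eqP; rewrite mulN1r subr_eq0 => /eqP.
Qed.

Lemma Nsq_addexp f (c : C) (k : int) : Lp 2%:E f ->
  Nsq (fun t => f t + c * (t : C) ^ k) =
  Nsq f + 2 * complex.Re (c^*%C * fourier f k) + sqn c.
Proof.
move=> hf; have [iR iI] := L2_cintg (- k) hf.
have [iR' iI'] := cintgZ c^*%C (L2_cintg (- k) hf).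
rewrite /fourier -(cintegralZ _ (L2_cintg (- k) hf)) cintegral_Re.
rewrite -[sqn c](Rintegral_arc_cst (sqn c)) /Nsq -RintegralZl//.
have rf := L2_rint hf.
have i1 : rint (fun _ : circle R => sqn c) by exact: (arc_integrable (bmeas_cst (sqn c))).
rewrite -RintegralD//; last exact: rintZ.
rewrite -RintegralD//; last by apply: rintD => //; exact: rintZ.
apply: eq_Rintegral => t _.
have := sqn_exprz t k.
rewrite exprzN_conj.
case: (f t) c {iR iI iR' iI' i1} (_ ^ _) => [a b] [x y] [p q]; rewrite /sqn /= => pq.
have -> : x ^+ 2 + y ^+ 2 = (x ^+ 2 + y ^+ 2) * (p ^+ 2 + q ^+ 2).
  by rewrite pq mulr1.
ring.
Qed.

Definition trig (s : seq int) (c : int -> C) (t : circle R) : C :=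
  \sum_(k <- s) c k * (t : C) ^ k.

Lemma L2_trig s c : Lp 2%:E (trig s c).
Proof. by apply: L2_sum => k; apply: L2Z; exact: L2_exprz. Qed.

Lemma fourier_trig s c n : uniq s ->
  fourier (trig s c) n = if n \in s then c n else 0.
Proof.
elim: s => [_|k s ih /= /andP[ks us]].
  rewrite /= -(fourier0 n); congr fourier; apply/funext => t.
  by rewrite /trig big_nil.
have -> : trig (k :: s) c = (fun t => c k * (t : C) ^ k + trig s c t).
  by apply/funext => t; rewrite /trig big_cons.
have hk := L2_exprz k; have hs := L2_trig s c; have hck := L2Z (c k) hk.
rewrite fourierD ?fourierZ ?fourier_exprz ?ih//.
rewrite inE; case: eqP => [->|_]; last by rewrite mulr0 add0r.
by rewrite (negbTE ks) addr0 mulr1.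
Qed.

(** Induction on [s]: the k-th coefficient of the remainder is still f_k when the k-th term is
    subtracted, and by [Nsq_addexp] this lowers the squared norm by |f_k|^2. *)
Lemma bessel_eq f (s : seq int) : Lp 2%:E f -> uniq s ->
  Nsq (fun t => f t - trig s (fourier f) t) =
  Nsq f - \sum_(k <- s) sqn (fourier f k).
Proof.
move=> hf; elim: s => [_|k s ih /= /andP[ks us]].
  rewrite big_nil subr0; congr Nsq; apply/funext => t.
  by rewrite /trig big_nil subr0.
have hft : Lp 2%:E (fun t => f t - trig s (fourier f) t).
  have := L2D hf (L2Z (-1) (L2_trig s (fourier f))).
  by congr (Lp _ _); apply/funext => t; rewrite mulN1r.
have -> : (fun t => f t - trig (k :: s) (fourier f) t) =
          (fun t => (f t - trig s (fourier f) t) + (- fourier f k) * (t : C) ^ k).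
  by apply/funext => t; rewrite /trig big_cons mulNr opprD addrA addrAC.
rewrite Nsq_addexp// ih// big_cons.
have -> : fourier (fun t => f t - trig s (fourier f) t) k = fourier f k.
  have -> : (fun t => f t - trig s (fourier f) t) =
            (fun t => f t + (-1) * trig s (fourier f) t).
    by apply/funext => t; rewrite mulN1r.
  rewrite fourierD// ?fourierZ ?fourier_trig ?(negbTE ks) ?mulr0 ?addr0//.
  - exact: L2_trig.
  - by apply: L2Z; exact: L2_trig.
by case: (fourier f k) => a b; rewrite /sqn /=; ring.
Qed.

Lemma Nsq_trig s c : uniq s -> Nsq (trig s c) = \sum_(k <- s) sqn (c k).
Proof.
move=> us; have := bessel_eq (L2_trig s c) us.
have -> : (fun t => trig s c t - trig s (fourier (trig s c)) t) = (fun=> 0).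
  apply/funext => t; apply/eqP; rewrite subr_eq0; apply/eqP.
  by apply: eq_big_seq => k ks; rewrite fourier_trig// ks.
have -> : Nsq (fun _ : circle R => 0 : C) = 0.
  rewrite /Nsq -[RHS](@Rintegral_arc_cst R 0); apply: eq_Rintegral => t _.
  by rewrite /sqn /= expr0n addr0.
move=> /esym/subr0_eq ->; apply: eq_big_seq => k ks.
by rewrite fourier_trig// ks.
Qed.

Lemma bessel_le f (s : seq int) : Lp 2%:E f -> uniq s ->
  \sum_(k <- s) sqn (fourier f k) <= Nsq f.
Proof. by move=> hf us; rewrite -subr_ge0 -bessel_eq// Nsq_ge0. Qed.

Lemma sqn_fourier_le f n : Lp 2%:E f -> sqn (fourier f n) <= Nsq f.
Proof. by move=> hf; have := @bessel_le f [:: n] hf isT; rewrite big_seq1. Qed.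

Lemma L2B f g : Lp 2%:E f -> Lp 2%:E g -> Lp 2%:E (fun t => f t - g t).
Proof.
move=> hf hg; have := L2D hf (L2Z (-1) hg).
by congr (Lp _ _); apply/funext => t; rewrite mulN1r.
Qed.

Lemma fourierB f g n : Lp 2%:E f -> Lp 2%:E g ->
  fourier (fun t => f t - g t) n = fourier f n - fourier g n.
Proof.
move=> hf hg; rewrite -mulN1r -fourierZ// -fourierD//; last exact: L2Z.
by congr fourier; apply/funext => t; rewrite mulN1r.
Qed.

(* Integrability of [\sum_k 4^k |u_{k+1} - u_k|^2] bounds almost every sequence of
   increments by a multiple of [2^-k]. *)
Lemma L2_complete (u : nat -> circle R -> C) : (forall k, Lp 2%:E (u k)) ->
  (forall k, Nsq (fun t => u k.+1 t - u k t) <= (16 ^+ k)^-1) ->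
  exists g, Lp 2%:E g /\ exists K : R, forall k,
    Nsq (fun t => g t - u k t) <= K * (4 ^+ k)^-1.
Proof.
move=> hu hN.
pose d k t := u k.+1 t - u k t.
have hd k : Lp 2%:E (d k) by exact: L2B.
pose G t : \bar R := (\sum_(0 <= k <oo) (4 ^+ k * sqn (d k t))%:E)%E.
have G0 t : (0 <= G t)%E.
  by apply: nneseries_ge0 => k _ _; rewrite lee_fin mulr_ge0 ?exprn_ge0 ?sqn_ge0.
have mG1 k : measurable_fun setT (fun t => (4 ^+ k * sqn (d k t))%:E).
  apply/measurable_EFinP; apply: measurable_funM => //.
  exact: measurable_sqn (L2_cmeasurable (hd k)).
have mG : measurable_fun setT G.
  apply: ge0_emeasurable_sum => // k t _ _.
  by rewrite lee_fin mulr_ge0 ?exprn_ge0 ?sqn_ge0.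
have iG : (\int[mu]_t G t < +oo)%E.
  rewrite integral_nneseries//; last first.
    by move=> k t _; rewrite lee_fin mulr_ge0 ?exprn_ge0 ?sqn_ge0.
  apply: (@le_lt_trans _ _ (\sum_(0 <= k <oo) ((4^-1) ^+ k)%:E)%E).
    apply: lee_nneseries => [k _ _|k _].
      by apply: integral_ge0 => t _; rewrite lee_fin mulr_ge0 ?exprn_ge0 ?sqn_ge0.
    have ri : rint (fun t => 4 ^+ k * sqn (d k t)) by apply: rintZ; exact: L2_rint.
    have -> : (\int[mu]_t (4 ^+ k * sqn (d k t))%:E =
        (\int[mu]_t (4 ^+ k * sqn (d k t)))%:E)%E.
      by rewrite /Rintegral fineK//; exact: integrable_fin_num ri.
    rewrite RintegralZl//; last exact: L2_rint.
    have k4 : 0 <= (4 : R) ^+ k by rewrite exprn_ge0.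
    rewrite lee_fin; apply: (le_trans (ler_wpM2l k4 (hN k))).
    by rewrite -!exprVn -exprMn (_ : (4 : R) * 16^-1 = 4^-1)//; field.
  apply: (@le_lt_trans _ _ 2%:E); last by rewrite ltry.
  apply: lime_le.
    by apply: is_cvg_nneseries => k _ _; rewrite lee_fin exprn_ge0.
  apply: nearW => n; rewrite sumEFin lee_fin.
  apply: (@le_trans _ _ (2 - 2 * (4^-1) ^+ n)).
    elim: n => [|n ih]; first by rewrite big_geq// expr0 mulr1 subrr.
    rewrite big_nat_recr//= exprS.
    have : 0 <= (4^-1 : R) ^+ n by rewrite exprn_ge0.
    move: ih; set x := \sum_(_ <= _ < _) _; set y := _ ^+ n; lra.
  by rewrite gerBl mulr_ge0// exprn_ge0.
have [N [mN N0 subN]] : {ae mu, forall t, G t \is a fin_num}.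
  have : mu.-integrable setT G.
    apply/integrableP; split => //.
    by rewrite (eq_integral G)// => t _; rewrite gee0_abs.
  by move=> /(integrable_ae measurableT); apply: filterS => t; exact.
have Gfin t : ~ N t -> G t \is a fin_num by move=> nN; apply: contrapT => h; apply/nN/subN.
pose S t := Num.sqrt (fine (G t)).
have dle t k : ~ N t -> sqn (d k t) <= (S t * (2^-1) ^+ k) ^+ 2.
  move=> /Gfin Gf.
  have : (\sum_(0 <= i < k.+1) (4 ^+ i * sqn (d i t))%:E <= G t)%E.
    by apply: nneseries_lim_ge => i _ _; rewrite lee_fin mulr_ge0 ?exprn_ge0 ?sqn_ge0.
  rewrite sumEFin -[G t]fineK// lee_fin big_nat_recr//= => le1.
  have : 4 ^+ k * sqn (d k t) <= fine (G t).
    apply: le_trans le1; rewrite lerDr; apply: sumr_ge0 => i _.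
    by rewrite mulr_ge0 ?exprn_ge0 ?sqn_ge0.
  rewrite exprMn sqr_sqrtr ?fine_ge0// -exprM mulnC exprM -ler_pdivlMl ?exprn_gt0//.
  by rewrite mulrC (_ : (2^-1 : R) ^+ 2 = 4^-1) ?exprVn//; field.
have S0 t : 0 <= S t by exact: sqrtr_ge0.
(* [p] stands for the real or the imaginary part. The sequences are set to 0 on the null set [N], so
   that they converge everywhere and the limit is measurable. *)
have lim_u (p : C -> R) : (forall y z, p (y - z) = p y - p z) ->
    (forall z, p z ^+ 2 <= sqn z) -> (forall f, Lp 2%:E f -> measurable_fun setT (fun t => p (f t))) ->
    exists2 h : circle R -> R, measurable_fun setT h &
      forall t, ~ N t -> forall k, `|h t - p (u k t)| <= 2 * S t * (2^-1) ^+ k.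
  move=> pB psq mp.
  pose v k t := p (u k t) * \1_(~` N) t.
  have mv k : measurable_fun setT (v k).
    by apply: measurable_funM; [exact: mp|apply: measurable_indic; exact: measurableC].
  have H t : ~ N t -> cvgn (fun k => p (u k t)) /\
     forall k, `|limn (fun k => p (u k t)) - p (u k t)| <= 2 * S t * (2^-1) ^+ k.
    move=> nN; apply: geometric_cauchy => // k.
    have := dle t k nN; have := psq (d k t); rewrite /d pB => h1 h2.
    rewrite -(ler_pXn2r (n := 2)) ?nnegrE ?normr_ge0//.
      by rewrite real_normK ?num_real// (le_trans h1 h2).
    by rewrite mulr_ge0// exprn_ge0.
  have vE k t : v k t = if `[< N t >] then 0 else p (u k t).
    rewrite /v indicE; case: asboolP => Nt.
      by rewrite memNset ?mulr0//; apply.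
    by rewrite mem_set ?mulr1.
  pose h t := if `[< N t >] then 0 else limn (fun k => p (u k t)).
  exists h; last first.
    by move=> t nN k; rewrite /h; case: asboolP => // _; exact: (H t nN).2.
  apply: (measurable_fun_cvg mv) => t _.
  rewrite /h; case: asboolP => Nt.
    rewrite (_ : v ^~ t = cst 0); first exact: cvg_cst.
    by apply/funext => k; rewrite vE; case: asboolP.
  rewrite (_ : v ^~ t = (fun k => p (u k t))); first exact: (H t Nt).1.
  by apply/funext => k; rewrite vE; case: asboolP.
have [hR mR HR] := lim_u (@complex.Re R) (fun y z => ltac:(by case: y z => ? ? []))
  (fun z => ltac:(by rewrite lerDl sqr_ge0)) (fun f hf => (L2_cmeasurable hf).1).
have [hI mI HI] := lim_u (@complex.Im R) (fun y z => ltac:(by case: y z => ? ? []))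
  (fun z => ltac:(by rewrite lerDr sqr_ge0)) (fun f hf => (L2_cmeasurable hf).2).
pose g t := hR t +i* hI t.
have mg : cmeasurable g by [].
have mind (h : circle R -> R) : measurable_fun setT h ->
    measurable_fun setT (fun t => if `[< N t >] then 0 else h t).
  move=> mh; rewrite (_ : (fun t => _) = (fun t => h t * \1_(~` N) t)).
    by apply: measurable_funM => //; apply: measurable_indic; exact: measurableC.
  apply/funext => t; rewrite indicE; case: asboolP => Nt.
    by rewrite memNset ?mulr0//; apply.
  by rewrite mem_set ?mulr1.
have aeN : {ae mu, forall t, ~ N t}.
  by exists N; split=> // t /= /contrapT.
have iGr : rint (fun t => if `[< N t >] then 0 else fine (G t)).
  have iG' : mu.-integrable setT G.
    apply/integrableP; split => //.
    by rewrite (eq_integral G)// => t _; rewrite gee0_abs.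
  apply: (le_integrable measurableT _ _ iG').
    have mf : measurable_fun setT (@fine R) by [].
    have mfG : measurable_fun setT (fun t => fine (G t)) by exact: (measurableT_comp mf mG).
    by apply/measurable_EFinP; exact: mind mfG.
  move=> t _ /=; rewrite [leRHS]gee0_abs//; case: asboolP => Nt.
    by rewrite normr0.
  by rewrite ger0_norm ?fine_ge0// fineK//; exact: Gfin.
(* The factor 8 is twice the square of the factor 2 in [geometric_cauchy]: one share for the real
   part and one for the imaginary part. *)
have gu k : rint (fun t => sqn (g t - u k t)) /\
  Nsq (fun t => g t - u k t) <=
     (8 * \int[mu]_t (if `[< N t >] then 0 else fine (G t))) * (4 ^+ k)^-1.
  have mgu : cmeasurable (fun t => g t - u k t).
    have := cmeasurableD mg (L2_cmeasurable (L2Z (-1) (hu k))).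
    by congr cmeasurable; apply/funext => t; rewrite mulN1r.
  have msq := measurable_sqn mgu.
  pose w t := if `[< N t >] then 0 else sqn (g t - u k t).
  have w_le t : `|w t| <= 8 * (4 ^+ k)^-1 * (if `[< N t >] then 0 else fine (G t)).
    rewrite /w; case: asboolP => Nt; first by rewrite normr0 mulr0.
    rewrite ger0_norm ?sqn_ge0//.
    have e4 : 8 * (4 ^+ k)^-1 * fine (G t) =
        (2 * S t * (2^-1) ^+ k) ^+ 2 + (2 * S t * (2^-1) ^+ k) ^+ 2.
      rewrite !exprMn sqr_sqrtr ?fine_ge0// -exprM mulnC exprM.
      by rewrite (_ : (2^-1 : R) ^+ 2 = 4^-1) -?exprVn; [ring|field].
    rewrite e4 /sqn lerD//.
      rewrite -(real_normK (num_real (complex.Re _))) lerXn2r ?nnegrE ?normr_ge0//.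
        by rewrite !mulr_ge0// exprn_ge0.
      by have := HR t Nt k; rewrite /g; case: (u k t).
    rewrite -(real_normK (num_real (complex.Im _))) lerXn2r ?nnegrE ?normr_ge0//.
      by rewrite !mulr_ge0// exprn_ge0.
    by have := HI t Nt k; rewrite /g; case: (u k t).
  have iw : rint w by apply: (rint_le _ (rintZ (8 * (4 ^+ k)^-1) iGr)) => //; exact: mind.
  have aew : {ae mu, forall t, w t = sqn (g t - u k t)}.
    by apply: filterS aeN => t nN; rewrite /w; case: asboolP.
  split; first exact: rint_ae iw aew.
  rewrite /Nsq -(ae_eq_Rintegral (mind _ msq) msq aew) mulrAC -RintegralZl//.
  apply: le_Rintegral => //; first exact: rintZ.
  by move=> t _; rewrite (le_trans (ler_norm _))// w_le.
exists g; split; last by eexists => k; exact: (gu k).2.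
have h1 : Lp 2%:E (fun t => g t - u 0 t).
  apply/Lp2P; split; last exact: (gu 0).1.
  have := cmeasurableD mg (L2_cmeasurable (L2Z (-1) (hu 0))).
  by congr cmeasurable; apply/funext => t; rewrite mulN1r.
have := L2D h1 (hu 0); congr (Lp _ _).
by apply/funext => t; rewrite subrK.
Qed.

Definition symseq (m : nat) : seq int := [seq (i%:Z - m%:Z)%R | i <- iota 0 m.*2.+1].

Lemma symseq_uniq m : uniq (symseq m).
Proof. by rewrite map_inj_uniq ?iota_uniq// => i j /addIr []. Qed.

Lemma mem_symseq m (k : int) : (k \in symseq m) = (`|k| <= m)%N.
Proof.
apply/mapP/idP => [[j]|km].
  by rewrite mem_iota add0n => /andP[_ jm] ->; lia.
exists (absz (k + m%:Z)); last by lia.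
by rewrite mem_iota; lia.
Qed.

(** Squared distances between partial sums are differences of the bounded monotone sequence [s].
    Indices at which [s] is within 16^(-k) of its limit give a sequence to which [L2_complete]
    applies. *)
Lemma riesz_fischer (c : int -> C) (M : R) :
  (forall m, \sum_(k <- symseq m) sqn (c k) <= M) ->
  exists g, [/\ Lp 2%:E g, forall n, fourier g n = c n, Nsq g <= M &
    forall e : R, 0 < e -> exists m, Nsq (fun t => g t - trig (symseq m) c t) < e].
Proof.
move=> hM; pose s m := \sum_(k <- symseq m) sqn (c k).
have diff i j : (i <= j)%N ->
    Nsq (fun t => trig (symseq j) c t - trig (symseq i) c t) = s j - s i.
  move=> ij; have := bessel_eq (L2_trig (symseq j) c) (symseq_uniq i).
  have fc k : k \in symseq i -> fourier (trig (symseq j) c) k = c k.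
    rewrite mem_symseq => ki; rewrite fourier_trig ?symseq_uniq// mem_symseq.
    by rewrite (leq_trans ki ij).
  have -> : \sum_(k <- symseq i) sqn (fourier (trig (symseq j) c) k) = s i.
    by apply: eq_big_seq => k ki; rewrite fc.
  rewrite Nsq_trig ?symseq_uniq// => <-; congr Nsq; apply/funext => t; congr (_ - _).
  by apply: eq_big_seq => k ki; rewrite fc.
have s_nd : nondecreasing_seq s.
  by move=> i j ij; rewrite -subr_ge0 -diff// Nsq_ge0.
have s_cvg : cvgn s.
  by apply: nondecreasing_is_cvgn => //; exists M => _ [m _ <-]; exact: hM.
pose L := limn s.
have sL m : s m <= L by exact: nondecreasing_cvgn_le.
have ex k : exists m, (k <= m)%N /\ L - s m <= (16 ^+ k)^-1.
  have e0 : 0 < (16 ^+ k)^-1 :> R by rewrite invr_gt0 exprn_gt0.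
  have /cvgrPdist_le/(_ _ e0)[m0 _ h] := s_cvg.
  exists (maxn k m0); split; first exact: leq_maxl.
  by have /= := h _ (leq_maxr k m0); apply: le_trans; rewrite ler_norm.
have [phi hphi] := choice ex.
pose u k := trig (symseq (phi k)) c.
have hu k : Lp 2%:E (u k) by exact: L2_trig.
have uN k : Nsq (fun t => u k.+1 t - u k t) <= (16 ^+ k)^-1.
  have [_ h1] := hphi k; have [_ h2] := hphi k.+1.
  have h3 : (16 ^+ k.+1)^-1 <= (16 ^+ k)^-1 :> R.
    rewrite lef_pV2 ?posrE ?exprn_gt0// exprS ler_peMl ?exprn_ge0//; lra.
  have l1 := sL (phi k); have l2 := sL (phi k.+1).
  (* The chosen indices [phi k] need not increase with k, so both orders occur. *)
  have [ij|ji] := leqP (phi k) (phi k.+1); first by rewrite diff//; lra.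
  have -> : Nsq (fun t => u k.+1 t - u k t) = Nsq (fun t => u k t - u k.+1 t).
    by apply: eq_Rintegral => t _; rewrite -sqnN opprB.
  rewrite diff; last exact: ltnW.
  lra.
have [g [hg [K hK]]] := L2_complete hu uN.
have gu0 (e : R) : 0 < e -> \forall k \near \oo, Nsq (fun t => g t - u k t) < e.
  move=> e0; have : (fun k => K * (4^-1) ^+ k) @ \oo --> (0 : R).
    by apply: cvg_geometric; rewrite ger0_norm//; lra.
  move=> /cvgrPdist_lt/(_ _ e0); apply: filterS => k; rewrite sub0r normrN => h.
  by rewrite (le_lt_trans (hK k))// -exprVn (le_lt_trans (ler_norm _)).
have fg n : fourier g n = c n.
  apply/eqP; rewrite -subr_eq0; apply/eqP; apply: sqn_eq0.
  apply/eqP; rewrite eq_le sqn_ge0 andbT; apply/ler_addgt0Pr => e e0; rewrite add0r.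
  near \oo => k.
  have -> : fourier g n - c n = fourier (fun t => g t - u k t) n.
    rewrite fourierB// fourier_trig ?symseq_uniq// mem_symseq ifT//.
    have [kp _] := hphi k; apply: leq_trans kp.
    by near: k; exact: nbhs_infty_ge.
  rewrite (le_trans (sqn_fourier_le n (L2B hg (hu k))))// ltW//.
  by near: k; exact: gu0.
exists g; split => //.
  apply/ler_addgt0Pr => e e0; near \oo => k.
  have := bessel_eq hg (symseq_uniq (phi k)).
  rewrite (eq_bigr (fun k => sqn (c k))); last by move=> i _; rewrite fg.
  have -> : (fun t => g t - trig (symseq (phi k)) (fourier g) t) = (fun t => g t - u k t).
    by apply/funext => t; congr (_ - _); apply: eq_bigr => i _; rewrite fg.
  move=> h; have : Nsq (fun t => g t - u k t) < e by near: k; exact: gu0.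
  by have := hM (phi k); rewrite h; lra.
move=> e e0; near \oo => k; exists (phi k).
by near: k; exact: gu0.
Unshelve. all: by end_near. Qed.

(** [riesz_fischer] rebuilds from the coefficients of [f] a function that its partial sums
    approximate; by uniqueness of coefficients it is [f] almost everywhere. *)
Lemma trig_dense f : Lp 2%:E f -> forall e : R, 0 < e ->
  exists m, Nsq (fun t => f t - trig (symseq m) (fourier f) t) < e.
Proof.
move=> hf e e0.
have [g [hg fg _ H]] := riesz_fischer (fun m => bessel_le hf (symseq_uniq m)).
have [m hm] := H e e0; exists m; rewrite (_ : Nsq _ =
  Nsq (fun t => g t - trig (symseq m) (fourier f) t))//.
have ht := L2_trig (symseq m) (fourier f).
apply: Nsq_ae; [exact: L2_cmeasurable (L2B hf ht)|exact: L2_cmeasurable (L2B hg ht)|].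
have gf := fourier_inj hf hg (fun n => esym (fg n)).
by apply: filterS gf => t ->.
Qed.

(** The truncated coefficients satisfy Bessel's inequality, hence by [riesz_fischer] the set from
    which [xget] chooses is inhabited and its default value is never taken. *)
Lemma riesz_spec f : Lp 2%:E f ->
  [/\ Lp 2%:E (riesz f),
      forall n, fourier (riesz f) n = if 0 <= n then fourier f n else 0 &
      Nsq (riesz f) <= Nsq f].
Proof.
move=> hf; pose c n : C := if 0 <= n then fourier f n else 0.
have cM m : \sum_(k <- symseq m) sqn (c k) <= Nsq f.
  apply: le_trans (bessel_le hf (symseq_uniq m)); apply: ler_sum => k _.
  rewrite /c; case: ifP => // _; rewrite {1}/sqn /= expr0n addr0.
  exact: sqn_ge0.
have [g [hg fg Ng _]] := riesz_fischer cM.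
have [hr fr] : Lp 2%:E (riesz f) /\ forall n, fourier (riesz f) n = c n.
  by rewrite /riesz; case: xgetP => [h -> []//|/(_ g)[]].
split=> //; rewrite (_ : Nsq _ = Nsq g)//; apply: Nsq_ae.
- exact: L2_cmeasurable.
- exact: L2_cmeasurable.
- by apply: fourier_inj => // n; rewrite fr fg.
Qed.

(* Approximate [f] by its partial Fourier sums. *)
Lemma fourier_mul_le0 (b : circle R -> C) (M : R) f (m : int) :
  Lp 2%:E b -> (forall t, sqn (b t) <= M) -> Lp 2%:E f ->
  (forall n, 0 < n -> fourier b n = 0) -> (forall n, m < n -> fourier f n = 0) ->
  forall n, m < n -> fourier (fun t => b t * f t) n = 0.
Proof.
move=> hb bM hf b0 f0 n mn.
have hbf g : Lp 2%:E g -> Lp 2%:E (fun t => b t * g t).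
  exact: (L2_bounded_mul (L2_cmeasurable hb) bM).
have M0 : 0 <= M by rewrite (le_trans (sqn_ge0 _) (bM (expi 0))).
apply: sqn_eq0; apply/eqP; rewrite eq_le sqn_ge0 andbT.
apply/ler_addgt0Pr => e e0; rewrite add0r.
have e0' : 0 < e / (M + 1) by rewrite divr_gt0// ltr_pwDr.
have [j hj] := trig_dense hf e0'.
set T := trig _ _ in hj.
have hT : Lp 2%:E T by exact: L2_trig.
have Tn : fourier (fun t => b t * T t) n = 0.
  have -> : (fun t => b t * T t) =
      (fun t => \sum_(k <- symseq j) fourier f k * ((t : C) ^ k * b t)).
    apply/funext => t; rewrite /T /trig mulr_sumr; apply: eq_bigr => k _.
    by rewrite mulrCA [b t * _]mulrC.
  have fsum (s : seq int) (F : int -> circle R -> C) : (forall k, Lp 2%:E (F k)) ->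
      fourier (fun t => \sum_(k <- s) F k t) n = \sum_(k <- s) fourier (F k) n.
    move=> hF; elim: s => [|k s ih].
      rewrite big_nil -[RHS](fourier0 n); congr fourier; apply/funext => t.
      by rewrite big_nil.
    rewrite big_cons -ih -fourierD//; last exact: L2_sum.
    by congr fourier; apply/funext => t; rewrite big_cons.
  rewrite fsum; last by move=> k; apply: L2Z; exact: L2_exprzM.
  rewrite big1// => k _; rewrite fourierZ; last exact: L2_exprzM.
  rewrite fourier_exprzM; have [km|mk] := leP k m; last by rewrite f0// mul0r.
  by rewrite b0 ?mulr0// subr_gt0 (le_lt_trans km).
have -> : fourier (fun t => b t * f t) n = fourier (fun t => b t * (f t - T t)) n.
  rewrite -[LHS]subr0 -Tn -fourierB; [|exact: hbf..].
  by congr fourier; apply/funext => t; rewrite mulrBr.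
have hfT := L2B hf hT.
rewrite (le_trans (sqn_fourier_le n (hbf _ hfT)))//.
rewrite (le_trans (Nsq_bounded_mul (L2_cmeasurable hb) bM hfT))//.
apply: (@le_trans _ _ (M * (e / (M + 1)))); first by rewrite ler_wpM2l// ltW.
by rewrite mulrCA ler_piMr ?(ltW e0)// ler_pdivrMr ?mul1r ?lerDl// ltr_pwDr.
Qed.

(** Compactness is taken from the interval [0, 2 pi], which [expi] maps onto the circle. *)
Lemma ccontinuous_bounded f : ccontinuous f -> exists M, forall t, sqn (f t) <= M.
Proof.
move=> /ccontinuousP[fR fI].
have aux (h : circle R -> R) : continuous h -> exists M, forall t, h t ^+ 2 <= M.
  move=> ch; have cg : {within `[0, (pi *+ 2 : R)], continuous (fun x => h (expi x) * h (expi x))}.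
    by apply: continuous_subspaceT => x; apply: cvgM;
      (apply: (@continuous_comp _ _ _ (@expi R) h); [exact: expi_continuous|exact: ch]).
  have [|x _ hx] := EVT_max _ cg; first exact/ltW/pi2_gt0.
  exists (h (expi x) * h (expi x)) => t; have [y y01 ->] := expi_exists t.
  by rewrite expr2; apply: hx; rewrite in_itv.
have [M1 h1] := aux _ fR; have [M2 h2] := aux _ fI.
by exists (M1 + M2) => t; rewrite lerD.
Qed.

Lemma ccontinuous_L2 f : ccontinuous f -> Lp 2%:E f.
Proof.
move=> cf; have [M fM] := ccontinuous_bounded cf.
have mf := ccontinuous_measurable cf.
have := L2_bounded_mul mf fM (L2_exprz 0); congr (Lp _ _).
by apply/funext => t; rewrite expr0z mulr1.
Qed.

Lemma ccontinuous_Loo f : ccontinuous f -> Lp +oo%E f.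
Proof.
move=> cf; have [M fM] := ccontinuous_bounded cf.
split; first exact: ccontinuous_measurable.
rewrite unlock; case: ifPn => [_|_]; last by rewrite ltry.
apply: (@le_lt_trans _ _ (1 + M)%:E); last by rewrite ltry.
apply/ess_supP; apply: nearW => t /=.
rewrite lee_fin ger0_norm; last by case: (f t) => a b; exact: sqrtr_ge0.
have := fM t; rewrite -normc_sqr; have := normr_ge0 (normc (f t)).
set x := normc _ => _ h; nra.
Qed.

End ScalarL2.

(** * Operators on vector-valued functions *)

Section VectorL2.
Variable R : realType.
Local Notation mu := (@arc R).
Local Notation C := R[i].

Definition vf n (f : vfun R n) (k : int) : 'cV[C]_n :=
  \col_i fourier (fun t => f t i 0) k.

Definition vN n (f : vfun R n) : R := \sum_i Nsq (fun t => f t i 0).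

Lemma vN_ge0 n (f : vfun R n) : 0 <= vN f.
Proof. by apply: sumr_ge0 => i _; exact: Nsq_ge0. Qed.

Lemma L2normE n (f : vfun R n) : L2 f -> L2norm f = (Num.sqrt (vN f))%:E.
Proof.
move=> hf; rewrite /L2norm Lnorm2E//.
have ri (s : seq 'I_n) : rint (fun t => \sum_(i <- s) normc (f t i 0) ^+ 2) /\
    \int[mu]_t (\sum_(i <- s) normc (f t i 0) ^+ 2) =
    \sum_(i <- s) Nsq (fun t => f t i 0).
  elim: s => [|i s [ih ihE]].
    under [X in rint X]eq_fun do rewrite big_nil.
    under eq_Rintegral do rewrite big_nil.
    rewrite big_nil Rintegral_arc_cst; split=> //.
    exact: (arc_integrable (bmeas_cst 0)).
  under [X in rint X]eq_fun do rewrite big_cons normc_sqr.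
  under eq_Rintegral do rewrite big_cons normc_sqr.
  have hi := L2_rint (hf i).
  split; first exact: rintD.
  by rewrite big_cons RintegralD// ihE.
have [r1 r2] := ri (enum 'I_n).
have E : (\int[mu]_t (\sum_i normc (f t i 0) ^+ 2)%:E)%E = (vN f)%:E.
  rewrite /vN -big_enum -r2 /Rintegral fineK; last exact: integrable_fin_num r1.
  by apply: eq_integral => t _; rewrite big_enum.
have -> : (\int[mu]_t (Num.sqrt (\sum_i normc (f t i 0) ^+ 2) ^+ 2)%:E)%E = (vN f)%:E.
  rewrite -E; apply: eq_integral => t _; rewrite sqr_sqrtr//.
  by apply: sumr_ge0 => i _; exact: sqr_ge0.
by rewrite poweR_EFin powR12_sqrt// vN_ge0.
Qed.

(* [vN] is a squared norm, hence [M] bounds the square of the operator norm. *)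
Definition bop m n (S : vfun R m -> vfun R n) :=
  [/\ forall f, L2 f -> L2 (S f),
      forall (a : C) f g, L2 f -> L2 g ->
        aeq (S (fun t => a *: f t + g t)) (fun t => a *: S f t + S g t) &
      exists2 M : R, 0 <= M & forall f, L2 f -> vN (S f) <= M * vN f].

Lemma bopP m n (S : vfun R m -> vfun R n) : bounded_operator S <-> bop S.
Proof.
split=> [[h1 h2 [M hM]]|[h1 h2 [M M0 hM]]]; split=> //.
  exists (M ^+ 2) => [|f hf]; first exact: sqr_ge0.
  have := hM f hf; rewrite !L2normE//; last exact: h1.
  rewrite -EFinM lee_fin => h.
  have := lerXn2r 2 _ _ h; rewrite !nnegrE sqrtr_ge0 => /(_ isT).
  rewrite exprMn !sqr_sqrtr ?vN_ge0//; apply.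
  exact: le_trans (sqrtr_ge0 _) h.
exists (Num.sqrt M) => f hf; rewrite !L2normE//; last exact: h1.
by rewrite -EFinM lee_fin -sqrtrM// ler_wsqrtr// hM.
Qed.

Lemma L2_cmeas n (f : vfun R n) i : L2 f -> cmeasurable (fun t => f t i 0).
Proof. by move=> /(_ i)/L2_cmeasurable. Qed.

Lemma aeq_refl n (f : vfun R n) : aeq f f.
Proof. exact: aeW. Qed.

Lemma aeq_sym n (f g : vfun R n) : aeq f g -> aeq g f.
Proof. by apply: filterS => t ->. Qed.

Lemma aeq_trans n (f g h : vfun R n) : aeq f g -> aeq g h -> aeq f h.
Proof. by apply: filterS2 => t -> ->. Qed.

Lemma aeq_coord n (f g : vfun R n) :
  (forall i, {ae mu, forall t, f t i 0 = g t i 0}) -> aeq f g.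
Proof.
move=> h; have : {ae mu, forall t, forall i, i \in enum 'I_n -> f t i 0 = g t i 0}.
  elim: (enum 'I_n) => [|j s ih]; first by apply: aeW => t i; rewrite in_nil.
  move: (h j) ih; apply: filterS2 => t hj hs i; rewrite inE => /predU1P[->//|]; exact: hs.
by apply: filterS => t ht; apply/colP => i; apply: ht; rewrite mem_enum.
Qed.

(** This reduces the operator identities below to computations with Fourier coefficients. *)
Lemma aeq_vf n (f g : vfun R n) : L2 f -> L2 g ->
  aeq f g <-> forall k, vf f k = vf g k.
Proof.
move=> hf hg; split=> [fg k|fg].
  apply/colP => i; rewrite !mxE; apply: fourier_ae; try exact: L2_cmeas.
  by apply: filterS fg => t ->.
apply: aeq_coord => i; apply: fourier_inj => // k.
by have /colP/(_ i) := fg k; rewrite !mxE.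
Qed.

Lemma L2v0 n : L2 (fun _ => 0 : 'cV[C]_n).
Proof.
by move=> i; have := @L2_0 R; congr (Lp _ _); apply/funext => t; rewrite mxE.
Qed.

Lemma L2vD n (f g : vfun R n) : L2 f -> L2 g -> L2 (fun t => f t + g t).
Proof.
move=> hf hg i; have := L2D (hf i) (hg i); congr (Lp _ _).
by apply/funext => t; rewrite mxE.
Qed.

Lemma L2vZ n (a : C) (f : vfun R n) : L2 f -> L2 (fun t => a *: f t).
Proof.
move=> hf i; have := L2Z a (hf i); congr (Lp _ _).
by apply/funext => t; rewrite mxE.
Qed.

Lemma L2vN n (f : vfun R n) : L2 f -> L2 (fun t => - f t).
Proof.
by move=> /(L2vZ (-1)); congr L2; apply/funext => t; rewrite scaleN1r.
Qed.

Lemma L2vB n (f g : vfun R n) : L2 f -> L2 g -> L2 (fun t => f t - g t).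
Proof. by move=> hf hg; apply: L2vD => //; exact: L2vN. Qed.

Lemma vf0 n k : vf (fun _ => 0 : 'cV[C]_n) k = 0.
Proof.
apply/colP => i; rewrite !mxE -[RHS](@fourier0 R k); by congr fourier; apply/funext => t; rewrite mxE.
Qed.

Lemma vfD n (f g : vfun R n) k : L2 f -> L2 g ->
  vf (fun t => f t + g t) k = vf f k + vf g k.
Proof.
move=> hf hg; apply/colP => i; rewrite !mxE -fourierD//; congr fourier.
by apply/funext => t; rewrite mxE.
Qed.

Lemma vfZ n (a : C) (f : vfun R n) k : L2 f -> vf (fun t => a *: f t) k = a *: vf f k.
Proof.
move=> hf; apply/colP => i; rewrite !mxE -fourierZ//; congr fourier.
by apply/funext => t; rewrite mxE.
Qed.

Lemma vfN n (f : vfun R n) k : L2 f -> vf (fun t => - f t) k = - vf f k.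
Proof.
move=> hf; rewrite -scaleN1r -vfZ//; congr vf.
by apply/funext => t; rewrite scaleN1r.
Qed.

Lemma vfB n (f g : vfun R n) k : L2 f -> L2 g ->
  vf (fun t => f t - g t) k = vf f k - vf g k.
Proof. by move=> hf hg; rewrite vfD ?vfN//; exact: L2vN. Qed.

Lemma L2_opP n (f : vfun R n) : L2 f -> L2 (opP f).
Proof.
move=> hf i; have [h _ _] := riesz_spec (hf i); move: h; congr (Lp _ _).
by apply/funext => t; rewrite mxE.
Qed.

Lemma vf_opP n (f : vfun R n) k : L2 f ->
  vf (opP f) k = if 0 <= k then vf f k else 0.
Proof.
move=> hf; apply/colP => i; have [_ h _] := riesz_spec (hf i).
rewrite !mxE; transitivity (fourier (riesz (fun s => f s i 0)) k).
  by congr fourier; apply/funext => t; rewrite mxE.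
by rewrite h; case: ifP; rewrite mxE.
Qed.

Lemma opJE n (f : vfun R n) i :
  (fun t => opJ f t i 0) = (fun t : circle R => (t : C) ^ (-1) * f (cinv t) i 0).
Proof. by apply/funext => t; rewrite /opJ mxE exprN1. Qed.

Lemma L2_opJ n (f : vfun R n) : L2 f -> L2 (opJ f).
Proof. by move=> hf i; rewrite opJE; apply: L2_exprzM; exact: L2_cinv (hf i). Qed.

Lemma vf_opJ n (f : vfun R n) k : L2 f -> vf (opJ f) k = vf f (- 1 - k).
Proof.
move=> hf; apply/colP => i; rewrite !mxE opJE fourier_exprzM.
rewrite (@fourier_cinv _ (fun t => f t i 0)); last exact: L2_cmeas.
by congr fourier; lia.
Qed.

Lemma opJK n (f : vfun R n) : opJ (opJ f) = f.
Proof.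
apply/funext => t; rewrite /opJ scalerA cinvK /= invrK mulVf ?scale1r//.
exact: cval_neq0.
Qed.

Definition cmx m n (A : circle R -> 'M[C]_(m, n)) :=
  forall i j, ccontinuous (fun t => A t i j).

Lemma ccontinuous_cst (c : C) : ccontinuous (fun _ : circle R => c).
Proof. by apply/ccontinuousP; split; exact: cst_continuous. Qed.

Lemma cmx_cst m n (A : 'M[C]_(m, n)) : cmx (fun=> A).
Proof. by move=> i j; exact: ccontinuous_cst. Qed.

Lemma opM_coordE m n (A : circle R -> 'M[C]_(m, n)) (f : vfun R n) i :
  (fun t => opM A f t i 0) = (fun t => \sum_(j <- enum 'I_n) A t i j * f t j 0).
Proof. by apply/funext => t; rewrite /opM mxE big_enum. Qed.

Lemma L2_cmul (b f : circle R -> C) : ccontinuous b -> Lp 2%:E f ->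
  Lp 2%:E (fun t => b t * f t).
Proof.
move=> cb; have [M bM] := ccontinuous_bounded cb.
exact: (L2_bounded_mul (ccontinuous_measurable cb) bM).
Qed.

Lemma L2_opM m n (A : circle R -> 'M[C]_(m, n)) (f : vfun R n) : cmx A -> L2 f ->
  L2 (opM A f).
Proof.
move=> cA hf i; rewrite opM_coordE.
by apply: (@L2_sum _ _ _ (fun j t => A t i j * f t j 0)) => j; exact: L2_cmul.
Qed.

Lemma vf_mulmx m n (A : 'M[C]_(m, n)) (f : vfun R n) k : L2 f ->
  vf (opM (fun=> A) f) k = A *m vf f k.
Proof.
move=> hf; apply/colP => i; rewrite !mxE opM_coordE -big_enum.
elim: (enum 'I_n) => [|j s ih].
  rewrite big_nil -[RHS](@fourier0 R k); congr fourier.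
  by apply/funext => t; rewrite big_nil.
rewrite big_cons -ih /= [vf f k j 0]mxE -fourierZ// -fourierD.
- by congr fourier; apply/funext => t; rewrite big_cons.
- exact: L2Z.
- by apply: (@L2_sum _ _ _ (fun j t => A i j * f t j 0)) => l; exact: L2Z.
Qed.

Lemma bop_opM m n (A : circle R -> 'M[C]_(m, n)) : cmx A -> bop (opM A).
Proof.
move=> cA; split=> [f hf|a f g hf hg|]; first exact: L2_opM.
  by apply: aeW => t; rewrite /opM mulmxDr scalemxAr.
(* The bound doubles with each summand, through [NsqD_le]; only its existence matters. *)
have row i (s : seq 'I_n) : exists2 M : R, 0 <= M & forall f : vfun R n, L2 f ->
    Nsq (fun t => \sum_(j <- s) A t i j * f t j 0) <= M * vN f.
  elim: s => [|j s [M M0 hM]].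
    exists 0 => // f hf; rewrite mul0r /Nsq -[leRHS](@Rintegral_arc_cst R 0).
    rewrite le_eqVlt; apply/orP; left; apply/eqP; apply: eq_Rintegral => t _.
    by rewrite big_nil /sqn /= expr0n addr0.
  have [K hK] := ccontinuous_bounded (cA i j).
  have K0 : 0 <= K by rewrite (le_trans (sqn_ge0 _) (hK (expi 0))).
  exists (2 * K + 2 * M) => [|f hf]; first by rewrite addr_ge0// mulr_ge0.
  have h1 : Lp 2%:E (fun t => A t i j * f t j 0) by exact: L2_cmul.
  have h2 : Lp 2%:E (fun t => \sum_(j <- s) A t i j * f t j 0).
    by apply: (@L2_sum _ _ _ (fun j t => A t i j * f t j 0)) => l; exact: L2_cmul.
  have -> : (fun t => \sum_(l <- j :: s) A t i l * f t l 0) =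
      (fun t => A t i j * f t j 0 + \sum_(l <- s) A t i l * f t l 0).
    by apply/funext => t; rewrite big_cons.
  rewrite (le_trans (NsqD_le h1 h2))// [leRHS]mulrDl -[leRHS]/(_ * _ + _ * _) lerD// -mulrA ler_wpM2l//; last exact: hM.
  rewrite (le_trans (Nsq_bounded_mul (ccontinuous_measurable (cA i j)) hK (hf j)))//.
  rewrite ler_wpM2l// /vN (bigD1 j)//= lerDl sumr_ge0// => l _; exact: Nsq_ge0.
have : forall i, exists M : R, 0 <= M /\ forall f : vfun R n, L2 f ->
    Nsq (fun t => opM A f t i 0) <= M * vN f.
  by move=> i; have [M M0 hM] := row i (enum 'I_n); exists M; split=> // f hf;
     rewrite opM_coordE; exact: hM.
move=> /choice[M hM]; exists (\sum_i M i) => [|f hf].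
  by apply: sumr_ge0 => i _; case: (hM i).
by rewrite mulr_suml; apply: ler_sum => i _; case: (hM i) => _; exact.
Qed.

Lemma bop_opP n : bop (@opP R n).
Proof.
split=> [f hf|a f g hf hg|]; first exact: L2_opP.
  (* [xget] chooses the representatives of the projections independently of each other, so linearity
     is checked on coefficients and holds almost everywhere. *)
  have hs := L2vD (L2vZ a hf) hg.
  apply/aeq_vf; [exact: L2_opP|by apply: L2vD; [apply: L2vZ|]; exact: L2_opP|].
  move=> k; rewrite vf_opP// !vfD ?vfZ ?vf_opP//; try exact: L2_opP; try exact: L2vZ.
    by case: ifP => // _; rewrite scaler0 addr0.
  by apply: L2vZ; exact: L2_opP.
exists 1 => // f hf; rewrite mul1r; apply: ler_sum => i _.
have [_ _ h] := riesz_spec (hf i); apply: le_trans h.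
by rewrite le_eqVlt; apply/orP; left; apply/eqP; congr Nsq; apply/funext => t; rewrite mxE.
Qed.

Lemma bop_opJ n : bop (@opJ R n).
Proof.
split=> [f hf|a f g hf hg|]; first exact: L2_opJ.
  by apply: aeW => t; rewrite /opJ scalerDr !scalerA mulrC.
exists 1 => // f hf; rewrite mul1r; apply: ler_sum => i _.
rewrite opJE -(Nsq_cinv (L2_cmeas i hf)).
rewrite (le_trans (Nsq_bounded_mul (M := 1) _ _ (L2_cinv (hf i))))// ?mul1r//.
  exact: cmeasurable_exprz.
by move=> t; rewrite sqn_exprz.
Qed.

Lemma vN_eq0 n (f : vfun R n) : aeq f (fun=> 0) -> L2 f -> vN f = 0.
Proof.
move=> f0 hf; rewrite /vN big1// => i _.
rewrite (@Nsq_ae _ _ (fun=> 0)); last 3 first.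
- exact: L2_cmeas.
- exact: cmeasurable_cst.
- by apply: filterS f0 => t ->; rewrite mxE.
rewrite /Nsq -[RHS](@Rintegral_arc_cst R 0); apply: eq_Rintegral => t _.
by rewrite /sqn /= expr0n addr0.
Qed.

Lemma eq0_vN n (f : vfun R n) : L2 f -> vN f = 0 -> aeq f (fun=> 0).
Proof.
move=> hf /eqP; rewrite psumr_eq0; last by move=> i _; exact: Nsq_ge0.
move=> /allP h; apply: aeq_coord => i.
have N0 : Nsq (fun t => f t i 0) = 0 by apply/eqP/h; rewrite mem_index_enum.
have := @fourier_eq0_ae _ _ (hf i) => /(_ _)/filterS; apply.
  by move=> t; rewrite mxE.
move=> k; apply: sqn_eq0; apply/eqP; rewrite eq_le sqn_ge0 andbT -N0.
exact: sqn_fourier_le.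
Qed.

(** The difference of [f] and [g] has norm 0, and boundedness sends it to a function of norm 0. *)
Lemma bop_aeq m n (S : vfun R m -> vfun R n) f g : bop S -> L2 f -> L2 g ->
  aeq f g -> aeq (S f) (S g).
Proof.
move=> [h1 h2 [M M0 hM]] hf hg fg.
have hd : L2 (fun t => (-1) *: f t + g t) by apply: L2vD => //; exact: L2vZ.
have d0 : aeq (fun t => (-1) *: f t + g t) (fun=> 0).
  by apply: filterS fg => t ->; rewrite scaleN1r addNr.
have : aeq (S (fun t => (-1) *: f t + g t)) (fun=> 0).
  apply: eq0_vN; first exact: h1.
  apply/eqP; rewrite eq_le vN_ge0 andbT (le_trans (hM _ hd))//.
  by rewrite (vN_eq0 d0 hd) mulr0.
have := h2 (-1) f g hf hg; apply: filterS2 => t -> /eqP.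
by rewrite scaleN1r addrC subr_eq0 => /eqP.
Qed.

Lemma bop0 m n (S : vfun R m -> vfun R n) : bop S -> aeq (S (fun=> 0)) (fun=> 0).
Proof.
move=> [h1 h2 [M M0 hM]]; have h0 := @L2v0 m; apply: eq0_vN; first exact: h1.
apply/eqP; rewrite eq_le vN_ge0 andbT (le_trans (hM _ h0))//.
by rewrite (vN_eq0 (aeq_refl _) h0) mulr0.
Qed.

Lemma bop_comp m n p (S : vfun R m -> vfun R n) (T : vfun R n -> vfun R p) :
  bop S -> bop T -> bop (fun f => T (S f)).
Proof.
move=> bS bT; have [s1 s2 [M M0 sM]] := bS; have [t1 t2 [K K0 tK]] := bT.
split=> [f hf|a f g hf hg|]; first exact/t1/s1.
  have h1 := s1 _ hf; have h2 := s1 _ hg.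
  apply: aeq_trans (t2 a _ _ h1 h2); apply: (bop_aeq bT); last exact: s2.
    by apply: s1; apply: L2vD => //; exact: L2vZ.
  by apply: L2vD => //; exact: L2vZ.
exists (K * M) => [|f hf]; first exact: mulr_ge0.
by rewrite (le_trans (tK _ (s1 _ hf)))// -mulrA ler_wpM2l// sM.
Qed.

Lemma vND_le n (f g : vfun R n) : L2 f -> L2 g ->
  vN (fun t => f t + g t) <= 2 * vN f + 2 * vN g.
Proof.
move=> hf hg; rewrite /vN !mulr_sumr -big_split /=; apply: ler_sum => i _.
have := NsqD_le (hf i) (hg i); congr (_ <= _); congr Nsq.
by apply/funext => t; rewrite mxE.
Qed.

Lemma bopD m n (S T : vfun R m -> vfun R n) : bop S -> bop T ->
  bop (fun f t => S f t + T f t).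
Proof.
move=> [s1 s2 [M M0 sM]] [t1 t2 [K K0 tK]].
split=> [f hf|a f g hf hg|]; first by apply: L2vD; [exact: s1|exact: t1].
  have := t2 a f g hf hg; have := s2 a f g hf hg; apply: filterS2 => t -> ->.
  by rewrite scalerDr addrACA.
exists (2 * M + 2 * K) => [|f hf]; first by rewrite addr_ge0// mulr_ge0.
rewrite (le_trans (vND_le (s1 _ hf) (t1 _ hf)))// [leRHS]mulrDl.
by rewrite lerD// -mulrA ler_wpM2l// ?sM ?tK.
Qed.

Lemma bop_id n : bop (fun f : vfun R n => f).
Proof. by split=> // [a f g _ _|]; [exact: aeq_refl|exists 1 => // f _; rewrite mul1r]. Qed.

Lemma bopN m n (S : vfun R m -> vfun R n) : bop S -> bop (fun f t => - S f t).
Proof.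
move=> bS; have := bop_comp bS (bop_opM (@cmx_cst n n (-1)%:M)); congr bop.
by apply/funext => f; apply/funext => t; rewrite /opM mul_scalar_mx scaleN1r.
Qed.

Lemma bopB m n (S T : vfun R m -> vfun R n) : bop S -> bop T ->
  bop (fun f t => S f t - T f t).
Proof. by move=> bS bT; apply: bopD => //; exact: bopN. Qed.

Lemma bop_L2 m n (S : vfun R m -> vfun R n) f : bop S -> L2 f -> L2 (S f).
Proof. by case=> h _ _; exact: h. Qed.

Lemma bop_sub m n (S : vfun R m -> vfun R n) f g : bop S -> L2 f -> L2 g ->
  aeq (S (fun t => f t - g t)) (fun t => S f t - S g t).
Proof.
move=> bS hf hg; have [_ h2 _] := bS.
have -> : (fun t => f t - g t) = (fun t => (-1) *: g t + f t).
  by apply/funext => t; rewrite scaleN1r addrC.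
by apply: aeq_trans (h2 (-1) g f hg hf) _; apply: aeW => t; rewrite scaleN1r addrC.
Qed.

Lemma aeqB m (f f' g g' : vfun R m) : aeq f f' -> aeq g g' ->
  aeq (fun t => f t - g t) (fun t => f' t - g' t).
Proof. by apply: filterS2 => t -> ->. Qed.

Lemma aeq_opM m n (A : circle R -> 'M[C]_(m, n)) f g : aeq f g -> aeq (opM A f) (opM A g).
Proof. by apply: filterS => t; rewrite /opM => ->. Qed.

Lemma opM_comp m n p (A : circle R -> 'M[C]_(m, n)) (A' : circle R -> 'M[C]_(n, p)) f :
  opM A (opM A' f) = opM (fun t => A t *m A' t) f.
Proof. by apply/funext => t; rewrite /opM mulmxA. Qed.

Lemma opJ_opM m n (A : circle R -> 'M[C]_(m, n)) f :
  opJ (opM A f) = opM (fun t => A (cinv t)) (opJ f).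
Proof. by apply/funext => t; rewrite /opJ /opM scalemxAr. Qed.

Lemma opJB n (f g : vfun R n) : opJ (fun t => f t - g t) = (fun t => opJ f t - opJ g t).
Proof. by apply/funext => t; rewrite /opJ scalerBr. Qed.

Definition pairv n (f g : vfun R n) : vfun R (n + n) := fun t => col_mx (f t) (g t).
Definition ufst n (h : vfun R (n + n)) : vfun R n := fun t => usubmx (h t).
Definition usnd n (h : vfun R (n + n)) : vfun R n := fun t => dsubmx (h t).

(** As multiplication by a constant matrix, the block inherits boundedness and coefficients from
    [bop_opM] and [vf_mulmx]. *)
Lemma ufstE n (h : vfun R (n + n)) : ufst h = opM (fun=> row_mx 1%:M 0) h.
Proof.
apply/funext => t; rewrite /opM -[h t]vsubmxK mul_row_col mul1mx mul0mx addr0.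
by [].
Qed.

Lemma usndE n (h : vfun R (n + n)) : usnd h = opM (fun=> row_mx 0 1%:M) h.
Proof.
apply/funext => t; rewrite /opM -[h t]vsubmxK mul_row_col mul1mx mul0mx add0r.
by [].
Qed.

Lemma pairvE n (f g : vfun R n) : pairv f g =
  (fun t => opM (fun=> col_mx 1%:M 0) f t + opM (fun=> col_mx 0 1%:M) g t).
Proof.
apply/funext => t; rewrite /pairv /opM !mul_col_mx !mul1mx !mul0mx add_col_mx.
by rewrite addr0 add0r.
Qed.

Lemma ufst_pairv n (f g : vfun R n) : ufst (pairv f g) = f.
Proof. by apply/funext => t; rewrite /ufst col_mxKu. Qed.

Lemma usnd_pairv n (f g : vfun R n) : usnd (pairv f g) = g.
Proof. by apply/funext => t; rewrite /usnd col_mxKd. Qed.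

Lemma pairv_eta n (h : vfun R (n + n)) : pairv (ufst h) (usnd h) = h.
Proof. by apply/funext => t; rewrite /pairv vsubmxK. Qed.

Lemma bop_ufst n : bop (@ufst n).
Proof.
have := bop_opM (@cmx_cst n (n + n) (row_mx 1%:M 0)); congr bop.
by apply/funext => h; rewrite ufstE.
Qed.

Lemma bop_usnd n : bop (@usnd n).
Proof.
have := bop_opM (@cmx_cst n (n + n) (row_mx 0 1%:M)); congr bop.
by apply/funext => h; rewrite usndE.
Qed.

Lemma bop_pairv m n (S T : vfun R m -> vfun R n) : bop S -> bop T ->
  bop (fun f => pairv (S f) (T f)).
Proof.
move=> bS bT; have := bopD
  (bop_comp bS (bop_opM (@cmx_cst (n + n) n (col_mx 1%:M 0))))
  (bop_comp bT (bop_opM (@cmx_cst (n + n) n (col_mx 0 1%:M)))).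
by congr bop; apply/funext => f; rewrite pairvE.
Qed.

Lemma L2_pairv n (f g : vfun R n) : L2 f -> L2 g -> L2 (pairv f g).
Proof.
move=> hf hg; rewrite pairvE; apply: L2vD; apply: L2_opM => //; exact: cmx_cst.
Qed.

Lemma L2_ufst n (h : vfun R (n + n)) : L2 h -> L2 (ufst h).
Proof. exact: bop_L2 (@bop_ufst n). Qed.

Lemma L2_usnd n (h : vfun R (n + n)) : L2 h -> L2 (usnd h).
Proof. exact: bop_L2 (@bop_usnd n). Qed.

Lemma vf_ufst n (h : vfun R (n + n)) k : L2 h -> vf (ufst h) k = usubmx (vf h k).
Proof.
move=> hh; rewrite ufstE vf_mulmx// -[vf h k]vsubmxK mul_row_col mul1mx mul0mx addr0.
by rewrite vsubmxK.
Qed.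

Lemma vf_usnd n (h : vfun R (n + n)) k : L2 h -> vf (usnd h) k = dsubmx (vf h k).
Proof.
move=> hh; rewrite usndE vf_mulmx// -[vf h k]vsubmxK mul_row_col mul1mx mul0mx add0r.
by rewrite vsubmxK.
Qed.

Lemma vf_pairv n (f g : vfun R n) k : L2 f -> L2 g ->
  vf (pairv f g) k = col_mx (vf f k) (vf g k).
Proof.
move=> hf hg; rewrite -[LHS]vsubmxK -vf_ufst ?ufst_pairv; last exact: L2_pairv.
by rewrite -vf_usnd ?usnd_pairv//; exact: L2_pairv.
Qed.

Lemma aeq_pairv n (f f' g g' : vfun R n) : aeq f f' -> aeq g g' ->
  aeq (pairv f g) (pairv f' g').
Proof. by apply: filterS2 => t; rewrite /pairv => -> ->. Qed.

Lemma aeq_ufst n (f g : vfun R (n + n)) : aeq f g -> aeq (ufst f) (ufst g).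
Proof. by apply: filterS => t; rewrite /ufst => ->. Qed.

Lemma aeq_usnd n (f g : vfun R (n + n)) : aeq f g -> aeq (usnd f) (usnd g).
Proof. by apply: filterS => t; rewrite /usnd => ->. Qed.

Lemma aeq_opJ n (f g : vfun R n) : L2 f -> L2 g -> aeq f g -> aeq (opJ f) (opJ g).
Proof. exact: (bop_aeq (@bop_opJ n)). Qed.

Lemma aeq_opP n (f g : vfun R n) : L2 f -> L2 g -> aeq f g -> aeq (opP f) (opP g).
Proof. exact: (bop_aeq (@bop_opP n)). Qed.

Lemma aeq_opP_vf n (f g : vfun R n) : L2 f -> L2 g ->
  aeq (opP f) (opP g) <-> forall k, 0 <= k -> vf f k = vf g k.
Proof.
move=> hf hg; rewrite aeq_vf; [|exact: L2_opP..]; split=> h k.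
  by move=> k0; have := h k; rewrite !vf_opP// k0.
by rewrite !vf_opP//; case: ifP => // /h.
Qed.

(** These are the rows (P, JP) and (I, J) and the columns (I; J) and (P; PJ), called R, T, L and H
    below. H stores the coefficients of index k >= 0 in its first block and those of index -1 - k in
    its second, so it identifies L^2 on N components with the range of P on 2N components. Both R
    and T undo H; R ignores the part of its argument outside the range of P, while T does not. *)
Definition opR N (h : vfun R (N + N)) : vfun R N :=
  fun t => opP (ufst h) t + opJ (opP (usnd h)) t.
Definition opL N (f : vfun R N) : vfun R (N + N) := pairv f (opJ f).
Definition opH N (f : vfun R N) : vfun R (N + N) := pairv (opP f) (opP (opJ f)).
Definition opT N (h : vfun R (N + N)) : vfun R N := fun t => ufst h t + opJ (usnd h) t.

Lemma PhiE N (A : circle R -> 'M[C]_(N + N)) f : Phi A f = opR (opM A (opL f)).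
Proof. by []. Qed.

Lemma PsiE N (A : circle R -> 'M[C]_(N + N)) f : Psi A f = opT (opM A (opH f)).
Proof. by []. Qed.

Lemma bop_opR N : bop (@opR N).
Proof.
apply: bopD; first exact: bop_comp (@bop_ufst N) (@bop_opP N).
exact: bop_comp (bop_comp (@bop_usnd N) (@bop_opP N)) (@bop_opJ N).
Qed.

Lemma bop_opL N : bop (@opL N).
Proof. by apply: bop_pairv; [exact: bop_id|exact: bop_opJ]. Qed.

Lemma bop_opH N : bop (@opH N).
Proof. by apply: bop_pairv; [exact: bop_opP|exact: bop_comp (@bop_opJ N) (@bop_opP N)]. Qed.

Lemma bop_opT N : bop (@opT N).
Proof. by apply: bopD; [exact: bop_ufst|exact: bop_comp (@bop_usnd N) (@bop_opJ N)]. Qed.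

Lemma vf_opR N (h : vfun R (N + N)) k : L2 h ->
  vf (opR h) k = if 0 <= k then usubmx (vf h k) else dsubmx (vf h (- 1 - k)).
Proof.
move=> hh; have h1 := L2_ufst hh; have h2 := L2_usnd hh.
rewrite /opR vfD; [|exact: L2_opP|by apply/L2_opJ/L2_opP].
rewrite vf_opJ; last exact: L2_opP.
rewrite !vf_opP// vf_ufst// vf_usnd//; case: ifPn => k0.
  by rewrite ifF ?addr0//; lia.
by rewrite ifT ?add0r//; lia.
Qed.

Lemma vf_opH N (f : vfun R N) k : L2 f ->
  vf (opH f) k = if 0 <= k then col_mx (vf f k) (vf f (- 1 - k)) else 0.
Proof.
move=> hf; have hj := L2_opJ hf.
rewrite vf_pairv; [|exact: L2_opP..].
by rewrite !vf_opP// vf_opJ//; case: ifP => // _; rewrite col_mx0.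
Qed.

Lemma vf_opT N (h : vfun R (N + N)) k : L2 h ->
  vf (opT h) k = usubmx (vf h k) + dsubmx (vf h (- 1 - k)).
Proof.
move=> hh; have h1 := L2_ufst hh; have h2 := L2_usnd hh.
by rewrite /opT vfD ?vf_opJ ?vf_ufst ?vf_usnd//; exact: L2_opJ.
Qed.

Lemma opR_eq N (h g : vfun R (N + N)) : L2 h -> L2 g ->
  aeq (opR h) (opR g) <-> aeq (opP h) (opP g).
Proof.
move=> hh hg; rewrite aeq_opP_vf// aeq_vf; last 2 first.
- exact: bop_L2 (@bop_opR N) hh.
- exact: bop_L2 (@bop_opR N) hg.
split=> H k; last first.
  rewrite [LHS](vf_opR k hh) [RHS](vf_opR k hg); case: ifPn => k0.
    congr usubmx; exact: H.
  congr dsubmx; apply: H; lia.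
move=> k0; have := H k; have := H (- 1 - k).
rewrite [in RHS](vf_opR _ hg) [in LHS](vf_opR _ hh) ifF; last lia.
rewrite ifF; last lia.
rewrite (_ : - 1 - (- 1 - k) = k); last lia.
move=> hd; rewrite [in RHS](vf_opR _ hg) [in LHS](vf_opR _ hh) k0 => hu.
by rewrite -[vf h k]vsubmxK -[vf g k]vsubmxK hd hu.
Qed.

Lemma opR_opH N (f : vfun R N) : L2 f -> aeq (opR (opH f)) f.
Proof.
move=> hf; have hH := bop_L2 (@bop_opH N) hf.
apply/aeq_vf => //; first exact: bop_L2 (@bop_opR N) hH.
move=> k; rewrite vf_opR// !vf_opH//; case: ifPn => k0; first by rewrite ?k0 col_mxKu.
rewrite ifT ?col_mxKd; last lia.
by congr vf; lia.
Qed.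

Lemma opT_opH N (f : vfun R N) : L2 f -> aeq (opT (opH f)) f.
Proof.
move=> hf; have hH := bop_L2 (@bop_opH N) hf.
apply/aeq_vf => //; first exact: bop_L2 (@bop_opT N) hH.
move=> k; rewrite vf_opT// !vf_opH//; case: ifPn => k0.
  by rewrite col_mxKu ifF ?linear0 ?addr0//; lia.
rewrite linear0 add0r ifT ?col_mxKd; last lia.
by congr vf; lia.
Qed.

(** J exchanges the ranges of P and I - P, as k -> -1 - k exchanges nonnegative and negative
    indices. This is why the splitting for Psi(A) is read off after a reflection. *)
Lemma opP_opJ_opH N (f : vfun R N) : L2 f -> aeq (opP (opJ (opH f))) (fun=> 0).
Proof.
move=> hf; have hH := bop_L2 (@bop_opH N) hf; have hJ := L2_opJ hH.
apply/aeq_vf; [exact: L2_opP|exact: L2v0|].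
move=> k; rewrite vf_opP// vf_opJ// vf_opH// vf0; case: ifP => // k0.
by rewrite ifF//; lia.
Qed.

Lemma opH_opT N (h : vfun R (N + N)) : L2 h -> aeq (opP h) h -> aeq (opH (opT h)) h.
Proof.
move=> hh Ph; have hT := bop_L2 (@bop_opT N) hh.
have neg k : k < 0 -> vf h k = 0.
  move=> k0; have /aeq_vf <- := Ph => //; last exact: L2_opP.
  by rewrite vf_opP// ifF//; lia.
apply/aeq_vf => //; first exact: bop_L2 (@bop_opH N) hT.
move=> k; rewrite vf_opH// !vf_opT//; case: ifPn => k0; last by rewrite neg//; lia.
rewrite (neg (- 1 - k)); last lia.
rewrite !linear0 addr0 add0r (_ : - 1 - (- 1 - k) = k) ?vsubmxK//; lia.
Qed.

End VectorL2.

(** * Invertibility as a splitting of L^2 *)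

Section Split.
Variable R : realType.
Local Notation C := R[i].

(** Membership of [h] in the space Y_F. *)
Definition flip_fixed n (F : circle R -> 'M[C]_n) (h : vfun R n) := aeq (opM F (opJ h)) h.

Definition split_inj n (F : circle R -> 'M[C]_n) := forall h, L2 h ->
  flip_fixed F h -> aeq (opP h) (fun=> 0) -> aeq h (fun=> 0).

Definition split_surj n (F : circle R -> 'M[C]_n) := forall g, L2 g ->
  exists h, [/\ L2 h, flip_fixed F h & aeq (opP h) (opP g)].

(* [split_inj F] and [split_surj F] say that L^2 is the direct sum of the solutions of
   [F J h = h] and of the range of [I - P]. A bounded section yields a bounded inverse
   without the open mapping theorem. *)
Definition split_section n (F : circle R -> 'M[C]_n) (E : vfun R n -> vfun R n) :=
  bop E /\ forall g, L2 g -> flip_fixed F (E g) /\ aeq (opP (E g)) (opP g).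

Lemma flip_fixedB n (F : circle R -> 'M[C]_n) h h' :
  flip_fixed F h -> flip_fixed F h' -> flip_fixed F (fun t => h t - h' t).
Proof.
move=> Y Y'; apply: aeq_trans (aeqB Y Y'); apply: aeW => t.
by rewrite opJB /opM mulmxBr.
Qed.

(** The difference of two solutions with the same projection lies in both summands. *)
Lemma split_section_unique n (F : circle R -> 'M[C]_n) E h g :
  split_inj F -> split_section F E -> L2 h -> L2 g -> flip_fixed F h ->
  aeq (opP h) (opP g) -> aeq (E g) h.
Proof.
move=> inj [bE EP] hh hg Yh Phg; have [YE PE] := EP g hg.
have hE := bop_L2 bE hg.
have := inj _ (L2vB hE hh) (flip_fixedB YE Yh); set d := fun t => _; move=> H.
have : aeq d (fun=> 0).
  apply: H; apply: aeq_trans (bop_sub (@bop_opP R n) hE hh) _.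
  apply: aeq_trans (aeqB (aeq_trans PE (aeq_sym Phg)) (aeq_refl _)) _.
  by apply: aeW => t; rewrite subrr.
by apply: filterS => t /eqP; rewrite subr_eq0 => /eqP.
Qed.

Lemma opJ_pairv n (f g : vfun R n) : opJ (pairv f g) = pairv (opJ f) (opJ g).
Proof. by apply/funext => t; rewrite /opJ /pairv scale_col_mx. Qed.

Lemma opM_W_pairv n (f g : vfun R n) : opM (fun=> Wmx n) (pairv f g) = pairv g f.
Proof.
apply/funext => t; rewrite /opM /pairv /Wmx mul_block_col.
by rewrite !mul0mx !mul1mx add0r addr0.
Qed.

Lemma Wmx_sqr n : Wmx n *m Wmx n = 1%:M :> 'M[C]_(n + n).
Proof.
rewrite /Wmx mulmx_block !mul0mx !mulmx0 !mul1mx !addr0 !add0r.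
by rewrite -scalar_mx_block.
Qed.

Variables (N : nat) (A A' : circle R -> 'M[C]_(N + N)).
Hypotheses (cA : cmx A) (cA' : cmx A').
Hypotheses (AA' : forall t, A t *m A' t = 1%:M) (A'A : forall t, A' t *m A t = 1%:M).

Let F t := A t *m Wmx N *m A' (cinv t).
Let G t := A' (cinv t) *m Wmx N *m A t.
Let G' t := - G t.

Lemma opM_id n (h : vfun R n) : opM (fun=> 1%:M) h = h.
Proof. by apply/funext => t; rewrite /opM mul1mx. Qed.

Lemma opMAA' h : opM A (opM A' h) = h.
Proof. by rewrite opM_comp; under eq_fun do rewrite AA'; rewrite opM_id. Qed.

Lemma opMA'A h : opM A' (opM A h) = h.
Proof. by rewrite opM_comp; under eq_fun do rewrite A'A; rewrite opM_id. Qed.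

Lemma flip_fixed_opL f : flip_fixed F (opM A (opL f)).
Proof.
apply: aeW => t; congr (_ t).
rewrite opJ_opM opM_comp.
have -> : (fun t => F t *m A (cinv t)) = (fun t => A t *m Wmx N).
  by apply/funext => s; rewrite /F -mulmxA A'A mulmx1.
by rewrite -(opM_comp A (fun=> Wmx N)) /opL opJ_pairv opJK opM_W_pairv.
Qed.

Lemma opL_flip_fixed h : L2 h -> flip_fixed F h ->
  aeq (opM A' h) (opL (ufst (opM A' h))).
Proof.
move=> hh Yh; have hx : L2 (opM A' h) by exact: L2_opM.
have h1 := L2_ufst hx; have h2 := L2_usnd hx.
have : aeq (opM (fun=> Wmx N) (opJ (opM A' h))) (opM A' h).
  apply: aeq_trans (aeq_opM A' Yh); apply: aeW => t; congr (_ t).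
  rewrite opJ_opM !opM_comp; congr opM; apply/funext => s.
  by rewrite /F !mulmxA A'A mul1mx.
rewrite -{1}[opM A' h]pairv_eta opJ_pairv opM_W_pairv => /aeq_usnd.
rewrite usnd_pairv => e; rewrite -{1}[opM A' h]pairv_eta.
by apply: aeq_pairv; [exact: aeq_refl|exact: aeq_sym].
Qed.

Lemma bop_Phi : bop (Phi A).
Proof. exact: bop_comp (bop_comp (@bop_opL R N) (bop_opM cA)) (@bop_opR R N). Qed.

Lemma bop_Psi : bop (Psi A).
Proof. exact: bop_comp (bop_comp (@bop_opH R N) (bop_opM cA)) (@bop_opT R N). Qed.

(** A solution [h] is A L f with Phi(A) f = R h, so P h = 0 forces f = 0. For given [g] take f =
    Phi(A)^(-1) R g: then A L f and [g] have the same image under R, hence the same projection. *)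
Lemma invertible_Phi_split : invertible_operator (Phi A) -> split_inj F /\ split_surj F.
Proof.
move=> [_ [S /bopP bS SP]]; split=> [h hh Yh Ph|g hg].
  have hx : L2 (opM A' h) by exact: L2_opM.
  have hf := L2_ufst hx; set f := ufst (opM A' h) in hf.
  have xf := opL_flip_fixed hh Yh.
  have hL : L2 (opL f) by exact: bop_L2 (@bop_opL R N) hf.
  have hAx : aeq (opM A (opL f)) h.
    by rewrite -[h in aeq _ h]opMAA'; apply: aeq_opM; exact: aeq_sym.
  have Phif : aeq (Phi A f) (fun=> 0).
    rewrite PhiE; apply: aeq_trans (bop_aeq (@bop_opR R N) _ hh hAx) _.
      exact: L2_opM.
    apply: aeq_trans (bop0 (@bop_opR R N)).
    apply/opR_eq => //; first exact: L2v0.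
    by apply: aeq_trans Ph _; apply: aeq_sym; exact: (bop0 (@bop_opP R _)).
  have f0 : aeq f (fun=> 0).
    apply: aeq_trans (aeq_sym (SP f hf).1) _.
    apply: aeq_trans (bop0 bS); apply: (bop_aeq bS) => //.
      exact: bop_L2 bop_Phi hf.
    exact: L2v0.
  apply: aeq_trans (aeq_sym hAx) _.
  apply: aeq_trans (bop0 (bop_comp (@bop_opL R N) (bop_opM cA))).
  apply: (bop_aeq (bop_comp (@bop_opL R N) (bop_opM cA))) => //; exact: L2v0.
have hg0 := bop_L2 (@bop_opR R N) hg.
have hf := bop_L2 bS hg0; set f := S _ in hf.
have hh : L2 (opM A (opL f)) by apply: L2_opM => //; exact: bop_L2 (@bop_opL R N) hf.
exists (opM A (opL f)); split=> //; first exact: flip_fixed_opL.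
by apply/opR_eq => //; exact: (SP _ hg0).2.
Qed.

(** The inverse lifts [g] to H g, which R maps back to [g], replaces it by the solution E H g with
    the same projection, and reads off the f for which this solution is A L f. *)
Lemma split_invertible_Phi E : split_inj F -> split_section F E ->
  invertible_operator (Phi A).
Proof.
move=> inj sE; have [bE EP] := sE; split; first by apply/bopP; exact: bop_Phi.
pose S g := ufst (opM A' (E (opH g))).
have bS : bop S.
  exact: bop_comp (bop_comp (bop_comp (@bop_opH R N) bE) (bop_opM cA')) (@bop_ufst R N).
exists S => [|g hg]; first by apply/bopP.
have hH := bop_L2 (@bop_opH R N) hg.
split.
  have hL := bop_L2 (@bop_opL R N) hg.
  have hh : L2 (opM A (opL g)) by exact: L2_opM.
  set h := opM A (opL g) in hh.
  have hPhi := bop_L2 bop_Phi hg.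
  have hHP := bop_L2 (@bop_opH R N) hPhi.
  have : aeq (E (opH (Phi A g))) h.
    apply: (split_section_unique inj sE hh hHP (flip_fixed_opL g)).
    exact: (opR_eq hh hHP).1 (aeq_sym (opR_opH hPhi)).
  move=> /(aeq_opM A')/aeq_ufst e; apply: aeq_trans e _.
  by rewrite opMA'A /opL ufst_pairv; exact: aeq_refl.
have [YE PE] := EP _ hH; have hE := bop_L2 bE hH.
have xf := opL_flip_fixed hE YE.
have hx : L2 (opM A' (E (opH g))) by exact: L2_opM.
have hL := bop_L2 (@bop_opL R N) (L2_ufst hx).
have hAL : L2 (opM A (opL (ufst (opM A' (E (opH g)))))) := L2_opM cA hL.
rewrite PhiE; apply: aeq_trans (opR_opH hg).
apply: (opR_eq hAL hH).2; apply: aeq_trans PE; apply: (aeq_opP hAL hE).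
by have := aeq_opM A (aeq_sym xf); rewrite opMAA'.
Qed.

(* [(I, J) w = 0] means [W J w = - w]: this is where the sign of [G'] comes from. *)
Lemma opT_eq0 v : L2 v -> aeq (opT (opM A v)) (fun=> 0) <-> flip_fixed G' (opJ v).
Proof.
move=> hv; have hw : L2 (opM A v) by exact: L2_opM.
have h1 := L2_ufst hw; have h2 := L2_usnd hw.
have step1 : aeq (opT (opM A v)) (fun=> 0) <->
    aeq (opM (fun=> Wmx N) (opJ (opM A v))) (fun t => - opM A v t).
  rewrite -{2 3}[opM A v]pairv_eta opJ_pairv opM_W_pairv; split=> h.
    have e1 : aeq (opJ (usnd (opM A v))) (fun t => - ufst (opM A v) t).
      move: h; apply: filterS => t; rewrite /opT => /eqP.
      by rewrite addrC addr_eq0 => /eqP.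
    have e2 : aeq (opJ (ufst (opM A v))) (fun t => - usnd (opM A v) t).
      have := aeq_opJ (L2_opJ h2) (L2vN h1) e1; rewrite opJK => e.
      apply: filterS e => t; rewrite /opJ => ->.
      by rewrite scalerN opprK.
    move: e1 e2; apply: filterS2 => t; rewrite /pairv => -> ->.
    by rewrite -opp_col_mx.
  move: h => /aeq_ufst; rewrite ufst_pairv; apply: filterS => t e.
  by rewrite /opT e /ufst linearN /= -/(pairv _ _) /pairv col_mxKu addrN.
rewrite step1 /flip_fixed opJK opJ_opM; split.
  move=> /(aeq_opM (fun t => A' (cinv t) *m Wmx N)).
  have -> : opM (fun t => A' (cinv t) *m Wmx N)
      (opM (fun=> Wmx N) (opM (fun t => A (cinv t)) (opJ v))) = opJ v.
    rewrite !opM_comp -[RHS]opM_id; congr opM; apply/funext => t.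
    by rewrite -[_ *m Wmx N *m Wmx N]mulmxA Wmx_sqr mulmx1 A'A.
  move=> e; apply: aeq_trans (aeq_sym e); apply: aeW => t.
  by rewrite /opM /G' /G mulmxN mulNmx !mulmxA.
move=> /(aeq_opM (fun t => Wmx N *m A (cinv t))) e.
apply: aeq_trans (aeq_trans (aeq_sym e) _); apply: aeW => t.
  by rewrite /opM !mulmxA.
rewrite /opM /G' /G mulNmx mulmxN !mulmxA -[Wmx N *m A _ *m _]mulmxA AA' mulmx1.
by rewrite Wmx_sqr mul1mx.
Qed.

(** [x g] solves T A x = g. The function v = J E J x lies in the kernel of T A, and J (x - v) has
    projection zero. Thus x - v lies in the range of P, so it is H f with f = T (x - v), and Psi(A)
    f = T A (x - v) = g. *)
Lemma split_invertible_Psi E : split_inj G' -> split_section G' E ->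
  invertible_operator (Psi A).
Proof.
move=> inj sE; have [bE EP] := sE; split; first by apply/bopP; exact: bop_Psi.
pose x g := opM A' (pairv g (fun=> 0)).
pose v g := opJ (E (opJ (x g))).
have b0 : bop (fun _ : vfun R N => (fun=> 0 : 'cV[C]_N)).
  split=> [f _|a f g _ _|]; first exact: L2v0.
    by apply: aeW => t; rewrite scaler0 addr0.
  by exists 0 => // f _; rewrite mul0r (vN_eq0 (aeq_refl _) (@L2v0 R _)).
have bx : bop x by exact: bop_comp (bop_pairv (@bop_id R N) b0) (bop_opM cA').
have bJ := @bop_opJ R (N + N).
have bv : bop v by exact: bop_comp (bop_comp (bop_comp bx bJ) bE) bJ.
have bS : bop (fun g => opT (fun t => x g t - v g t)).
  exact: bop_comp (bopB bx bv) (@bop_opT R N).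
have opTx g : opT (opM A (x g)) = g.
  apply/funext => t; rewrite /x opMAA' /opT ufst_pairv usnd_pairv /opJ scaler0.
  by rewrite addr0.
have hT := @bop_opT R N.
have hbA := bop_opM cA.
exists (fun g => opT (fun t => x g t - v g t)) => [|g hg]; first by apply/bopP.
split.
  have hf := bop_L2 bop_Psi hg; set f := Psi A g in hf.
  have hx := bop_L2 bx hf; have hv := bop_L2 bv hf; have hq := bop_L2 (@bop_opH R N) hg.
  have hJx := bop_L2 bJ hx; have hJq := bop_L2 bJ hq.
  have hxq := L2vB hx hq; have hJxq := bop_L2 bJ hxq.
  have e0 : aeq (opT (opM A (fun t => x f t - opH g t))) (fun=> 0).
    apply: aeq_trans (bop_sub (bop_comp hbA hT) hx hq) _.
    by rewrite opTx; apply: aeW => t; rewrite subrr.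
  have Y := (opT_eq0 hxq).1 e0.
  have PJ : aeq (opP (opJ (fun t => x f t - opH g t))) (opP (opJ (x f))).
    rewrite opJB; apply: aeq_trans (bop_sub (@bop_opP R _) hJx hJq) _.
    apply: aeq_trans (aeqB (aeq_refl _) (opP_opJ_opH hg)) _.
    by apply: aeW => t; rewrite subr0.
  have := split_section_unique inj sE hJxq hJx Y PJ.
  move=> /(aeq_opJ (bop_L2 bE hJx) hJxq); rewrite opJK -/(v f) => e.
  apply: aeq_trans (opT_opH hg); apply: (bop_aeq hT) => //; first exact: L2vB.
  by apply: filterS e => t ->; rewrite subKr.
have hx := bop_L2 bx hg; have hv := bop_L2 bv hg.
have hJx := bop_L2 bJ hx; have hh := L2vB hx hv.
have [YE PE] := EP _ hJx; have hE := bop_L2 bE hJx.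
set h := fun t => x g t - v g t in hh *.
have PJh : aeq (opP (opJ h)) (fun=> 0).
  rewrite /h opJB opJK; apply: aeq_trans (bop_sub (@bop_opP R _) hJx hE) _.
  apply: aeq_trans (aeqB (aeq_refl _) PE) _.
  by apply: aeW => t; rewrite subrr.
have Ph : aeq (opP h) h.
  apply/aeq_vf => //; first exact: L2_opP.
  move=> k; rewrite vf_opP//; case: ifPn => // k0.
  have hJh := bop_L2 bJ hh.
  have := (aeq_vf (L2_opP hJh) (@L2v0 R _)).1 PJh (- 1 - k).
  rewrite vf_opP// vf_opJ// vf0 ifT; last lia.
  by rewrite (_ : - 1 - (- 1 - k) = k); last lia.
have hTh := bop_L2 hT hh.
rewrite PsiE; apply: aeq_trans (bop_aeq (bop_comp hbA hT) _ hh (opH_opT hh Ph)) _.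
  exact: bop_L2 (@bop_opH R N) hTh.
apply: aeq_trans (bop_sub (bop_comp hbA hT) hx hv) _; rewrite opTx.
have : aeq (opT (opM A (v g))) (fun=> 0).
  by apply/(opT_eq0 hv); rewrite /v opJK.
by apply: filterS => t ->; rewrite subr0.
Qed.

(** A solution [k] with zero projection is J H f with Psi(A) f = 0. For given [g], solve Psi(A) f =
    T A J g: subtracting J H f from [g] leaves the projection unchanged and gives a solution. *)
Lemma invertible_Psi_split : invertible_operator (Psi A) -> split_inj G' /\ split_surj G'.
Proof.
have hT := @bop_opT R N; have hbA := bop_opM cA; have bJ := @bop_opJ R (N + N).
have bH := @bop_opH R N.
move=> [_ [S /bopP bS SP]]; split=> [k hk Yk Pk|g hg].
  have hv := bop_L2 bJ hk; set v := opJ k in hv.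
  have Pv : aeq (opP v) v.
    apply/aeq_vf => //; first exact: L2_opP.
    move=> j; rewrite vf_opP//; case: ifPn => // j0.
    have := (aeq_vf (L2_opP hk) (@L2v0 R _)).1 Pk (- 1 - j).
    by rewrite vf_opP// vf0 ifT ?/v ?vf_opJ//; lia.
  have Tv : aeq (opT (opM A v)) (fun=> 0) by apply/(opT_eq0 hv); rewrite /v opJK.
  have hf := bop_L2 hT hv; have hHf := bop_L2 bH hf.
  have e := opH_opT hv Pv.
  have f0 : aeq (opT v) (fun=> 0).
    apply: aeq_trans (aeq_sym (SP _ hf).1) _; apply: aeq_trans (bop0 bS).
    apply: (bop_aeq bS); [exact: bop_L2 bop_Psi hf|exact: L2v0|].
    by rewrite PsiE; apply: aeq_trans Tv; apply: (bop_aeq (bop_comp hbA hT)).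
  have v0 : aeq v (fun=> 0).
    apply: aeq_trans (aeq_sym e) _; apply: aeq_trans (bop0 bH).
    by apply: (bop_aeq bH) => //; exact: L2v0.
  rewrite -[k]opJK; apply: aeq_trans (bop0 bJ).
  by apply: (bop_aeq bJ) => //; exact: L2v0.
have hx := bop_L2 bJ hg; have hAx := bop_L2 (bop_comp hbA hT) hx.
have hf := bop_L2 bS hAx; set f := S _ in hf.
have hHf := bop_L2 bH hf; have hv := L2vB hx hHf.
have hJH := bop_L2 bJ hHf.
have eJ : opJ (fun t => opJ g t - opH f t) = (fun t => g t - opJ (opH f) t).
  by rewrite opJB opJK.
exists (fun t => g t - opJ (opH f) t); split.
- exact: L2vB.
- rewrite -eJ; apply/(opT_eq0 hv).
  apply: aeq_trans (bop_sub (bop_comp hbA hT) hx hHf) _.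
  have [_ e] := SP _ hAx.
  by move: e; rewrite PsiE; apply: filterS => t ->; rewrite subrr.
- apply: aeq_trans (bop_sub (@bop_opP R _) hg hJH) _.
  apply: aeq_trans (aeqB (aeq_refl _) (opP_opJ_opH hf)) _.
  by apply: aeW => t; rewrite subr0.
Qed.

End Split.

(** * The splitting of a factored matrix function *)

Section Factored.
Variable R : realType.
Local Notation C := R[i].

Definition antianalytic m n (A : circle R -> 'M[C]_(m, n)) :=
  forall i j k, 0 < k -> fourier (fun t => A t i j) k = 0.

Lemma vf_coord n (f : vfun R n) k i : vf f k i 0 = fourier (fun t => f t i 0) k.
Proof. by rewrite mxE. Qed.

Lemma vf_antianalytic m n (A : circle R -> 'M[C]_(m, n)) (f : vfun R n) :
  cmx A -> antianalytic A -> L2 f -> (forall k, 0 <= k -> vf f k = 0) ->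
  forall k, 0 <= k -> vf (opM A f) k = 0.
Proof.
move=> cA aA hf f0 k k0; apply/colP => i; rewrite vf_coord mxE opM_coordE.
elim: (enum 'I_n) => [|j s ih].
  rewrite -[RHS](@fourier0 R k); congr fourier.
  by apply/funext => t; rewrite big_nil.
have -> : (fun t => \sum_(l <- j :: s) A t i l * f t l 0) =
    (fun t => A t i j * f t j 0 + \sum_(l <- s) A t i l * f t l 0).
  by apply/funext => t; rewrite big_cons.
rewrite fourierD ?ih ?addr0//; last 2 first.
- exact: L2_cmul.
- by apply: (@L2_sum _ _ _ (fun j t => A t i j * f t j 0)) => l; exact: L2_cmul.
have [M bM] := ccontinuous_bounded (cA i j).
apply: (@fourier_mul_le0 _ _ M _ (-1)) => //.
- exact: ccontinuous_L2.
- by move=> p; exact: aA.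
- by move=> p p0; rewrite -vf_coord f0 ?mxE//; lia.
Qed.

Lemma opP_eq0 n (f : vfun R n) : L2 f ->
  aeq (opP f) (fun=> 0) <-> forall k, 0 <= k -> vf f k = 0.
Proof.
move=> hf; rewrite aeq_vf; [|exact: L2_opP|exact: L2v0].
split=> h k; last by rewrite vf_opP// vf0; case: ifP => // /h.
by move=> k0; have := h k; rewrite vf_opP// k0 vf0.
Qed.

Lemma ccontinuousM (f g : circle R -> C) : ccontinuous f -> ccontinuous g ->
  ccontinuous (fun t => f t * g t).
Proof.
move=> /ccontinuousP[fR fI] /ccontinuousP[gR gI]; apply/ccontinuousP; split.
  have -> : (fun t => complex.Re (f t * g t)) = (fun t =>
      complex.Re (f t) * complex.Re (g t) - complex.Im (f t) * complex.Im (g t)).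
    by apply/funext => t; case: (f t) (g t) => [? ?] [].
  by move=> t; exact: (cvgB (cvgM (fR t) (gR t)) (cvgM (fI t) (gI t))).
have -> : (fun t => complex.Im (f t * g t)) = (fun t =>
    complex.Re (f t) * complex.Im (g t) + complex.Im (f t) * complex.Re (g t)).
  by apply/funext => t; case: (f t) (g t) => [? ?] [].
by move=> t; exact: (cvgD (cvgM (fR t) (gI t)) (cvgM (fI t) (gR t))).
Qed.

Lemma ccontinuousD (f g : circle R -> C) : ccontinuous f -> ccontinuous g ->
  ccontinuous (fun t => f t + g t).
Proof.
move=> /ccontinuousP[fR fI] /ccontinuousP[gR gI]; apply/ccontinuousP; split.
  have -> : (fun t => complex.Re (f t + g t)) = (fun t =>
      complex.Re (f t) + complex.Re (g t)).
    by apply/funext => t; case: (f t) (g t) => [? ?] [].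
  by move=> t; exact: (cvgD (fR t) (gR t)).
have -> : (fun t => complex.Im (f t + g t)) = (fun t =>
    complex.Im (f t) + complex.Im (g t)).
  by apply/funext => t; case: (f t) (g t) => [? ?] [].
by move=> t; exact: (cvgD (fI t) (gI t)).
Qed.

Lemma ccontinuous_cinv (f : circle R -> C) : ccontinuous f ->
  ccontinuous (fun t => f (cinv t)).
Proof.
move=> /ccontinuousP[fR fI]; apply/ccontinuousP; split=> t.
  exact: (continuous_comp (@cinv_continuous R t) (fR (cinv t))).
exact: (continuous_comp (@cinv_continuous R t) (fI (cinv t))).
Qed.

Lemma ccontinuous_exprz (k : int) : ccontinuous (fun t : circle R => (t : C) ^ k).
Proof.
have h (f : circle R -> C) (m : nat) : ccontinuous f -> ccontinuous (fun t => f t ^+ m).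
  move=> cf; elim: m => [|m ih]; first exact: ccontinuous_cst.
  rewrite (_ : (fun t => _) = (fun t => f t * f t ^+ m)); first exact: ccontinuousM.
  by apply/funext => t; rewrite exprS.
case: k => k; first by apply: h; exact: ccontinuous_cval.
rewrite (_ : (fun t => _) = (fun t : circle R => (cinv t : C) ^+ k.+1)).
  by apply: h; apply: (@ccontinuous_cinv (@cval R)); exact: ccontinuous_cval.
by apply/funext => t; rewrite NegzE -exprnN -exprVn.
Qed.

Variables (n : nat) (rho kappa : 'I_n -> int).
Hypothesis rhoP : forall k, rho k \in [:: -1; 1].

Definition Dmx (t : circle R) : 'M[C]_n :=
  diag_mx (\row_k ((rho k)%:~R * (t : C) ^ kappa k)).

Lemma rho_sqr k : (rho k)%:~R * (rho k)%:~R = 1 :> C.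
Proof. by have := rhoP k; rewrite !inE => /orP[]/eqP ->; rewrite ?mulrNN mulr1. Qed.

Lemma cmx_Dmx : cmx Dmx.
Proof.
move=> i j; have -> : (fun t => Dmx t i j) =
    (fun t => ((rho i)%:~R *+ (i == j)) * (t : C) ^ kappa i).
  by apply/funext => t; rewrite !mxE mulrnAl.
by apply: ccontinuousM; [exact: ccontinuous_cst|exact: ccontinuous_exprz].
Qed.

Lemma opM_Dmx_coord (f : vfun R n) i : (fun t => opM Dmx f t i 0) =
  (fun t => (rho i)%:~R * ((t : C) ^ kappa i * f t i 0)).
Proof. by apply/funext => t; rewrite /opM mul_diag_mx !mxE mulrA. Qed.

Lemma vf_DJ (f : vfun R n) k i : L2 f ->
  vf (opM Dmx (opJ f)) k i 0 = (rho i)%:~R * vf f (kappa i - 1 - k) i 0.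
Proof.
move=> hf; rewrite vf_coord opM_Dmx_coord fourierZ; last first.
  by apply: L2_exprzM; exact: L2_opJ.
rewrite fourier_exprzM -vf_coord vf_opJ//; congr (_ * vf f _ i 0); lia.
Qed.

Lemma flip_fixed_DP (y : vfun R n) : L2 y -> flip_fixed Dmx y <->
  forall k i, vf y k i 0 = (rho i)%:~R * vf y (kappa i - 1 - k) i 0.
Proof.
move=> hy; rewrite /flip_fixed aeq_vf//; last first.
  by apply: L2_opM; [exact: cmx_Dmx|exact: L2_opJ].
split=> [h k i|h k]; first by rewrite -vf_DJ// h.
by apply/colP => i; rewrite vf_DJ// -h.
Qed.

Variables (Fm Fm' F : circle R -> 'M[C]_n).
Hypotheses (cF : cmx Fm) (cF' : cmx Fm') (aF : antianalytic Fm) (aF' : antianalytic Fm').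
Hypotheses (FF' : forall t, Fm t *m Fm' t = 1%:M) (F'F : forall t, Fm' t *m Fm t = 1%:M).
Hypothesis FE : forall t, F t = Fm t *m Dmx t *m Fm' (cinv t).

Lemma opMFF' h : opM Fm (opM Fm' h) = h.
Proof. by apply/funext => t; rewrite /opM mulmxA FF' mul1mx. Qed.

Lemma opMF'F h : opM Fm' (opM Fm h) = h.
Proof. by apply/funext => t; rewrite /opM mulmxA F'F mul1mx. Qed.

Lemma flip_fixed_factor y : flip_fixed Dmx y -> flip_fixed F (opM Fm y).
Proof.
move=> /(aeq_opM Fm) Y; apply: aeq_trans Y; apply: aeW => t.
by rewrite opJ_opM /opM FE -!mulmxA; do 2 congr (_ *m _); rewrite mulmxA F'F mul1mx.
Qed.

Lemma flip_fixed_unfactor h : flip_fixed F h -> flip_fixed Dmx (opM Fm' h).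
Proof.
move=> /(aeq_opM Fm') Y; apply: aeq_trans Y; apply: aeW => t.
by rewrite opJ_opM /opM FE !mulmxA F'F mul1mx.
Qed.

Lemma opP_Fm h : L2 h -> aeq (opP h) (fun=> 0) -> aeq (opP (opM Fm h)) (fun=> 0).
Proof.
move=> hh; move/(opP_eq0 hh) => H; apply/opP_eq0; first exact: L2_opM.
exact: vf_antianalytic.
Qed.

Lemma opP_Fm' h : L2 h -> aeq (opP h) (fun=> 0) -> aeq (opP (opM Fm' h)) (fun=> 0).
Proof.
move=> hh; move/(opP_eq0 hh) => H; apply/opP_eq0; first exact: L2_opM.
exact: vf_antianalytic.
Qed.

Let S : seq (int * int) := [:: (-1, -1); (-1, 0); (1, 0); (1, 1)].

(* The operator [(I + (I - P) D J) P]. *)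
Definition DE (u : vfun R n) : vfun R n := fun t =>
  opP u t + (opM Dmx (opJ (opP u)) t - opP (opM Dmx (opJ (opP u))) t).

Lemma bop_DE : bop DE.
Proof.
have bP := @bop_opP R n.
have bDJ := bop_comp (bop_comp bP (@bop_opJ R n)) (bop_opM cmx_Dmx).
have h := bopD bP (bopB bDJ (bop_comp bDJ bP)); exact: h.
Qed.

Lemma vf_DE u k i : L2 u -> vf (DE u) k i 0 =
  if 0 <= k then vf u k i 0 else
  (if 0 <= kappa i - 1 - k then (rho i)%:~R * vf u (kappa i - 1 - k) i 0 else 0).
Proof.
move=> hu; have hP := L2_opP hu.
have hD : L2 (opM Dmx (opJ (opP u))).
  by apply: L2_opM; [exact: cmx_Dmx|exact: L2_opJ].
have hPD := L2_opP hD.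
rewrite /DE (vfD _ hP (L2vB hD hPD)) (vfB _ hD hPD).
rewrite (vf_opP _ hu) (vf_opP _ hD); case: ifPn => k0; first by rewrite subrr addr0.
rewrite subr0 add0r (vf_DJ _ _ hP) (vf_opP _ hu); case: ifP => // _.
by rewrite mxE mulr0.
Qed.

(** For the allowed pairs the reflection k -> kappa - 1 - k exchanges negative and nonnegative
    indices, with a single self-paired index when kappa is -1 or 1. The sign rho settles that
    index. *)
Lemma factor_split : (forall k, (rho k, kappa k) \in S) ->
  split_inj F /\ split_section F (fun g => opM Fm (DE (opM Fm' g))).
Proof.
move=> inS; split.
  move=> h hh Yh Ph; have hy : L2 (opM Fm' h) by exact: L2_opM.
  have Py := (opP_eq0 hy).1 (opP_Fm' hh Ph).
  have Yy := (flip_fixed_DP hy).1 (flip_fixed_unfactor Yh).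
  have : aeq (opM Fm' h) (fun=> 0).
    apply/aeq_vf => //; first exact: L2v0.
    move=> k; rewrite vf0; have [k0|k0] := lerP 0 k; first exact: Py.
    apply/colP => i; rewrite [RHS]mxE; have [j0|j0] := lerP 0 (kappa i - 1 - k).
      by rewrite Yy Py// mxE mulr0.
    (* Two negative indices are paired only for kappa = -1 and k = -1, an index that is its own
       reflection; there rho = -1 forces the coefficient to vanish. *)
    have := inS i; rewrite !inE => /orP[|/orP[|/orP[|]]] /eqP[rE kE]; try lia.
    have kk : kappa i - 1 - k = k by lia.
    have := Yy k i; rewrite kk rE => /eqP.
    by rewrite mulN1r -addr_eq0 -mulr2n mulrn_eq0 /= => /eqP.
  move=> /(aeq_opM Fm); rewrite opMFF' => e; apply: aeq_trans e _.
  by apply: aeW => t; rewrite /opM mulmx0.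
split; first exact: bop_comp (bop_comp (bop_opM cF') bop_DE) (bop_opM cF).
move=> g hg; have hu : L2 (opM Fm' g) by exact: L2_opM.
have hy := bop_L2 bop_DE hu.
split.
  apply: flip_fixed_factor; apply/(flip_fixed_DP hy) => k i.
  rewrite (vf_DE k i hu) (vf_DE (kappa i - 1 - k) i hu); set j := kappa i - 1 - k.
  have -> : kappa i - 1 - j = k by rewrite /j; lia.
  have [k0|k0] := lerP 0 k; have [j0|j0] := lerP 0 j => //.
  (* Two nonnegative indices are paired only for kappa = 1 and k = 0, where rho = 1 makes the
     equation trivial. *)
  - have := inS i; rewrite !inE => /orP[|/orP[|/orP[|]]] /eqP[rE kE]; try (rewrite /j in j0; lia).
    rewrite rE mul1r (_ : j = k)//; rewrite /j in j0 *; lia.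
  - by rewrite mulrA rho_sqr mul1r.
  - by rewrite mulr0.
have hFy : L2 (opM Fm (DE (opM Fm' g))) by exact: L2_opM.
have hd := L2vB hy hu; have hFd : L2 (opM Fm (fun t => DE (opM Fm' g) t - opM Fm' g t)).
  exact: L2_opM.
have P0 : aeq (opP (opM Fm (fun t => DE (opM Fm' g) t - opM Fm' g t))) (fun=> 0).
  apply: opP_Fm => //; apply/(opP_eq0 hd) => k k0; rewrite vfB//.
  by apply/colP => i; rewrite mxE [X in _ + X]mxE vf_DE// k0 subrr mxE.
have e : opM Fm (fun t => DE (opM Fm' g) t - opM Fm' g t) =
    (fun t => opM Fm (DE (opM Fm' g)) t - g t).
  apply/funext => t; rewrite /opM mulmxBr; congr (_ - _).
  exact: (congr1 (@^~ t) (opMFF' g)).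
rewrite e in P0 hFd; apply/aeq_opP_vf => // k k0.
have := (opP_eq0 hFd).1 P0 k k0; rewrite vfB// => /eqP.
by rewrite subr_eq0 => /eqP.
Qed.

Lemma vf_exprz_delta (c : C) (p k : int) (i : 'I_n) :
  vf (fun t : circle R => (c * (t : C) ^ p) *: delta_mx i 0) k =
  (c *+ (k == p)) *: delta_mx i 0.
Proof.
apply/colP => j; rewrite vf_coord !mxE.
have -> : (fun t : circle R => ((c * (t : C) ^ p) *: (delta_mx i 0 : 'cV[C]_n)) j 0) =
   (fun t : circle R => (c * ((j == i) && (0 == 0 :> 'I_1))%:R) * (t : C) ^ p).
  by apply/funext => t; rewrite !mxE mulrAC.
rewrite fourierZ; last exact: L2_exprz.
by rewrite fourier_exprz mulrAC [c * _]mulr_natr.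
Qed.

Lemma L2_exprz_delta (c : C) (p : int) (i : 'I_n) :
  L2 (fun t : circle R => (c * (t : C) ^ p) *: (delta_mx i 0 : 'cV[C]_n)).
Proof.
move=> j; have := L2Z (c * ((j == i) && (0 == 0 :> 'I_1))%:R) (L2_exprz R p).
by congr (Lp _ _); apply/funext => t; rewrite !mxE mulrAC.
Qed.

(* Otherwise [t^-1 + rho t^kappa] spans a nonzero solution with vanishing projection. *)
Lemma split_inj_index k : split_inj F -> kappa k < 0 -> (rho k, kappa k) = (-1, -1).
Proof.
move=> inj k0.
pose y1 (t : circle R) : 'cV[C]_n := (1 * (t : C) ^ (-1)) *: delta_mx k 0.
pose y2 (t : circle R) : 'cV[C]_n := ((rho k)%:~R * (t : C) ^ kappa k) *: delta_mx k 0.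
have h1 : L2 y1 := L2_exprz_delta 1 (-1) k.
have h2 : L2 y2 := L2_exprz_delta (rho k)%:~R (kappa k) k.
have hy := L2vD h1 h2; set y := fun t => _ in hy.
have vy j i : vf y j i 0 = ((1 : C) *+ (j == -1) + (rho k)%:~R *+ (j == kappa k)) * (i == k)%:R.
  by rewrite /y vfD// !vf_exprz_delta !mxE andbT mulrDl.
have Yy : flip_fixed Dmx y.
  apply/(flip_fixed_DP hy) => j i; rewrite !vy mulrA.
  have [->|_] := eqVneq i k; last by rewrite !mulr0.
  rewrite !mulr1 mulrDr (_ : (kappa k - 1 - j == -1) = (j == kappa k)); last by lia.
  rewrite (_ : (kappa k - 1 - j == kappa k) = (j == -1)); last by lia.
  by case: (j == -1); case: (j == kappa k);
    rewrite /= ?mulr0n ?mulr1n ?mulr0 ?mulr1 ?rho_sqr ?addr0 ?add0r // addrC.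
have Py : aeq (opP y) (fun=> 0).
  apply/(opP_eq0 hy) => j j0; apply/colP => i; rewrite vy mxE.
  have -> : (j == -1) = false by move: j0; clear; lia.
  have -> : (j == kappa k) = false by move: (kappa k) j0 k0; clear; lia.
  by rewrite addr0 mul0r.
have hFy : L2 (opM Fm y) by exact: L2_opM.
have := inj _ hFy (flip_fixed_factor Yy) (opP_Fm hy Py).
move=> /(aeq_opM Fm'); rewrite opMF'F => e.
have : aeq y (fun=> 0).
  by apply: aeq_trans e _; apply: aeW => t; rewrite /opM mulmx0.
move=> /(aeq_vf hy (@L2v0 R _)).1/(_ (-1)).
rewrite vf0 => /colP/(_ k); rewrite vy !mxE !eqxx mulr1.
(* If kappa = -1 the two monomials coincide: they cancel for rho = -1, the allowed pair, and add up
   for rho = 1. *)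
have := rhoP k; rewrite !inE => /orP[]/eqP ->.
  have [->//|_] := eqVneq (-1) (kappa k).
  by rewrite addr0 => /eqP; rewrite oner_eq0.
by rewrite -mulrnDr => /eqP; rewrite mulrn_eq0 oner_eq0 addSn.
Qed.

(* A solution [y] with [P y = e_k] has [1 = y_0 = rho y_(kappa-1)]. *)
Lemma split_surj_index k : split_surj F -> 0 < kappa k -> (rho k, kappa k) = (1, 1).
Proof.
move=> surj k0.
have he : L2 (fun t : circle R => (1 * (t : C) ^ 0) *: (delta_mx k 0 : 'cV[C]_n)).
  exact: L2_exprz_delta.
set e := fun t : circle R => _ in he.
have hg : L2 (opM Fm e) by exact: L2_opM.
have [h [hh Yh Ph]] := surj _ hg.
have hy : L2 (opM Fm' h) by exact: L2_opM.
have Yy := (flip_fixed_DP hy).1 (flip_fixed_unfactor Yh).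
have hd := L2vB hh hg.
have Pd : aeq (opP (fun t => h t - opM Fm e t)) (fun=> 0).
  apply: aeq_trans (bop_sub (@bop_opP R n) hh hg) _.
  by apply: filterS Ph => t ->; rewrite subrr.
have := opP_Fm' hd Pd.
have -> : opM Fm' (fun t => h t - opM Fm e t) = (fun t => opM Fm' h t - e t).
  apply/funext => t; rewrite /opM mulmxBr; congr (_ - _).
  exact: (congr1 (@^~ t) (opMF'F e)).
move=> /(opP_eq0 (L2vB hy he)).1 H.
have vy j : 0 <= j -> vf (opM Fm' h) j k 0 = (j == 0)%:R.
  move=> j0; have /eqP := H j j0; rewrite vfB// subr_eq0 => /eqP ->.
  by rewrite vf_exprz_delta !mxE !eqxx mulr1.
have := Yy 0 k; rewrite !vy//; last lia.
rewrite eqxx; have [k1|_] := eqVneq (kappa k - 1 - 0) 0; last first.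
  by rewrite mulr0 => /eqP; rewrite oner_eq0.
have -> : kappa k = 1 by lia.
have := rhoP k; rewrite !inE => /orP[]/eqP ->//.
by rewrite mulr1 => /eqP; rewrite -subr_eq0 opprK -mulr2n mulrn_eq0 oner_eq0.
Qed.

Lemma split_index : split_inj F -> split_surj F -> forall k, (rho k, kappa k) \in S.
Proof.
move=> inj surj k; case: (ltrgtP (kappa k) 0) => k0.
- by rewrite split_inj_index.
- by rewrite split_surj_index.
- by rewrite k0; have := rhoP k; rewrite !inE => /orP[]/eqP ->.
Qed.

End Factored.

(** * Existence of antisymmetric factorizations *)

(** The identity is the sum of (1 + A)/2 and (1 - A)/2, whose rows are eigenvectors for 1 and -1. *)
Lemma involution_diagonalizable (K : fieldType) n (A : 'M[K]_n) :
  2 \is a (@GRing.unit K) -> A *m A = 1%:M -> diagonalizable A.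
Proof.
move=> u2 AA; apply/diagonalizablePeigen; exists [:: 1; -1].
  rewrite /= inE andbT; apply/eqP => h1.
  by move: u2; rewrite unitfE -[2]/(1 + 1) {2}h1 subrr eqxx.
rewrite big_cons big_seq1; apply/eqmxP; rewrite submx1 /=.
have -> : (1%:M : 'M[K]_n) = (2^-1 *: (1%:M + A)) + (2^-1 *: (1%:M - A)).
  rewrite -scalerDr addrACA subrr addr0 -mulr2n.
  by rewrite -[1%:M *+ 2]scaler_nat scalerA mulVr// scale1r.
apply: addmx_sub_adds; apply/eigenspaceP.
  by rewrite -scalemxAl mulmxDl AA mul1mx scale1r addrC.
by rewrite -scalemxAl mulmxBl AA mul1mx scaleN1r -scalerN opprB.
Qed.

(* A permutation [s] with [kappa i <= kappa (s i)] for all [i] preserves [kappa], since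
   [\sum_i kappa (s i) = \sum_i kappa i]. *)
Lemma det_kappa_triangular (K : comNzRingType) n (kappa : 'I_n -> int) (c : K)
    (Y : 'M[K]_n) :
  (forall i j, kappa j < kappa i -> Y i j = 0) ->
  (forall i j, kappa i = kappa j -> Y i j = c *+ (i == j)) -> \det Y = c ^+ n.
Proof.
move=> Y0 Yc; rewrite /determinant (bigD1 (1%g : {perm 'I_n}))//= odd_perm1 expr0 mul1r.
rewrite [X in _ + X]big1 ?addr0.
  rewrite (eq_bigr (fun=> c)) ?prodr_const ?card_ord// => i _.
  by rewrite perm1 Yc// eqxx.
move=> s s1; rewrite [X in _ * X](_ : _ = 0) ?mulr0//.
have [/existsP[i ki]|/existsPn h] := boolP [exists i, kappa (s i) < kappa i].
  by rewrite (bigD1 i)//= Y0// mul0r.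
have le i : kappa i <= kappa (s i) by rewrite leNgt h.
have eqs : \sum_i (kappa (s i) - kappa i) = 0.
  by rewrite sumrB [X in _ - X](reindex_inj (@perm_inj _ s)) subrr.
have eqk i : kappa i = kappa (s i).
  have := @psumr_eq0P _ _ predT (fun i => kappa (s i) - kappa i).
  move=> /(_ (fun i _ => _))/(_ eqs i isT) h2.
  by apply/esym/eqP; rewrite -subr_eq0; apply/eqP/h2 => i0; rewrite subr_ge0.
have [i si] : exists i, s i != i.
  apply/existsP; apply: contraR s1 => /existsPn h'; apply/eqP/permP => i.
  by rewrite perm1; apply/eqP; move: (h' i); rewrite negbK.
by rewrite (bigD1 i)//= Yc// eq_sym (negbTE si) mulr0n mul0r.
Qed.

Lemma invmx_eq (K : comUnitRingType) n (A A' : 'M[K]_n) : A *m A' = 1%:M -> invmx A = A'.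
Proof.
move=> h; have uA : A \in unitmx by case/mulmx1_unit: h.
by rewrite -[RHS]mul1mx -(mulVmx uA) -mulmxA h mulmx1.
Qed.

(** * Noncommutative identities behind the normal form *)

Section Regroup.
Variables (K : comUnitRingType) (n : nat).
Implicit Types a b c d l m p r u x : 'M[K]_n.

(** With a = A_+~, m = A_- and d = L, the left side is U L U~ L~ and the right side is the conjugate
    of F F~ by [a]. *)
Lemma mulmx_conj a a' d d' m m' : a \in unitmx ->
  a *m m *m d *m (a' *m m') *m d' = a *m (m *m d *m a' *m (m' *m d' *m a)) *m invmx a.
Proof. by move=> ua; rewrite !mulmxA mulmxK. Qed.

(** With a = A_+~, m = A_-, d = L and b = D, the equation X D = U L X~ yields the factorization of F
    = A_- L A_+ with left factor a^(-1) X. *)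
Lemma mulmx_regroup a a' b d m x x' : a \in unitmx -> x' \in unitmx ->
  x *m b = a *m m *m d *m x' ->
  invmx a *m x *m b *m (invmx x' *m a') = m *m d *m a'.
Proof.
by move=> ua ux e; rewrite -(mulmxA _ x) e !mulmxA mulmxK// mulVmx// mul1mx.
Qed.

Lemma mulmx_invmxC p a b : p \in unitmx -> p *m a = b *m p ->
  a *m invmx p = invmx p *m b.
Proof. by move=> up e; rewrite -[a in LHS](mulKmx up) e -!mulmxA mulmxV// mulmx1. Qed.

(** The two summands change places: U L C = U C L' is (U C R) (R L'), and U L U~ C R = L C R is C (R
    L'). *)
Lemma mulmx_normal_form u u' l l' r c : u *m l *m u' = l -> l *m c = c *m l' ->
  r *m l' = l' *m r -> r *m r = 1%:M ->
  u *m l *m (c + u' *m c *m r) = (c + u *m c *m r) *m (r *m l').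
Proof.
move=> ul lc rl rr; rewrite mulmxDr mulmxDl addrC; congr (_ + _).
  by rewrite !mulmxA ul lc -[LHS]mulmxA -rl mulmxA.
by rewrite -(mulmxA u) lc -(mulmxA (u *m c) r) (mulmxA r) rr mul1mx mulmxA.
Qed.

End Regroup.

Section KappaDiag.
Variable R : rcfType.
Local Notation C := R[i].

(* [U0] is an involution commuting with [diag kappa]: diagonalize both at once. *)
Lemma kappa_codiagonalize n (kappa : 'I_n -> int) (U0 : 'M[C]_n) :
  U0 *m U0 = 1%:M -> (forall i j, kappa i != kappa j -> U0 i j = 0) ->
  exists (P : 'M[C]_n) (rho kappa' : 'I_n -> int),
  [/\ P \in unitmx, forall k, rho k \in [:: -1; 1],
      P *m U0 = diag_mx (\row_k (rho k)%:~R) *m P &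
      forall j i, P j i != 0 -> kappa i = kappa' j].
Proof.
move=> UU U0k; pose K : 'M[C]_n := diag_mx (\row_i (kappa i)%:~R).
have UK : U0 *m K = K *m U0.
  apply/matrixP => i j; rewrite mul_mx_diag mul_diag_mx !mxE mulrC.
  have [->//|/U0k ->] := eqVneq (kappa i) (kappa j); by rewrite !mulr0.
have [P uP] : codiagonalizable [:: U0; K].
  apply/codiagonalizableP; split.
    by apply/all_comm_mxP/all_comm_mx2P.
  move=> B; rewrite !inE => /orP[]/eqP ->.
    apply: involution_diagonalizable => //.
    by rewrite unitfE pnatr_eq0.
  exact: diagonalizable_diag.
move=> /allP hall.
have U0in : U0 \in [:: U0; K] by rewrite inE eqxx.
have Kin : K \in [:: U0; K] by rewrite !inE eqxx orbT.
have /diagonalizable_forPex[r /simmxPp hr] : diagonalizable_for P U0 := hall _ U0in.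
have /diagonalizable_forPex[k' /simmxPp hk] : diagonalizable_for P K := hall _ Kin.
have fP : row_full P by rewrite row_full_unit.
have {}hr := hr (submx_full _ fP); have {}hk := hk (submx_full _ fP).
have rr j : r 0 j * r 0 j = 1.
  have : diag_mx r *m diag_mx r = 1%:M.
    rewrite -[LHS](mulmxK uP) -(mulmxA (diag_mx r)) -hr (mulmxA (diag_mx r)) -hr.
    by rewrite -(mulmxA P) UU mulmx1 mulmxV.
  by move=> /matrixP/(_ j j); rewrite mul_diag_mx !mxE eqxx mulr1n.
(* A row of the invertible [P] has a nonzero entry P j i, and at any such entry the eigenvalue of
   row j is the integer kappa i; this defines the new exponents. *)
have exP j : exists i, P j i != 0.
  apply/existsP; apply: contraT => /existsPn h.
  have : (P *m invmx P) j j = 1 by rewrite mulmxV// mxE eqxx.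
  rewrite mxE big1 => [|i _]; last by have := h i; rewrite negbK => /eqP ->; rewrite mul0r.
  by move=> /esym/eqP; rewrite oner_eq0.
have [f Pf] := choice exP.
have kE j i : P j i != 0 -> (kappa i)%:~R = k' 0 j :> C.
  move=> Pji; have /matrixP/(_ j i) := hk.
  by rewrite mul_diag_mx mul_mx_diag !mxE mulrC => /(mulIf Pji).
exists P, (fun j => if r 0 j == 1 then 1 else -1), (fun j => kappa (f j)).
split; first exact: uP.
- by move=> j; case: ifP; rewrite !inE.
- rewrite hr; congr (diag_mx _ *m _); apply/rowP => j; rewrite mxE.
  case: eqP => [->//|/eqP r1]; have /eqP := rr j.
  by rewrite -expr2 sqrf_eq1 (negbTE r1) /= => /eqP.
- move=> j i Pji; have := kE j i Pji; rewrite -(kE j (f j) (Pf j)).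
  exact: intr_inj.
Qed.

End KappaDiag.

Section KDiag.
Variable R : realType.

Definition kdiag n (kappa : 'I_n -> int) (t : circle R) : 'M[R[i]]_n :=
  diag_mx (\row_j (t : R[i]) ^ kappa j).

Lemma kdiagV n (kappa : 'I_n -> int) t : kdiag kappa t *m kdiag kappa (cinv t) = 1%:M.
Proof.
rewrite mulmx_diag -[RHS]diag_const_mx; congr diag_mx; apply/rowP => j.
rewrite [LHS]mxE [RHS]mxE [X in X * _]mxE [X in _ * X]mxE /= exprz_inv.
by rewrite -expfzDr ?cval_neq0// subrr expr0z.
Qed.

End KDiag.

(** * Matrix functions over [B] and [Bminus B], and the normal form of U *)

Section Algebra.
Variable R : realType.
Local Notation C := R[i].
Variables (B : set (circle R -> C)) (nB : (circle R -> C) -> R).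
Hypothesis hB : standing_assumptions B nB.
Implicit Types f g : circle R -> C.

Let Bc f : B f -> ccontinuous f := @sa_continuous _ _ _ hB f.
Let bB := sa_banach hB.

Lemma B_cst (c : C) : B (fun=> c).
Proof.
have := sa_trig hB (fun _ : 'I_1 => c) (fun=> 0); congr B.
by apply/funext => t; rewrite big_ord1 expr0z mulr1.
Qed.

(** Elements of [B] are continuous, hence bounded and square integrable, so only the condition on
    coefficients is left. *)
Lemma BminusP f : Bminus B f <-> B f /\ forall k, 0 < k -> fourier f k = 0.
Proof.
split=> [[Bf [_ [_ h]]]|[Bf h]]; first by split.
by split=> //; split; [exact/ccontinuous_Loo/Bc|split=> //; exact/ccontinuous_L2/Bc].
Qed.

Lemma BplusP f : Bplus B f <-> B f /\ forall k, k < 0 -> fourier f k = 0.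
Proof.
split=> [[Bf [_ [_ h]]]|[Bf h]]; first by split.
by split=> //; split; [exact/ccontinuous_Loo/Bc|split=> //; exact/ccontinuous_L2/Bc].
Qed.

Lemma Bplus_tilde f : Bplus B f -> Bminus B (fun t => f (cinv t)).
Proof.
move=> /BplusP[Bf f0]; apply/BminusP; split; first exact: sa_tilde hB _ Bf.
move=> k k0; rewrite fourier_cinv; last exact/ccontinuous_measurable/Bc.
by rewrite f0// oppr_lt0.
Qed.

(** What [B] and [Bminus B] share: closure under the polynomial expressions that produce matrix
    products, determinants and adjugates. *)
Record subalg (S : set (circle R -> C)) : Prop := {
  sg_cst : forall c, S (fun=> c);
  sg_add : forall f g, S f -> S g -> S (fun t => f t + g t);
  sg_mul : forall f g, S f -> S g -> S (fun t => f t * g t) }.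

Lemma subalg_B : subalg B.
Proof. by split; [exact: B_cst|exact: ba_add bB|exact: ba_mul bB]. Qed.

Lemma subalg_Bminus : subalg (Bminus B).
Proof.
split=> [c|f g /BminusP[Bf f0] /BminusP[Bg g0]|f g /BminusP[Bf f0] /BminusP[Bg g0]].
- apply/BminusP; split; first exact: B_cst.
  move=> k k0; have -> : (fun _ : circle R => c) = (fun t : circle R => c * (t : C) ^ 0).
    by apply/funext => t; rewrite expr0z mulr1.
  rewrite fourierZ; last exact: L2_exprz.
  by rewrite fourier_exprz gt_eqF// mulr0.
- apply/BminusP; split; first exact: ba_add bB _ _ Bf Bg.
  move=> k k0; rewrite fourierD ?f0 ?g0 ?addr0//; exact/ccontinuous_L2/Bc.
- apply/BminusP; split; first exact: ba_mul bB _ _ Bf Bg.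
  have [M bM] := ccontinuous_bounded (Bc Bf).
  by apply: (fourier_mul_le0 (M := M)) => //; exact/ccontinuous_L2/Bc.
Qed.

Section Subalg.
Variables (S : set (circle R -> C)) (hS : subalg S).

Lemma subalg_sum (I : Type) (s : seq I) (P : pred I) (F : I -> circle R -> C) :
  (forall i, P i -> S (F i)) -> S (fun t => \sum_(i <- s | P i) F i t).
Proof.
move=> hF; elim: s => [|i s ih].
  by have := sg_cst hS 0; congr S; apply/funext => t; rewrite big_nil.
have [Pi|nPi] := boolP (P i); last first.
  by move: ih; congr S; apply/funext => t; rewrite big_cons (negbTE nPi).
by have := sg_add hS (hF i Pi) ih; congr S; apply/funext => t; rewrite big_cons Pi.
Qed.

Lemma subalg_prod (I : Type) (s : seq I) (F : I -> circle R -> C) :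
  (forall i, S (F i)) -> S (fun t => \prod_(i <- s) F i t).
Proof.
move=> hF; elim: s => [|i s ih].
  by have := sg_cst hS 1; congr S; apply/funext => t; rewrite big_nil.
by have := sg_mul hS (hF i) ih; congr S; apply/funext => t; rewrite big_cons.
Qed.

Lemma subalg_det n (A : circle R -> 'M[C]_n) : mx_over S A -> S (fun t => \det (A t)).
Proof.
move=> hA; apply: (@subalg_sum _ _ predT (fun (s : {perm 'I_n}) t =>
  (-1) ^+ s * \prod_i A t i (s i))) => s _.
apply: (sg_mul hS); first exact: (sg_cst hS).
by apply: (@subalg_prod _ _ (fun i t => A t i (s i))) => i; exact: hA.
Qed.

Lemma subalg_adj n (A : circle R -> 'M[C]_n) : mx_over S A -> mx_over S (fun t => \adj (A t)).
Proof.
move=> hA i j.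
have -> : (fun t => (\adj (A t)) i j) =
    (fun t => (-1) ^+ (j + i) * \det (row' j (col' i (A t)))).
  by apply/funext => t; rewrite mxE.
apply: (sg_mul hS); first exact: (sg_cst hS).
apply: subalg_det => k l; have := hA (lift j k) (lift i l).
by congr S; apply/funext => t; rewrite !mxE.
Qed.

Lemma subalg_mxD n (A A' : circle R -> 'M[C]_n) : mx_over S A -> mx_over S A' ->
  mx_over S (fun t => A t + A' t).
Proof.
move=> hA hA' i j; have := sg_add hS (hA i j) (hA' i j).
by congr S; apply/funext => t; rewrite mxE.
Qed.

Lemma subalg_mxM n (A A' : circle R -> 'M[C]_n) : mx_over S A -> mx_over S A' ->
  mx_over S (fun t => A t *m A' t).
Proof.
move=> hA hA' i j.
have -> : (fun t => (A t *m A' t) i j) = (fun t => \sum_l A t i l * A' t l j).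
  by apply/funext => t; rewrite mxE.
by apply: (@subalg_sum _ _ predT (fun l t => A t i l * A' t l j)) => l _; exact: (sg_mul hS).
Qed.

Lemma subalg_mx_cst n (A : 'M[C]_n) : mx_over S (fun=> A).
Proof. by move=> i j; exact: (sg_cst hS). Qed.

Lemma GLmxM n (A A' : circle R -> 'M[C]_n) : GLmx S A -> GLmx S A' ->
  GLmx S (fun t => A t *m A' t).
Proof.
move=> [hA [K hK AK]] [hA' [K' hK' AK']]; split; first exact: subalg_mxM.
exists (fun t => K' t *m K t); first exact: subalg_mxM.
move=> t; have [h1 h2] := AK t; have [h3 h4] := AK' t; split.
  by rewrite -mulmxA (mulmxA (A' t)) h3 mul1mx.
by rewrite -mulmxA (mulmxA (K t)) h2 mul1mx.
Qed.

Lemma GLmx_cst n (A : 'M[C]_n) : A \in unitmx -> GLmx S (fun=> A).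
Proof.
move=> uA; split; first exact: subalg_mx_cst.
exists (fun=> invmx A); first exact: subalg_mx_cst.
by move=> t; rewrite mulmxV// mulVmx.
Qed.

(** By Cramer's rule the inverse is then polynomial in the entries and stays in [S]. For [Bminus B]
    a nonvanishing determinant would be too weak, as t^(-1) shows. *)
Lemma GLmx_det_cst n (A : circle R -> 'M[C]_n) (c : C) : mx_over S A -> c != 0 ->
  (forall t, \det (A t) = c) -> GLmx S A.
Proof.
move=> hA c0 hdet; split=> //.
exists (fun t => (c^-1)%:M *m \adj (A t)).
  by apply: subalg_mxM; [exact: subalg_mx_cst|exact: subalg_adj].
have e t : (c^-1)%:M *m \adj (A t) *m A t = 1%:M.
  by rewrite -mulmxA mul_adj_mx hdet -scalar_mxM mulVf.
by move=> t; rewrite e; split=> //; exact: mulmx1C.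
Qed.

End Subalg.

Lemma GLmx_tilde n (A : circle R -> 'M[C]_n) : GLmx (Bplus B) A ->
  GLmx (Bminus B) (fun t => A (cinv t)).
Proof.
move=> [hA [K hK AK]]; split=> [i j|]; first exact: Bplus_tilde (hA i j).
by exists (fun t => K (cinv t)) => [i j|t]; [exact: Bplus_tilde (hK i j)|exact: AK].
Qed.

Lemma GLmx_tildeB n (A : circle R -> 'M[C]_n) : GLmx B A -> GLmx B (fun t => A (cinv t)).
Proof.
move=> [hA [K hK AK]]; split=> [i j|]; first exact: sa_tilde hB _ (hA i j).
by exists (fun t => K (cinv t)) => [i j|t]; [exact: sa_tilde hB _ (hK i j)|exact: AK].
Qed.

Lemma GLmx_inv n (S : set (circle R -> C)) (A : circle R -> 'M[C]_n) : GLmx S A ->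
  GLmx S (fun t => invmx (A t)).
Proof.
move=> [hA [K hK AK]]; have -> : (fun t => invmx (A t)) = K.
  by apply/funext => t; apply: invmx_eq; case: (AK t).
by split=> //; exists A => // t; case: (AK t).
Qed.

Lemma GLmx_unit n (S : set (circle R -> C)) (A : circle R -> 'M[C]_n) t :
  GLmx S A -> A t \in unitmx.
Proof. by move=> [_ [K _ /(_ t)[/mulmx1_unit[]]]]. Qed.

Lemma ccontinuous_eq0 f : ccontinuous f -> (forall k, fourier f k = 0) -> forall t, f t = 0.
Proof.
move=> cf f0; apply: ccontinuous_ae_eq0 => //.
by apply: fourier_eq0_ae => //; exact: ccontinuous_L2.
Qed.

Lemma ccontinuous_const f : ccontinuous f -> (forall k, k != 0 -> fourier f k = 0) ->
  forall t, f t = fourier f 0.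
Proof.
move=> cf f0 t; apply/eqP; rewrite -subr_eq0; apply/eqP.
pose c := - fourier f 0.
have hc : Lp 2%:E (fun t : circle R => c * (t : C) ^ 0) by apply: L2Z; exact: L2_exprz.
have cg : ccontinuous (fun t : circle R => f t + c * (t : C) ^ 0).
  rewrite (_ : (fun _ => _) = (fun t => f t + c)); last first.
    by apply/funext => s; rewrite expr0z mulr1.
  exact: (ccontinuousD cf (@ccontinuous_cst _ c)).
have -> : f t - fourier f 0 = f t + c * (t : C) ^ 0 by rewrite expr0z mulr1.
apply: (ccontinuous_eq0 cg) => k.
rewrite fourierD//; last exact: ccontinuous_L2.
rewrite fourierZ ?fourier_exprz; last exact: L2_exprz.
have [->|k0] := eqVneq k 0; first by rewrite mulr1 addrN.
by rewrite mulr0 addr0 f0.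
Qed.

Section NormalForm.
Variables (n : nat) (kappa : 'I_n -> int) (U : circle R -> 'M[C]_n).
Hypothesis GU : GLmx (Bminus B) U.
Hypothesis ULU : forall t, U t *m kdiag kappa t *m U (cinv t) = kdiag kappa t.

(* Compare the Fourier supports of both sides of
   [U t i j = t^(kappa i - kappa j) * U^-1(1/t) i j]. *)
Lemma Bminus_kdiag_block :
  (forall i j t, kappa j < kappa i -> U t i j = 0) /\
  (forall i j t s, kappa i = kappa j -> U t i j = U s i j).
Proof.
have [hU [U' hU' UU']] := GU.
have ULV t : U t *m kdiag kappa t = kdiag kappa t *m U' (cinv t).
  by rewrite -[in RHS](ULU t) -(mulmxA (U t *m _)) (UU' (cinv t)).1 mulmx1.
have Uk i j t : U t i j = (t : C) ^ (kappa i - kappa j) * U' (cinv t) i j.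
  have /matrixP/(_ i j) := ULV t; rewrite mul_mx_diag mul_diag_mx.
  rewrite [LHS]mxE [RHS]mxE [X in _ * X = _]mxE [X in _ = X * _]mxE => e.
  rewrite expfzDr ?cval_neq0// mulrAC -e -mulrA -expfzDr ?cval_neq0// subrr.
  by rewrite expr0z mulr1.
have cU i j : ccontinuous (fun t => U t i j) by apply: Bc; case/BminusP: (hU i j).
have cU' i j : ccontinuous (fun t => U' t i j) by apply: Bc; case/BminusP: (hU' i j).
(* The left side has coefficients only at k <= 0, the right side only at k >= kappa i - kappa j. For
   kappa j <= kappa i these meet at most at k = 0, and only if the exponents are equal. *)
have fU i j k : kappa j <= kappa i -> (k != 0) || (kappa i != kappa j) ->
    fourier (fun t => U t i j) k = 0.
  move=> ij h; have [k0|k0] := ltrP 0 k; first by case/BminusP: (hU i j) => _; exact.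
  have -> : (fun t => U t i j) =
      (fun t : circle R => (t : C) ^ (kappa i - kappa j) * U' (cinv t) i j).
    by apply/funext => t; exact: Uk.
  rewrite fourier_exprzM (@fourier_cinv _ (fun t => U' t i j)); last first.
    exact/ccontinuous_measurable/cU'.
  case/BminusP: (hU' i j) => _; apply.
  by move: (kappa i) (kappa j) ij h k0; clear; lia.
split=> [i j t ij|i j t s ij].
  apply: (ccontinuous_eq0 (cU i j)) => k; apply: fU; first exact: ltW.
  by rewrite (gt_eqF ij) orbT.
have h := ccontinuous_const (cU i j) _.
by rewrite !h// => k k0; apply: fU; rewrite ?ij// k0.
Qed.

Lemma Bminus_kdiag_normal_form : exists rho kappa' (X : circle R -> 'M[C]_n),
  [/\ forall k, rho k \in [:: -1; 1], GLmx (Bminus B) X &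
    forall t, U t *m kdiag kappa t *m X (cinv t) =
      X t *m (diag_mx (\row_k (rho k)%:~R) *m kdiag kappa' t)].
Proof.
have hm := subalg_Bminus; have [hU _] := GU; have [Ult Ueq] := Bminus_kdiag_block.
(* The point 1 is fixed by inversion and L is the identity there, so U L U~ = L becomes U(1)^2 =
   I. *)
pose t1 : circle R := expi 0.
have U1 : U t1 *m U t1 = 1%:M.
  have := ULU t1; have -> : kdiag kappa t1 = 1%:M.
    rewrite /kdiag -[RHS]diag_const_mx; congr diag_mx; apply/rowP => j.
    by rewrite [LHS]mxE [RHS]mxE /t1 /= cos0 sin0 exp1rz.
  rewrite mulmx1 (_ : cinv t1 = t1)//.
  by apply: val_inj; rewrite /= cos0 sin0 invr1.
pose u i j := U t1 i j.
pose U0 : 'M[C]_n := \matrix_(i, j) if kappa i == kappa j then u i j else 0.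
have U0E i j : U0 i j = if kappa i == kappa j then u i j else 0 by rewrite mxE.
have U0k i j : kappa i != kappa j -> U0 i j = 0 by rewrite U0E => /negbTE ->.
(* Within a diagonal block [U] is constant and agrees with [U0], so U(t) U0 has the same entries
   there as U(1)^2; below the diagonal blocks both are zero. *)
have UU0 t i j : kappa j <= kappa i -> (U t *m U0) i j = ((i == j)%:R : C).
  rewrite le_eqVlt => /orP[/eqP ji|ji].
    have <- : (U t1 *m U t1) i j = (i == j)%:R by rewrite U1 mxE.
    rewrite [LHS]mxE [RHS]mxE; apply: eq_bigr => l _; rewrite U0E.
    case: (eqVneq (kappa l) (kappa j)) => [lj|lj].
      by rewrite (Ueq i l t t1)// lj.
    rewrite mulr0; have [il|li|il] := ltrgtP (kappa i) (kappa l).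
    - by rewrite (Ult l j) ?mulr0// ji.
    - by rewrite (Ult i l) ?mul0r.
    - by rewrite -il ji eqxx in lj.
  rewrite [LHS]mxE big1 => [|l _]; last first.
    rewrite U0E; case: (eqVneq (kappa l) (kappa j)) => [lj|_]; last by rewrite mulr0.
    by rewrite Ult ?mul0r// lj.
  by case: eqP => // ijE; rewrite ijE ltxx in ji.
have U00 : U0 *m U0 = 1%:M.
  apply/matrixP => i j; rewrite [RHS]mxE.
  have [ij|ij] := eqVneq (kappa i) (kappa j).
    rewrite -(UU0 t1) ?ij// [LHS]mxE [RHS]mxE; apply: eq_bigr => l _.
    rewrite !U0E; case: (eqVneq (kappa i) (kappa l)) => // il.
    by rewrite mul0r [kappa l == _]eq_sym -ij (negbTE il) mulr0.
  rewrite [LHS]mxE big1 => [|l _]; last first.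
    have [il|il] := eqVneq (kappa i) (kappa l); last by rewrite U0k// mul0r.
    by rewrite (U0k l j) ?mulr0// -il.
  by case: eqP => // ijE; rewrite ijE eqxx in ij.
clearbody U0.
have [P [rho [kappa' [uP rhoP PU Pk]]]] := kappa_codiagonalize U00 U0k.
set Rd : 'M[C]_n := diag_mx (\row_k (rho k)%:~R) in PU.
pose Cm := invmx P.
have UC : U0 *m Cm = Cm *m Rd.
  exact: (mulmx_invmxC uP PU).
have LC t : kdiag kappa t *m Cm = Cm *m kdiag kappa' t.
  have PL : P *m kdiag kappa t = kdiag kappa' t *m P.
    apply/matrixP => j i; rewrite mul_mx_diag mul_diag_mx.
    rewrite [LHS]mxE [RHS]mxE [X in _ * X = _]mxE [X in _ = X * _]mxE.
    by have [->|/Pk ->] := eqVneq (P j i) 0; rewrite ?mul0r ?mulr0// mulrC.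
  exact: (mulmx_invmxC uP PL).
have Rd2 : Rd *m Rd = 1%:M.
  rewrite mulmx_diag -[RHS]diag_const_mx; congr diag_mx; apply/rowP => j.
  rewrite [LHS]mxE [RHS]mxE [X in X * _]mxE [X in _ * X]mxE -intrM.
  by have := rhoP j; rewrite !inE => /orP[]/eqP ->.
have RL t : Rd *m kdiag kappa' t = kdiag kappa' t *m Rd by exact: diag_mxC.
(* [X P = 1 + U U0] is triangular along [kappa] with diagonal blocks [2]. *)
pose X t := Cm + U t *m Cm *m Rd.
have XE t : U t *m kdiag kappa t *m X (cinv t) = X t *m (Rd *m kdiag kappa' t).
  exact: (mulmx_normal_form (ULU t) (LC t) (RL t) Rd2).
have hX : mx_over (Bminus B) X.
  apply: (subalg_mxD hm); first exact: (subalg_mx_cst hm).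
  by apply: (subalg_mxM hm); [apply: (subalg_mxM hm) => //|]; exact: (subalg_mx_cst hm).
have XP t : X t *m P = 1%:M + U t *m U0.
  rewrite /X mulmxDl /Cm mulVmx//; congr (_ + _).
  by rewrite -(mulmxA (U t)) -/Cm -UC mulmxA -(mulmxA (U t *m U0)) mulVmx// mulmx1.
have detX t : \det (X t) = 2 ^+ n / \det P.
  have uPd : \det P \is a GRing.unit by rewrite -unitmxE.
  rewrite -[LHS](mulrK uPd) -det_mulmx XP; congr (_ / _).
  apply: (@det_kappa_triangular _ n kappa 2) => i j ij.
    rewrite [LHS]mxE UU0 ?(ltW ij)// mxE.
    by case: eqP ij => [->|_ _]; rewrite ?ltxx// addr0.
  by rewrite [LHS]mxE UU0 ?ij// mxE; case: (i == j); rewrite ?addr0.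
exists rho, kappa', X; split=> //.
apply: (GLmx_det_cst hm hX _ detX); apply: mulf_neq0.
  by rewrite expf_neq0// pnatr_eq0.
by rewrite invr_neq0// -unitfE -unitmxE.
Qed.

End NormalForm.

Lemma antisym_factorization_exists n (F : circle R -> 'M[C]_n) : GLmx B F ->
  (forall t, F t *m F (cinv t) = 1%:M) ->
  exists rho kappa : 'I_n -> int, antisym_factorization B F rho kappa.
Proof.
move=> GF FF; have [Am [Ap [kappa [GAm GAp FE0]]]] := sa_factorization hB GF.
have FE t : F t = Am t *m kdiag kappa t *m Ap t := FE0 t.
have hm := subalg_Bminus.
pose Apt t := Ap (cinv t); have GApt : GLmx (Bminus B) Apt := GLmx_tilde GAp.
have ApE t : Ap t = Apt (cinv t) by rewrite /Apt cinvK.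
clearbody Apt; pose U t := Apt t *m Am t.
have GU : GLmx (Bminus B) U := GLmxM hm GApt GAm.
have uA t : Apt t \in unitmx := GLmx_unit t GApt.
have ULU t : U t *m kdiag kappa t *m U (cinv t) = kdiag kappa t.
  have e : U t *m kdiag kappa t *m U (cinv t) *m kdiag kappa (cinv t) =
      Apt t *m (F t *m F (cinv t)) *m invmx (Apt t).
    by rewrite !FE !ApE cinvK; exact: mulmx_conj.
  rewrite FF mulmx1 mulmxV// in e.
  by rewrite -[LHS]mulmx1 -(mulmx1C (kdiagV kappa t)) mulmxA e mul1mx.
have [rho [kappa' [X [rhoP GX XE]]]] := Bminus_kdiag_normal_form GU ULU.
exists rho, kappa'; split=> //.
exists (fun t => invmx (Apt t) *m X t).
  by apply: (GLmxM hm) => //; exact: GLmx_inv.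
move=> t; have uX s : X s \in unitmx := GLmx_unit s GX.
have -> : diag_mx (\row_k ((rho k)%:~R * (t : C) ^ kappa' k)) =
    diag_mx (\row_k (rho k)%:~R) *m kdiag kappa' t.
  by rewrite mulmx_diag; congr diag_mx; apply/rowP => k; rewrite [LHS]mxE [RHS]mxE !mxE.
have -> : invmx (invmx (Apt (cinv t)) *m X (cinv t)) = invmx (X (cinv t)) *m Apt (cinv t).
  by apply: invmx_eq; rewrite mulmxA mulmxK// mulVmx.
rewrite FE ApE; apply/esym.
exact: (@mulmx_regroup _ _ (Apt t) (Apt (cinv t)) _ (kdiag kappa t) (Am t) _ _
  (uA t) (uX (cinv t)) (esym (XE t))).
Qed.

End Algebra.

(** * Characteristic pairs *)

Section Assembly.
Variables (R : realType) (B : set (circle R -> R[i])) (nB : (circle R -> R[i]) -> R).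
Hypothesis hB : standing_assumptions B nB.
Local Notation C := R[i].

Lemma GLmx_cmx n (F : circle R -> 'M[C]_n) : mx_over B F -> cmx F.
Proof. by move=> hF i j; exact/(sa_continuous hB)/hF. Qed.

Lemma antisym_factors n (F : circle R -> 'M[C]_n) rho kappa :
  antisym_factorization B F rho kappa -> exists Fm Fm' : circle R -> 'M[C]_n,
  [/\ cmx Fm /\ cmx Fm', antianalytic Fm /\ antianalytic Fm',
      forall t, Fm t *m Fm' t = 1%:M, forall t, Fm' t *m Fm t = 1%:M &
      forall t, F t = Fm t *m Dmx rho kappa t *m Fm' (cinv t)].
Proof.
move=> [_ [Fm [hFm [Fm' hFm' FF]] FE]]; exists Fm, Fm'.
split; first by split=> i j; apply: (sa_continuous hB);
  [case: (hFm i j)|case: (hFm' i j)].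
- by split=> i j k k0; [have /(BminusP hB)[_] := hFm i j|have /(BminusP hB)[_] := hFm' i j]; exact.
- by move=> t; case: (FF t).
- by move=> t; case: (FF t).
- by move=> t; rewrite FE (invmx_eq (FF (cinv t)).1).
Qed.

Lemma split_antisym_factorization n (F : circle R -> 'M[C]_n) : GLmx B F ->
  (forall t, F t *m F (cinv t) = 1%:M) -> split_inj F -> split_surj F ->
  antisym_factorization_in B F [:: (-1, -1); (-1, 0); (1, 0); (1, 1)].
Proof.
move=> GF FF Fi Fs; have [rho [kappa Fa]] := antisym_factorization_exists hB GF FF.
exists rho, kappa; split=> // k; have [rhoP _] := Fa.
have [Fm [Fm' [[cF cF'] [aF aF'] FF' F'F FE]]] := antisym_factors Fa.
exact: (split_index rhoP cF cF' aF aF' F'F FE Fi Fs).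
Qed.

Lemma antisym_factorization_split n (F : circle R -> 'M[C]_n) :
  antisym_factorization_in B F [:: (-1, -1); (-1, 0); (1, 0); (1, 1)] ->
  exists2 E, split_inj F & split_section F E.
Proof.
move=> [rho [kappa [Fa hrk]]]; have [rhoP _] := Fa.
have [Fm [Fm' [[cF cF'] [aF aF'] FF' F'F FE]]] := antisym_factors Fa.
by have [Fi Fs] := factor_split rhoP cF cF' aF aF' FF' F'F FE hrk; eexists; eauto.
Qed.

(** A change of sign is absorbed by rho, which relates the list for the splitting of -G to the one
    for [G]. *)
Lemma antisym_factorization_in_opp n (F : circle R -> 'M[C]_n) (s s' : seq (int * int)) :
  (forall p, p \in s -> (- p.1, p.2) \in s') ->
  antisym_factorization_in B F s -> antisym_factorization_in B (fun t => - F t) s'.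
Proof.
move=> ss' [rho [kappa [[rhoP [Fm GF FE]] hrk]]].
exists (fun k => - rho k), kappa; split; last first.
  by move=> k; exact: (ss' (rho k, kappa k)).
split=> [k|].
  by have := rhoP k; rewrite !inE => /orP[]/eqP ->; rewrite ?opprK eqxx ?orbT.
exists Fm => // t; rewrite FE -mulNmx -mulmxN; congr (_ *m _ *m _).
apply/matrixP => i j; rewrite !mxE; case: (i == j); rewrite ?mulr1n ?mulr0n ?oppr0//.
by rewrite rmorphN mulNr.
Qed.

End Assembly.

Theorem corollary5p5 (R : realType)
    (B : set (circle R -> R[i])) (nB : (circle R -> R[i]) -> R)
    (hB : standing_assumptions B nB)
    (N : nat) (hN : (0 < N)%N)
    (A : circle R -> 'M[R[i]]_(N + N)) (hA : GLmx B A) :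
  (invertible_operator (Phi A) <->
     antisym_factorization_in B
       (fun t => A t *m Wmx N *m invmx (A (cinv t)))
       [:: (-1, -1); (-1, 0); (1, 0); (1, 1)]) /\
  (invertible_operator (Psi A) <->
     antisym_factorization_in B
       (fun t => invmx (A (cinv t)) *m Wmx N *m A t)
       [:: (1, -1); (-1, 0); (1, 0); (-1, 1)]).
Proof.
have [mA [A' mA' AA0]] := hA.
have AA' t : A t *m A' t = 1%:M := (AA0 t).1.
have A'A t : A' t *m A t = 1%:M := (AA0 t).2.
have GA' : GLmx B A' by split=> //; exists A => // t; rewrite A'A AA'.
have cA : cmx A := GLmx_cmx hB mA; have cA' : cmx A' := GLmx_cmx hB mA'.
have iA t : invmx (A (cinv t)) = A' (cinv t) := invmx_eq (AA' (cinv t)).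
have WW := @Wmx_sqr R N.
have uW : (Wmx N : 'M[R[i]]_(N + N)) \in unitmx := (mulmx1_unit WW).1.
have sB := subalg_B hB; have GW := GLmx_cst sB uW.
pose F t := A t *m Wmx N *m A' (cinv t).
pose G t := A' (cinv t) *m Wmx N *m A t.
have GF : GLmx B F by apply: (GLmxM sB); [exact: (GLmxM sB)|exact: (GLmx_tildeB hB)].
have GG : GLmx B (fun t => - G t).
  have := GLmxM sB (GLmxM sB (GLmx_tildeB hB GA') (GLmx_cst sB (_ : - Wmx N \in unitmx))) hA.
  rewrite (_ : - Wmx N \in unitmx); first last.
    by apply: (proj1 (@mulmx1_unit _ _ _ (- Wmx N) _)); rewrite mulNmx mulmxN opprK.
  move=> /(_ isT); congr GLmx; apply/funext => t.
  by rewrite mulmxN mulNmx.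
have FF t : F t *m F (cinv t) = 1%:M.
  rewrite /F cinvK !mulmxA -(mulmxA (A t *m _)) A'A mulmx1 -(mulmxA (A t)) WW mulmx1.
  exact: AA'.
have GGn t : - G t *m - G (cinv t) = 1%:M.
  rewrite mulNmx mulmxN opprK /G cinvK !mulmxA -(mulmxA (A' (cinv t) *m _)) AA' mulmx1.
  by rewrite -(mulmxA (A' (cinv t))) WW mulmx1 A'A.
have -> : (fun t => A t *m Wmx N *m invmx (A (cinv t))) = F.
  by apply/funext => t; rewrite iA.
have -> : (fun t => invmx (A (cinv t)) *m Wmx N *m A t) = G.
  by apply/funext => t; rewrite iA.
split; split.
- move=> /(invertible_Phi_split cA cA' AA' A'A)[Fi Fs].
  exact: (split_antisym_factorization hB GF FF Fi Fs).
- move=> /(antisym_factorization_split hB)[E Fi Fs].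
  exact: (split_invertible_Phi cA cA' AA' A'A Fi Fs).
(* The splitting concerns -G, so the factorization found for -G is carried back to [G] by reversing
   every rho. *)
- move=> /(invertible_Psi_split cA AA' A'A)[Gi Gs].
  have := split_antisym_factorization hB GG GGn Gi Gs.
  move=> /(antisym_factorization_in_opp (s' := [:: (1, -1); (-1, 0); (1, 0); (-1, 1)])).
  under eq_fun do rewrite opprK; apply=> p.
  by rewrite !inE => /or4P[]/eqP ->.
- move=> /(antisym_factorization_in_opp (s' := [:: (-1, -1); (-1, 0); (1, 0); (1, 1)])) h.
  have /(antisym_factorization_split hB)[E Gi Gs] : antisym_factorization_in B
      (fun t => - G t) [:: (-1, -1); (-1, 0); (1, 0); (1, 1)].
    by apply: h => p; rewrite !inE => /or4P[]/eqP ->.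
  exact: (split_invertible_Psi cA cA' AA' A'A Gi Gs).
Qed.
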